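(* There exists an absolute constant $C$ such that the following holds. Let $\mathcal{J}\subset Z^d$ and let $\{X_i, i\in\mathcal{J}\}$ be an $m$-dependent random field with zero means and $E|X_i|^p<\infty$ for all $i\in\mathcal{J}$, where $2<p\leq 3$. Then $$\sup_{z\in\mathbb{R}} |F(z) - \Phi(z)| \leq 75(10m+1)^{(p-1)d} \sum_{i \in \mathcal{J}} E|X_i|^p$$ and, for all $z\in\mathbb{R}$, $$|F(z) - \Phi(z)| \leq C(1+|z|)^{-p}\,19^{pd}(m+1)^{(p-1)d} \sum_{i \in \mathcal{J}} E|X_i|^p.$$
   Context: $d\geq 1$ and $Z^d$ denotes the $d$-dimensional space of positive integers, with distance $|i-j|=\max_{1\leq l\leq d}|i_l-j_l|$ between points $i=(i_1,\dots,i_d)$ and $j=(j_1,\dots,j_d)$, and $\rho(A,B)=\inf\{|i-j|: i\in A, j\in B\}$ for subsets $A,B$ of $Z^d$. For a finite subset $\mathcal{J}$ of $Z^d$ and a nonnegative integer $m$, a family $\{X_i, i\in\mathcal{J}\}$ of real random variables on a common probability space is an $m$-dependent random field if $\{X_i, i\in A\}$ and $\{X_j, j\in B\}$ are independent whenever $\rho(A,B)>m$, for any subsets $A,B$ of $\mathcal{J}$. $W=\sum_{i\in\mathcal{J}}X_i$, and it is assumed that $\mathrm{Var}(W)=1$. $F$ is the distribution function of $W$ and $\Phi$ is the standard normal distribution function. *)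

(* Defs.v *)
From HB Require Import structures.
From mathcomp Require Import all_boot all_order all_algebra finmap.
From mathcomp Require Import all_classical all_reals all_analysis measurable_realfun.

Set Implicit Arguments.
Unset Strict Implicit.
Unset Printing Implicit Defensive.

Import Order.TTheory GRing.Theory Num.Theory.
Import numFieldNormedType.Exports.

Local Open Scope classical_set_scope.
Local Open Scope ring_scope.

Definition posint := {n : nat | (0 < n)%N}.

(* The source takes the lattice Z^d to consist of points with positive integer
   coordinates. *)
Definition lattice (d : nat) := {ffun 'I_d -> posint}.

(* The subtraction inside `|_ - _|%N is the signed one of int. *)
Definition lattice_dist (d : nat) (i j : lattice d) : nat :=
  (\max_(l < d) `|val (i l) - val (j l)|)%N.

(* Valued in \bar R: it is +oo when A or B is empty. *)
Definition set_dist (R : realType) (d : nat) (A B : set (lattice d)) : \bar R :=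
  ereal_inf [set ((lattice_dist i j)%:R)%:E | i in A & j in B].

Definition sigma_family (disp : measure_display) (T : measurableType disp)
    (R : realType) (P : probability T R) (I : Type) (X : I -> {RV P >-> R})
    (A : set I) : set (set T) :=
  <<s \bigcup_(i in A) preimage_set_system setT (X i) measurable >>.

Definition indep_families (disp : measure_display) (T : measurableType disp)
    (R : realType) (P : probability T R) (I : Type) (X : I -> {RV P >-> R})
    (A B : set I) : Prop :=
  forall E F : set T, sigma_family X A E -> sigma_family X B F ->
    P (E `&` F) = (P E * P F)%E.

(* X is indexed by the whole lattice, but only its values on J matter. *)
Definition m_dependent (disp : measure_display) (T : measurableType disp)
    (R : realType) (P : probability T R) (d m : nat) (J : {fset lattice d})
    (X : lattice d -> {RV P >-> R}) : Prop :=
  forall A B : set (lattice d), A `<=` [set` J] -> B `<=` [set` J] ->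
    (m%:R%:E < set_dist R A B)%E -> indep_families X A B.

Definition field_sum (disp : measure_display) (T : measurableType disp)
    (R : realType) (P : probability T R) (d : nat) (J : {fset lattice d})
    (X : lattice d -> {RV P >-> R}) : {RV P >-> R} :=
  (\sum_(i <- J) (X i : {mfun T >-> R}))%R.

Definition abs_moment (disp : measure_display) (T : measurableType disp)
    (R : realType) (P : probability T R) (p : R) (Y : {RV P >-> R}) : \bar R :=
  'E_P[fun w => `|Y w| `^ p].

Definition std_normal_cdf (R : realType) (z : R) : \bar R :=
  normal_prob 0 1 `]-oo, z].

(* Main.v *)
Require Import Defs.
From HB Require Import structures.
From mathcomp Require Import all_boot all_order all_algebra finmap.
From mathcomp Require Import all_classical all_reals all_analysis measurable_realfun.
From mathcomp Require Import zify ring lra.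

(** The proof is Stein's method under local dependence.  Let [h] be the
  indicator of a half line, made continuous over a length [al], and let [f]
  solve [f' w - w * f w = h w - E (h Z)] with [Z] standard normal.  The distance
  of [W] to the normal distribution is then measured by
  [E (f' (W)) - E (W * f (W))].  If [Y_i] is the sum of the field over the ball
  of radius [m] around [i], then [X_i] is centred and independent of [W - Y_i],
  so that [E (W * f (W))] is the sum of the [E (X_i * (f (W) - f (W - Y_i)))].
  Expanding [f] at the sum [Tc_i] over the sites far from [i], which is
  independent of [X_i * Y_i], and using that the [E (X_i * Y_i)] add up to the
  variance [1], one is left with the oscillation of [f'] over a translation of
  [W] by a local sum [V_i] ([stein_decomposition]).

  The part [w * f w] of [f'] is smooth, and its oscillation leads to terms like
  [E (|X_i * Y_i| * V_i ^ (p - 2))].  Young's and Jensen's inequalities bound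
  each of them by [third i], and the [third i] add up to at most
  [Gam = kap ^ (p - 1) * sum_i E |X_i| ^ p], where [kap] bounds the number of
  sites of a ball ([sum_third]).  The part [h] of [f'] oscillates only when [W]
  is close to the jump, and this requires the bound
  [P (a <= W <= b) <= C * (b - a + Gam)], even conditionally on the sites near
  [i].  It is obtained by testing [W] against the primitive of a trapezoid over
  the interval ([concentration]), first with an a priori constant, then by
  iteration ([conc_uniform]).  With [al = 16 * Gam] the constants add up to at
  most [75] ([uniform_bound]).

  Far from the origin, say at [z > 0], the same decomposition gains powers of
  [z]: the tails of [W] are of the order [z ^ (- 2 k) + Gam * z ^ (- p)] for
  each [k] ([tail_prob]), and the solution [f] is exponentially small to the
  left of [3 / 4 * z] ([sol_left]).  If [Gam > z ^ (- 24)] both tails at [z] are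
  already small enough; if not, smoothing over the length [Gam * z ^ 4] costs
  nothing, since the normal density is exponentially small at [z]
  ([far_smooth], [far_bound]).

  All this is carried out for fields on finite probability spaces, where
  expectations are finite sums.  A general field is the limit of such fields:
  round its values to a finite grid, centre and rescale.  Rounding is done site
  by site, hence preserves the dependence structure, and all moments converge by
  dominated convergence ([field_bound]).  On the lattice, a ball of radius
  [5 * m] has at most [(10 * m + 1) ^ d] points ([card_lattice_ball]). *)

Set Implicit Arguments.
Unset Strict Implicit.
Unset Printing Implicit Defensive.

Import Order.TTheory GRing.Theory Num.Theory.
Import numFieldNormedType.Exports.

Local Open Scope ring_scope.


(** * Elementary inequalities *)

(** Weighted inequality of the means: add the inequalities [ln u <= u - 1] at the ratios of
  [x `^ p], [y `^ p] and [z `^ p] to the right-hand side, with weights [1], [1] and [p - 2].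
  The weighted sum of these ratios is [p], which cancels the right-hand sides. *)
Lemma young3 (R : realType) (p x y z : R) : 2 < p -> 0 <= x -> 0 <= y -> 0 <= z ->
  x * y * z `^ (p - 2) <= (x `^ p + y `^ p + (p - 2) * z `^ p) / p.
Proof.
move=> p2 x0 y0 z0.
have p0 : 0 < p by lra.
set S := _ / p.
have X0 : 0 <= x `^ p by exact: powR_ge0.
have Y0 : 0 <= y `^ p by exact: powR_ge0.
have Z0 : 0 <= z `^ p by exact: powR_ge0.
have p20 : 0 <= p - 2 by lra.
have S0 : 0 <= S by rewrite divr_ge0 ?addr_ge0 ?mulr_ge0 //; lra.
have [->|xn] := eqVneq x 0; first by rewrite !mul0r.
have [->|yn] := eqVneq y 0; first by rewrite mulr0 !mul0r.
have [->|zn] := eqVneq z 0.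
  by rewrite powR0 ?mulr0//; lra.
have xp : 0 < x by rewrite lt_neqAle eq_sym xn.
have yp : 0 < y by rewrite lt_neqAle eq_sym yn.
have zp : 0 < z by rewrite lt_neqAle eq_sym zn.
have Xp : 0 < x `^ p by exact: powR_gt0.
have Yp : 0 < y `^ p by exact: powR_gt0.
have Zp : 0 < z `^ p by exact: powR_gt0.
have Sp : 0 < S.
  rewrite divr_gt0 // ltr_wpDr ?mulr_ge0 //; lra.
have L (t : R) : 0 < t -> ln (t `^ p / S) <= t `^ p / S - 1.
  move=> t0; have := @le_ln1Dx R (t `^ p / S - 1); rewrite subrKC; apply.
  by rewrite ltrBrDr addrC subrr divr_gt0 // powR_gt0.
have E (t : R) : 0 < t -> ln (t `^ p / S) = p * ln t - ln S.
  by move=> t0; rewrite ln_div ?posrE ?powR_gt0 // ln_powR.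
have := L _ xp; have := L _ yp; have := L _ zp.
rewrite !E // => hz hy hx.
have xyz0 : 0 < x * y * z `^ (p - 2) by rewrite !mulr_gt0 // powR_gt0.
have xy0 : 0 < x * y by rewrite mulr_gt0.
rewrite -ler_ln ?posrE // (@lnM _ (x * y)) ?posrE ?powR_gt0 // (@lnM _ x) ?posrE //.
rewrite ln_powR.
have sumE : x `^ p / S + y `^ p / S + (p - 2) * (z `^ p / S) = p.
  rewrite mulrA -!mulrDl.
  have -> : x `^ p + y `^ p + (p - 2) * z `^ p = p * S.
    by rewrite /S [RHS]mulrC divfK // gt_eqF.
  by rewrite mulfK // gt_eqF.
have hz' : (p - 2) * (p * ln z - ln S) <= (p - 2) * (z `^ p / S - 1).
  by rewrite ler_wpM2l.
have key : p * (ln x + ln y + (p - 2) * ln z - ln S) <= 0.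
  have -> : p * (ln x + ln y + (p - 2) * ln z - ln S) =
   (p * ln x - ln S) + (p * ln y - ln S) + (p - 2) * (p * ln z - ln S) by ring.
  apply: (le_trans (lerD (lerD hx hy) hz')).
  have -> : x `^ p / S - 1 + (y `^ p / S - 1) + (p - 2) * (z `^ p / S - 1) =
     x `^ p / S + y `^ p / S + (p - 2) * (z `^ p / S) - p by ring.
  by rewrite sumE subrr.
by move: key; rewrite pmulr_rle0 // subr_le0.
Qed.

Lemma powR_split (R : realType) (x a b : R) : 0 <= x -> 0 < a -> 0 < b ->
  x `^ (a + b) = x `^ a * x `^ b.
Proof.
move=> x0 a0 b0; case: (eqVneq x 0) => [->|xn].
  by rewrite !powR0 ?mul0r // gt_eqF // addr_gt0.
by rewrite powRD // xn implybT.
Qed.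

Lemma young2 (R : realType) (p x z : R) : 2 < p -> 0 <= x -> 0 <= z ->
  x * z `^ (p - 1) <= (x `^ p + (p - 1) * z `^ p) / p.
Proof.
move=> p2 x0 z0; have := young3 p2 x0 z0 z0.
have -> : x `^ p + z `^ p + (p - 2) * z `^ p = x `^ p + (p - 1) * z `^ p by ring.
apply: le_trans; rewrite -mulrA.
have -> : p - 1 = 1 + (p - 2) by ring.
have e1 : 0 < p - 2 by lra.
by rewrite (@powR_split _ z 1 (p - 2)) // powRr1.
Qed.

(** Jensen's inequality: sum [young2] over [A] with the average [s] as second argument. *)
Lemma pow_avg_le (R : realType) (I : finType) (A : {set I}) (u : I -> R) (p kap : R) :
  2 < p -> 0 < kap -> #|A|%:R <= kap -> (forall i, 0 <= u i) ->
  ((\sum_(i in A) u i) / kap) `^ p <= kap^-1 * \sum_(i in A) u i `^ p.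
Proof.
move=> p2 k0 Ak u0; set s := _ / kap.
have s0 : 0 <= s by rewrite divr_ge0 ?sumr_ge0 // ltW.
have p0 : 0 < p by lra.
have H i : p * (s `^ (p - 1) * u i) <= u i `^ p + (p - 1) * s `^ p.
  have := young2 p2 (u0 i) s0; rewrite ler_pdivlMr //; lra.
have H2 : p * (s `^ (p - 1) * (\sum_(i in A) u i)) <=
     \sum_(i in A) u i `^ p + (p - 1) * s `^ p * #|A|%:R.
  rewrite !mulr_sumr.
  have -> : (p - 1) * s `^ p * #|A|%:R = \sum_(i in A) (p - 1) * s `^ p.
    by rewrite sumr_const mulr_natr.
  by rewrite -big_split /=; apply: ler_sum => i _; exact: H.
have sE : \sum_(i in A) u i = kap * s by rewrite /s [RHS]mulrC divfK // gt_eqF.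
have sp : s `^ (p - 1) * s = s `^ p.
  have e1 : 0 < p - 1 by lra.
  by rewrite -{2}(subrK 1 p) (@powR_split _ s (p - 1) 1) // powRr1.
move: H2; rewrite sE.
have -> : p * (s `^ (p - 1) * (kap * s)) = p * kap * s `^ p by rewrite -sp; ring.
rewrite ler_pdivlMl // => H2.
have P0 : 0 <= s `^ p by exact: powR_ge0.
have : (p - 1) * s `^ p * #|A|%:R <= (p - 1) * s `^ p * kap.
  by rewrite ler_wpM2l // mulr_ge0 //; lra.
lra.
Qed.

Lemma sqr_le_powR (R : realType) (p x e : R) : 2 < p -> 0 <= x -> 0 < e ->
  x ^+ 2 <= e ^+ 2 + e `^ (2 - p) * x `^ p.
Proof.
move=> p2 x0 e0; have [xe|ex] := leP x e.
  by rewrite ler_wpDr ?mulr_ge0 ?powR_ge0 // lerXn2r ?nnegrE // ltW.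
rewrite ler_wpDl ?sqr_ge0 //.
have {2}-> : p = 2 + (p - 2) by ring.
rewrite (@powR_split _ x 2 (p - 2)) //; last by lra.
rewrite powR_mulrn // mulrCA ler_peMr ?sqr_ge0 //.
have -> : 2 - p = - (p - 2) by ring.
rewrite powRN mulrC ler_pdivlMr ?powR_gt0 // mul1r ge0_ler_powR ?nnegrE ?ltW//.
  by lra.
exact: lt_trans ex.
Qed.

(** All approximations below, whether by a grid of step [1 / L] or by a perturbation of
  size [1 / L], are removed in this way. *)
Lemma le_of_le_addeps (R : realType) (a b K : R) :
  (forall L : nat, (0 < L)%N -> a <= b + K / L%:R) -> a <= b.
Proof.
move=> H; apply/ler_addgt0Pr => e e0.
set L := (Num.bound (`|K| / e)).+1.
have L0 : 0 < L%:R :> R by rewrite ltr0n.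
apply: (le_trans (H L isT)); rewrite lerD2l ler_pdivrMr //.
apply: (le_trans (ler_norm K)); rewrite mulrC -ler_pdivrMr //.
have := @archi_boundP R (`|K| / e) (divr_ge0 (normr_ge0 _) (ltW e0)).
by move=> /ltW/le_trans; apply; rewrite ler_nat.
Qed.


(** * Expectation on a finite probability space *)

Section Expectation.
Variables (R : realType) (Om : finType) (mu : Om -> R).
Definition Ex (f : Om -> R) : R := \sum_w mu w * f w.

Lemma eq_Ex (f g : Om -> R) : f =1 g -> Ex f = Ex g.
Proof. by move=> fg; apply: eq_bigr => w _; rewrite fg. Qed.

Lemma ExD (f g : Om -> R) : Ex (fun w => f w + g w) = Ex f + Ex g.
Proof. by rewrite -big_split; apply: eq_bigr => w _; rewrite mulrDr. Qed.

Lemma ExN (f : Om -> R) : Ex (fun w => - f w) = - Ex f.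
Proof. by rewrite -sumrN; apply: eq_bigr => w _; rewrite mulrN. Qed.

Lemma ExB (f g : Om -> R) : Ex (fun w => f w - g w) = Ex f - Ex g.
Proof. by rewrite ExD ExN. Qed.

Lemma ExZ (c : R) (f : Om -> R) : Ex (fun w => c * f w) = c * Ex f.
Proof. by rewrite mulr_sumr; apply: eq_bigr => w _; rewrite mulrCA. Qed.

Lemma ExZr (c : R) (f : Om -> R) : Ex (fun w => f w * c) = Ex f * c.
Proof. by rewrite mulr_suml; apply: eq_bigr => w _; rewrite mulrA. Qed.

Lemma Ex_sum (I : Type) (r : seq I) (P : pred I) (f : I -> Om -> R) :
  Ex (fun w => \sum_(i <- r | P i) f i w) = \sum_(i <- r | P i) Ex (f i).
Proof.
by rewrite exchange_big; apply: eq_bigr => w _; rewrite mulr_sumr.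
Qed.

Hypothesis mu0 : forall w, 0 <= mu w.

Lemma ler_Ex (f g : Om -> R) : (forall w, f w <= g w) -> Ex f <= Ex g.
Proof. by move=> fg; apply: ler_sum => w _; rewrite ler_wpM2l. Qed.

Lemma Ex_ge0 (f : Om -> R) : (forall w, 0 <= f w) -> 0 <= Ex f.
Proof. by move=> f0; apply: sumr_ge0 => w _; rewrite mulr_ge0. Qed.

Lemma ler_norm_Ex (f : Om -> R) : `|Ex f| <= Ex (fun w => `|f w|).
Proof.
apply: (le_trans (ler_norm_sum _ _ _)); apply: ler_sum => w _.
by rewrite normrM ger0_norm.
Qed.

Hypothesis mu1 : \sum_w mu w = 1.

Lemma Ex_cst (c : R) : Ex (fun=> c) = c.
Proof. by rewrite /Ex -mulr_suml mu1 mul1r. Qed.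

End Expectation.

(** * Locally dependent fields on a finite probability space *)

(** The finite counterpart of measurability with respect to the coordinates in [A]. *)
Definition dep (I D : finType) (A : {set I}) (S : Type) (f : {ffun I -> D} -> S) :=
  forall w w' : {ffun I -> D}, (forall i, i \in A -> w i = w' i) -> f w = f w'.

(** The value at a site is read off from the coordinate of that site, so that a function of the
  field on [A] is a function of the coordinates in [A].  The bound [kap] is for balls of radius
  [5 * radius], the largest ones that occur: five steps are needed to separate [X i], the sums
  over neighbours, and the rest of the field from one another. *)
Record lfield (R : realType) := LField {
  site : finType;
  state : finType;
  mass : {ffun site -> state} -> R;
  coord : site -> state -> R;
  dist : site -> site -> nat;
  radius : nat;
  expo : R;
  kap : R;
  mass_ge0 : forall w, 0 <= mass w;
  mass1 : \sum_w mass w = 1;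
  dist_sym : forall i j, dist i j = dist j i;
  dist_refl : forall i, dist i i = 0%N;
  dist_tri : forall i j k, (dist i k <= dist i j + dist j k)%N;
  indep : forall (A B : {set site}) (f g : {ffun site -> state} -> R),
    (forall i j, i \in A -> j \in B -> (radius < dist i j)%N) ->
    dep A f -> dep B g ->
    Ex mass (fun w => f w * g w) = Ex mass f * Ex mass g;
  mean0 : forall i, Ex mass (fun w => coord i (w i)) = 0;
  var1 : Ex mass (fun w => (\sum_i coord i (w i)) ^+ 2) = 1;
  expo_bd : 2 < expo <= 3;
  card_bd : forall i, (#|[set j | (dist i j <= 5 * radius)%N]|)%:R <= kap
}.

Section Basics.
Variables (R : realType) (F : lfield R).

Let I := site F.
Definition conf := {ffun site F -> state F}.
Local Notation p := (expo F).
Local Notation k := (kap F).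

Definition E (f : conf -> R) : R := Ex (@mass R F) f.
Definition X (i : site F) (w : conf) : R := coord i (w i).
Definition SX (A : {set site F}) (w : conf) : R := \sum_(i in A) X i w.
Definition W (w : conf) : R := \sum_i X i w.
Definition ball (r : nat) (i : site F) : {set site F} :=
  [set j | (dist i j <= r * radius F)%N].
Definition Y (i : site F) : conf -> R := SX (ball 1 i).
Definition AX (A : {set site F}) (w : conf) : R := \sum_(i in A) `|X i w|.
Definition V (r : nat) (i : site F) : conf -> R := AX (ball r i).
Definition gam : R := \sum_i E (fun w => `|X i w| `^ p).
(** The size of all error terms.  Local sums with at most [kap] terms cost the factor
  [kap `^ (p - 1)] by Jensen's inequality. *)
Definition Gam : R := k `^ (p - 1) * gam.

Lemma ED f g : E (fun w => f w + g w) = E f + E g. Proof. exact: ExD. Qed.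
Lemma EN f : E (fun w => - f w) = - E f. Proof. exact: ExN. Qed.
Lemma EB f g : E (fun w => f w - g w) = E f - E g. Proof. exact: ExB. Qed.
Lemma EZ c f : E (fun w => c * f w) = c * E f. Proof. exact: ExZ. Qed.
Lemma EZr c f : E (fun w => f w * c) = E f * c. Proof. exact: ExZr. Qed.
Lemma E_sum (J : Type) (r : seq J) (P : pred J) (f : J -> conf -> R) :
  E (fun w => \sum_(i <- r | P i) f i w) = \sum_(i <- r | P i) E (f i).
Proof. exact: Ex_sum. Qed.
Lemma eq_E f g : f =1 g -> E f = E g. Proof. exact: eq_Ex. Qed.
Lemma ler_E f g : (forall w, f w <= g w) -> E f <= E g.
Proof. exact/ler_Ex/mass_ge0. Qed.
Lemma E_ge0 f : (forall w, 0 <= f w) -> 0 <= E f.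
Proof. exact/Ex_ge0/mass_ge0. Qed.
Lemma ler_norm_E f : `|E f| <= E (fun w => `|f w|).
Proof. exact/ler_norm_Ex/mass_ge0. Qed.
Lemma E_cst c : E (fun=> c) = c. Proof. exact/Ex_cst/mass1. Qed.

Lemma p2 : 2 < p. Proof. by case/andP: (expo_bd F). Qed.
Lemma p3 : p <= 3. Proof. by case/andP: (expo_bd F). Qed.
Lemma p0 : 0 < p. Proof. by have := p2; lra. Qed.

Lemma ball_mono r s i : (r <= s)%N -> ball r i \subset ball s i.
Proof.
move=> rs; apply/fintype.subsetP => j; rewrite !inE => /leq_trans; apply.
by rewrite leq_mul2r rs orbT.
Qed.

Lemma ball_refl r i : i \in ball r i.
Proof. by rewrite inE dist_refl. Qed.

Lemma ball_sym r i j : (j \in ball r i) = (i \in ball r j).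
Proof. by rewrite !inE dist_sym. Qed.

Lemma card_ball r i : (r <= 5)%N -> (#|ball r i|)%:R <= k.
Proof.
move=> r5; apply: le_trans (card_bd i); rewrite ler_nat.
by apply: subset_leq_card; exact: (@ball_mono r 5).
Qed.

Lemma site_inhab : exists i : site F, True.
Proof.
apply: contrapT => H.
have := var1 F; rewrite /Ex big1; first by move/eqP; rewrite eq_sym oner_eq0.
move=> w _; rewrite big1 ?expr0n ?mulr0 // => i _.
by case: H; exists i.
Qed.

Lemma kap_ge1 : 1 <= k.
Proof.
have [i _] := site_inhab; apply: le_trans (card_bd i).
rewrite ler1n; apply/card_gt0P; exists i; rewrite inE dist_refl//.
Qed.

Lemma kap_gt0 : 0 < k. Proof. exact: lt_le_trans kap_ge1. Qed.

Lemma kap_ge0 : 0 <= k. Proof. exact: ltW kap_gt0. Qed.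

Lemma dep_sub (A B : {set site F}) S (f : conf -> S) : A \subset B -> dep A f -> dep B f.
Proof. by move=> /fintype.subsetP AB fA w w' H; apply: fA => i /AB; exact: H. Qed.

Lemma dep1 (A : {set site F}) S S' (g : S -> S') (f : conf -> S) :
  dep A f -> dep A (fun w => g (f w)).
Proof. by move=> fA w w' H; rewrite (fA _ _ H). Qed.

Lemma dep2 (A : {set site F}) S S' S'' (h : S -> S' -> S'') (f : conf -> S) (g : conf -> S') :
  dep A f -> dep A g -> dep A (fun w => h (f w) (g w)).
Proof. by move=> fA gA w w' H; rewrite (fA _ _ H) (gA _ _ H). Qed.

Lemma dep_X (A : {set site F}) i : i \in A -> dep A (X i).
Proof. by move=> iA w w' H; rewrite /X H. Qed.

Lemma dep_SX (A B : {set site F}) : B \subset A -> dep A (SX B).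
Proof.
move=> /fintype.subsetP BA w w' H; apply: eq_bigr => i /BA iA; exact: (dep_X iA).
Qed.

Lemma dep_AX (A B : {set site F}) : B \subset A -> dep A (AX B).
Proof.
move=> /fintype.subsetP BA w w' H; apply: eq_bigr => i /BA iA; by rewrite (dep_X iA H).
Qed.

Lemma dep_V (A : {set site F}) r i : ball r i \subset A -> dep A (V r i).
Proof. exact: dep_AX. Qed.

Lemma dep_Y (A : {set site F}) i : ball 1 i \subset A -> dep A (Y i).
Proof. exact: dep_SX. Qed.

Lemma E_indep (A B : {set site F}) (f g : conf -> R) :
  (forall i j, i \in A -> j \in B -> (radius F < dist i j)%N) ->
  dep A f -> dep B g -> E (fun w => f w * g w) = E f * E g.
Proof. exact: indep. Qed.

Lemma W_split (A : {set site F}) w : W w = SX A w + SX (~: A) w.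
Proof.
rewrite /W (bigID (mem A)) /=; congr +%R.
by apply: eq_bigl => i; rewrite inE.
Qed.

Lemma norm_SX (A : {set site F}) w : `|SX A w| <= AX A w.
Proof. exact: ler_norm_sum. Qed.

Lemma AX_ge0 A w : 0 <= AX A w.
Proof. by apply: sumr_ge0 => i _. Qed.

Lemma V_ge0 r i w : 0 <= V r i w.
Proof. exact: AX_ge0. Qed.

Lemma AX_sub (A B : {set site F}) w : A \subset B -> AX A w <= AX B w.
Proof.
move=> AB; rewrite /AX [leRHS](big_setID A) /= (finset.setIidPr AB) lerDl.
by apply: sumr_ge0.
Qed.

Lemma V_mono r s i w : (r <= s)%N -> V r i w <= V s i w.
Proof. by move=> rs; exact/AX_sub/ball_mono. Qed.

Lemma Y_le_V r i w : (1 <= r)%N -> `|Y i w| <= V r i w.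
Proof. by move=> r1; apply: (le_trans (norm_SX _ _)); exact: V_mono. Qed.

Lemma E_X i : E (X i) = 0. Proof. exact: mean0. Qed.
Lemma E_W2 : E (fun w => W w ^+ 2) = 1. Proof. exact: var1. Qed.

(** Balls around [i] and around a point outside [ball t i] are more than [radius] apart when
  their radii add up to less than [t] units, by the triangle inequality. *)
Lemma far_ball (r s t : nat) i j a b : (r + s < t)%N -> j \notin ball t i ->
  a \in ball r i -> b \in ball s j -> (radius F < dist a b)%N.
Proof.
rewrite !inE -ltnNge => rst ij ai bj.
have H1 := dist_tri i a j; have H2 := dist_tri a b j.
rewrite (dist_sym b j) in H2.
have H3 : ((r + s).+1 * radius F <= t * radius F)%N by rewrite leq_mul2r rst orbT.
rewrite mulSn mulnDl in H3.
have := leq_trans H1 (leq_add (leqnn _) H2) => H4.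
have H5 := leq_trans ij H4.
rewrite ltnNge; apply/negP => H6.
have : (dist i a + (dist a b + dist j b) <= r * radius F + (radius F + s * radius F))%N.
  by rewrite leq_add // leq_add.
move=> H7; have := leq_trans H5 (leq_trans H7 _).
by rewrite addnCA => /(_ _ H3); rewrite ltnn.
Qed.

End Basics.


(** * Third-order moments *)

Section Moments.
Variables (R : realType) (F : lfield R).
Local Notation p := (expo F).
Local Notation k := (kap F).
Local Notation conf := (conf F).
Local Notation I := (site F).
Implicit Types (f g : conf -> R) (i j : site F) (A B : {set site F}).

Definition absmom i : R := E (fun w : conf => `|X i w| `^ p).
Definition avgmom i : R := E (fun w : conf => (V 5 i w / k) `^ p).
(** This is what Young's inequality yields for a product of [X i] with two local sums at [i]. *)
Definition third i : R := k `^ (p - 1) * ((absmom i + (p - 1) * avgmom i) / p).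

Lemma absmom_ge0 i : 0 <= absmom i.
Proof. by apply: E_ge0 => w; exact: powR_ge0. Qed.

Lemma avgmom_ge0 i : 0 <= avgmom i.
Proof. by apply: E_ge0 => w; exact: powR_ge0. Qed.

Lemma third_ge0 i : 0 <= third i.
Proof.
have := p2 F; rewrite /third => p2.
rewrite mulr_ge0 ?powR_ge0 // divr_ge0 //; last by lra.
by rewrite addr_ge0 ?absmom_ge0 // mulr_ge0 ?avgmom_ge0 //; lra.
Qed.

Lemma gam_ge0 : 0 <= gam F.
Proof. by apply: sumr_ge0 => i _; exact: absmom_ge0. Qed.

Lemma Gam_ge0 : 0 <= Gam F.
Proof. by rewrite mulr_ge0 ?powR_ge0 ?gam_ge0. Qed.

Lemma avgmom_le i : avgmom i <= k^-1 * \sum_(j in ball 5 i) absmom j.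
Proof.
rewrite /avgmom /absmom -E_sum -EZ; apply: ler_E => w.
by apply: pow_avg_le; rewrite ?p2 ?kap_gt0 // card_ball.
Qed.

Lemma avgmom_le_gam i : k `^ p * avgmom i <= Gam F.
Proof.
have H : avgmom i <= k^-1 * gam F.
  apply: (le_trans (avgmom_le i)); rewrite ler_wpM2l ?invr_ge0 ?kap_ge0 //.
  rewrite /gam [leRHS](bigID (mem (ball 5 i))) /= lerDl.
  by apply: sumr_ge0 => j _; exact: absmom_ge0.
apply: (le_trans (ler_wpM2l (powR_ge0 _ _) H)).
have p2 := p2 F; have k0 := kap_gt0 F.
rewrite /Gam mulrA ler_wpM2r ?gam_ge0 //.
rewrite -{1}(subrK 1 p) (@powR_split _ k (p - 1) 1) ?powRr1 ?kap_ge0 //; last by lra.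
by rewrite mulfK // gt_eqF.
Qed.

(** By symmetry of the distance, a site lies in at most [kap] balls of a given radius. *)
Lemma exchange_ball r (a : site F -> R) (B : {set site F}) : (r <= 5)%N -> (forall i, 0 <= a i) ->
  \sum_(i in B) \sum_(j in ball r i | j \in B) a j <= k * \sum_(j in B) a j.
Proof.
move=> r5 a0.
rewrite (exchange_big_dep (mem B)) /=; last by move=> i j _ /andP[].
rewrite mulr_sumr; apply: ler_sum => j jB.
rewrite sumr_const -[leLHS]mulr_natl ler_wpM2r //.
apply: le_trans (card_ball j r5); rewrite ler_nat.
apply: subset_leq_card; apply/fintype.subsetP => i.
by rewrite ball_sym => /and3P[].
Qed.

Lemma sum_avgmom : \sum_i avgmom i <= gam F.
Proof.
apply: le_trans (_ : \sum_i k^-1 * \sum_(j in ball 5 i) absmom j <= _).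
  by apply: ler_sum => i _; exact: avgmom_le.
rewrite -mulr_sumr ler_pdivrMl ?kap_gt0 //.
have := @exchange_ball 5 absmom [set: site F]%SET isT absmom_ge0.
rewrite (eq_bigl predT) => [|i]; last by rewrite inE.
rewrite [X in _ <= _ * X](eq_bigl predT) => [|i]; last by rewrite inE.
apply: le_trans; apply: ler_sum => i _.
by rewrite [leRHS](eq_bigl (fun j => j \in ball 5 i)) // => j; rewrite finset.in_setT andbT.
Qed.

Lemma sum_third : \sum_i third i <= Gam F.
Proof.
have p2 := p2 F.
rewrite -mulr_sumr /Gam ler_wpM2l ?powR_ge0 // -mulr_suml ler_pdivrMr; last by lra.
rewrite big_split /= -mulr_sumr.
have := sum_avgmom; rewrite -/(gam F) => H.
have : (p - 1) * (\sum_i avgmom i) <= (p - 1) * gam F by rewrite ler_wpM2l //; lra.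
rewrite -/(gam F); lra.
Qed.

Lemma young3_scaled (x y z : R) : 0 <= x -> 0 <= y -> 0 <= z ->
  x * y * z `^ (p - 2) <=
  k `^ (p - 1) * ((x `^ p + (y / k) `^ p + (p - 2) * (z / k) `^ p) / p).
Proof.
move=> x0 y0 z0; have k0 := kap_gt0 F; have p2 := p2 F.
have yk : 0 <= y / k by rewrite divr_ge0 // kap_ge0.
have zk : 0 <= z / k by rewrite divr_ge0 // kap_ge0.
apply: le_trans (ler_wpM2l (powR_ge0 _ _) (young3 p2 x0 yk zk)).
have -> : k `^ (p - 1) = k * k `^ (p - 2).
  have -> : p - 1 = 1 + (p - 2) by ring.
  rewrite (@powR_split _ k 1 (p - 2)) ?powRr1 ?kap_ge0 //; lra.
have {1}-> : z = k * (z / k) by rewrite mulrC divfK // gt_eqF.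
rewrite powRM ?kap_ge0 //.
have {1}-> : y = k * (y / k) by rewrite mulrC divfK // gt_eqF.
rewrite le_eqVlt; apply/orP; left; apply/eqP; ring.
Qed.

Lemma young3_sq (x z : R) : 0 <= x -> 0 <= z ->
  k * x ^+ 2 * z `^ (p - 2) <=
  k `^ (p - 1) * ((2 * x `^ p + (p - 2) * (z / k) `^ p) / p).
Proof.
move=> x0 z0; have k0 := kap_gt0 F; have p2 := p2 F.
have kx : 0 <= k * x by rewrite mulr_ge0 // kap_ge0.
have := young3_scaled x0 kx z0.
have -> : k * x / k = x by rewrite mulrAC divff ?mul1r // gt_eqF.
have -> : x * (k * x) = k * x ^+ 2 by ring.
by have -> : x `^ p + x `^ p = 2 * x `^ p by ring.
Qed.

(** Young's inequality with a constant in place of the third factor.  Taking the expectation over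
  that constant bounds the products of expectations that come from independence. *)
Lemma E_XY_cst i (c : R) : 0 <= c ->
  E (fun w : conf => `|X i w| * `|Y i w|) * c `^ (p - 2) <=
  k `^ (p - 1) * ((absmom i + avgmom i + (p - 2) * (c / k) `^ p) / p).
Proof.
move=> c0; have p2 := p2 F; have k0 := kap_gt0 F.
rewrite -EZr.
apply: le_trans (_ : E (fun w : conf => k `^ (p - 1) *
   ((`|X i w| `^ p + (V 5 i w / k) `^ p + (p - 2) * (c / k) `^ p) / p)) <= _).
  apply: ler_E => w; apply: le_trans (young3_scaled (normr_ge0 _) (V_ge0 5 i w) c0).
  by rewrite ler_wpM2r ?powR_ge0 // ler_wpM2l // Y_le_V.
by rewrite EZ EZr !ED E_cst.
Qed.

Lemma third_rearr i : absmom i + avgmom i + (p - 2) * avgmom i =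
  absmom i + (p - 1) * avgmom i.
Proof. ring. Qed.

Lemma third_XYV i :
  E (fun w : conf => `|X i w| * `|Y i w| * V 5 i w `^ (p - 2)) <= third i.
Proof.
apply: le_trans (_ : E (fun w : conf => k `^ (p - 1) *
   ((`|X i w| `^ p + (V 5 i w / k) `^ p + (p - 2) * (V 5 i w / k) `^ p) / p)) <= _).
  apply: ler_E => w; apply: le_trans (young3_scaled (normr_ge0 _) (V_ge0 5 i w) (V_ge0 5 i w)).
  by rewrite ler_wpM2r ?powR_ge0 // ler_wpM2l // Y_le_V.
by rewrite EZ EZr !ED EZ third_rearr.
Qed.

Lemma third_XV i : E (fun w : conf => `|X i w| * V 5 i w `^ (p - 1)) <= third i.
Proof.
have p2 := p2 F.
apply: le_trans (_ : E (fun w : conf => k `^ (p - 1) *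
   ((`|X i w| `^ p + (V 5 i w / k) `^ p + (p - 2) * (V 5 i w / k) `^ p) / p)) <= _).
  apply: ler_E => w; apply: le_trans (young3_scaled (normr_ge0 _) (V_ge0 5 i w) (V_ge0 5 i w)).
  have -> : p - 1 = 1 + (p - 2) by ring.
  rewrite (@powR_split _ _ 1 (p - 2)) ?powRr1 ?V_ge0 //; last by lra.
  by rewrite mulrA.
by rewrite EZ EZr !ED EZ third_rearr.
Qed.

Lemma third_XY_V i :
  E (fun w : conf => `|X i w| * `|Y i w|) * E (fun w => V 5 i w `^ (p - 2)) <= third i.
Proof.
rewrite -EZ; apply: le_trans (_ : E (fun w : conf => k `^ (p - 1) *
   ((absmom i + avgmom i + (p - 2) * (V 5 i w / k) `^ p) / p)) <= _).
  by apply: ler_E => w; apply: E_XY_cst; exact: V_ge0.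
by rewrite EZ EZr !ED !E_cst EZ third_rearr.
Qed.

(** Used with [c] the norm of order [p] of the local sum [V 5 i]. *)
Lemma third_XY_cst i (c : R) : 0 <= c -> c `^ p <= k `^ p * avgmom i ->
  E (fun w : conf => `|X i w| * `|Y i w|) * c `^ (p - 2) <= third i.
Proof.
move=> c0 cV; apply: (le_trans (E_XY_cst i c0)).
have p2 := p2 F; have k0 := kap_gt0 F.
rewrite ler_wpM2l ?powR_ge0 // ler_wpM2r ?invr_ge0 //; first by lra.
rewrite -third_rearr lerD2l ler_wpM2l //; first by lra.
have cE : c = k * (c / k) by rewrite mulrC divfK // gt_eqF.
have ck : 0 <= c / k by rewrite divr_ge0 // kap_ge0.
by move: cV; rewrite {1}cE powRM ?kap_ge0 // ler_pM2l // powR_gt0.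
Qed.

(** This bounds the total variance of the localized kernel in [concentration]. *)
Lemma sum_sq_third :
  \sum_i k * E (fun w : conf => `|X i w| ^+ 2 * V 5 i w `^ (p - 2)) <= Gam F.
Proof.
have p2 := p2 F.
apply: le_trans (_ : \sum_i k `^ (p - 1) *
   ((2 * absmom i + (p - 2) * avgmom i) / p) <= _).
  apply: ler_sum => i _; rewrite -!EZ -ED -EZr -EZ; apply: ler_E => w.
  by rewrite [leLHS]mulrA; apply: young3_sq; rewrite ?V_ge0.
rewrite -mulr_sumr /Gam ler_wpM2l ?powR_ge0 // -mulr_suml ler_pdivrMr; last by lra.
rewrite big_split /= -!mulr_sumr.
have : (p - 2) * (\sum_i avgmom i) <= (p - 2) * gam F.
  by rewrite ler_wpM2l ?sum_avgmom //; lra.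
rewrite -/(gam F); lra.
Qed.

(** * Second moments *)

(** Only the pairs of indices within a ball contribute, at most [kap] of them for each index. *)
Lemma second_moment_le r A (M : site F -> conf -> R) : (r <= 5)%N ->
  (forall i j, i \in A -> j \in A -> j \notin ball r i -> E (fun w => M i w * M j w) = 0) ->
  E (fun w => (\sum_(i in A) M i w) ^+ 2) <= k * \sum_(i in A) E (fun w => M i w ^+ 2).
Proof.
move=> r5 M0.
have sqE w : (\sum_(i in A) M i w) ^+ 2 = \sum_(i in A) \sum_(j in A) M i w * M j w.
  rewrite expr2 mulr_suml; apply: eq_bigr => i _; by rewrite mulr_sumr.
rewrite (eq_E sqE) E_sum.
under eq_bigr => i _ do rewrite E_sum.
set S := fun i => E (fun w => M i w ^+ 2).
have S0 i : 0 <= S i by apply: E_ge0 => w; exact: sqr_ge0.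
apply: le_trans (_ : \sum_(i in A) \sum_(j in ball r i | j \in A) 2^-1 * (S i + S j) <= _).
  apply: ler_sum => i iA.
  rewrite (bigID (mem (ball r i))) /= [X in _ + X]big1 ?addr0; last first.
    by move=> j /andP[jA ji]; exact: M0.
  rewrite (eq_bigl (fun j => (j \in ball r i) && (j \in A))); last by move=> j; rewrite andbC.
  apply: ler_sum => j _; rewrite -ED -EZ; apply: ler_E => w.
  have := sqr_ge0 (M i w - M j w); rewrite sqrrB; lra.
under eq_bigr => i _ do rewrite -mulr_sumr big_split /=.
rewrite -mulr_sumr big_split /=.
have H1 : \sum_(i in A) \sum_(j in ball r i | j \in A) S i <= k * \sum_(i in A) S i.
  rewrite mulr_sumr; apply: ler_sum => i iA; rewrite sumr_const -[leLHS]mulr_natl ler_wpM2r //.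
  apply: le_trans (card_ball i r5); rewrite ler_nat.
  by apply: subset_leq_card; apply/fintype.subsetP => j /andP[].
have := exchange_ball A r5 S0; lra.
Qed.

Lemma E_XX_far i j : j \notin ball 1 i -> E (fun w => X i w * X j w) = 0.
Proof.
move=> ji; rewrite (@E_indep _ _ [set i]%SET [set j]%SET) ?E_X ?mul0r //.
- move=> a b /set1P -> /set1P ->; by move: ji; rewrite inE -ltnNge mul1n.
- by apply: dep_X; rewrite inE.
- by apply: dep_X; rewrite inE.
Qed.

Lemma E_SX2_le A : E (fun w => SX A w ^+ 2) <= k * \sum_(i in A) E (fun w => X i w ^+ 2).
Proof. by apply: (@second_moment_le 1) => // i j _ _; exact: E_XX_far. Qed.

(** The threshold [e] splits the second moments into a part of total size [1 / 25] and a part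
  of size at most [5 * Gam], hence the value [1 / 9]. *)
Lemma E_SX2_small A : #|A|%:R <= k -> Gam F <= 75^-1 ->
  E (fun w => SX A w ^+ 2) <= 9^-1.
Proof.
move=> Ak G; apply: (le_trans (E_SX2_le A)).
have k0 := kap_gt0 F; have p2 := p2 F; have p3 := p3 F.
pose e := (5 * k)^-1.
have e0 : 0 < e by rewrite invr_gt0 mulr_gt0.
have H i : E (fun w => X i w ^+ 2) <= e ^+ 2 + e `^ (2 - p) * absmom i.
  rewrite -EZ -(E_cst F (e ^+ 2)) -ED; apply: ler_E => w.
  by have := @sqr_le_powR R p `|X i w| e p2 (normr_ge0 _) e0; rewrite real_normK ?num_real.
have H2 : \sum_(i in A) E (fun w => X i w ^+ 2) <= k * e ^+ 2 + e `^ (2 - p) * gam F.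
  apply: (le_trans (ler_sum _ (fun i _ => H i))).
  rewrite big_split /= sumr_const -[X in X + _]mulr_natl lerD //.
    by rewrite ler_wpM2r ?sqr_ge0.
  rewrite -mulr_sumr ler_wpM2l ?powR_ge0 // /gam [leRHS](bigID (mem A)) /= lerDl.
  by apply: sumr_ge0 => i _; exact: absmom_ge0.
apply: (le_trans (ler_wpM2l (ltW k0) H2)); rewrite mulrDr.
have -> : k * (k * e ^+ 2) = 25^-1.
  by rewrite /e; field; rewrite gt_eqF.
have -> : e `^ (2 - p) = 5 `^ (p - 2) * k `^ (p - 2).
  rewrite /e -powR_inv1 ?mulr_ge0 ?(ltW k0) // -powRrM mulN1r opprB powRM ?kap_ge0 //.
have -> : k * (5 `^ (p - 2) * k `^ (p - 2) * gam F) = 5 `^ (p - 2) * Gam F.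
  rewrite /Gam.
  have -> : p - 1 = 1 + (p - 2) by ring.
  rewrite (@powR_split _ k 1 (p - 2)) ?powRr1 ?kap_ge0 //; last by lra.
  ring.
have H5 : 5 `^ (p - 2) <= 5 :> R.
  by rewrite -[leRHS]powRr1 // ler_powR //; lra.
have : 5 `^ (p - 2) * Gam F <= 5 * 75^-1.
  by apply: ler_pM; rewrite ?powR_ge0 ?Gam_ge0.
lra.
Qed.

End Moments.


(** * A trapezoid and its primitive *)

Section Trapezoid.
Variables (R : realType).
Implicit Types al x y : R.

Definition ramp al x : R := Num.min (Num.max (x / al) 0) 1.
(** The primitive of [ramp al], written without a case distinction. *)
Definition pramp al x : R :=
  (Num.max x 0 ^+ 2 - Num.max (x - al) 0 ^+ 2) / (2 * al).

Variant ramp_spec al x : R -> R -> Type :=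
| RampLow of x <= 0 : ramp_spec al x 0 0
| RampMid u of 0 <= u & u <= 1 & x = u * al : ramp_spec al x u (u ^+ 2 * al / 2)
| RampHigh of al <= x : ramp_spec al x 1 (x - al / 2).

Lemma rampP al x : 0 < al -> ramp_spec al x (ramp al x) (pramp al x).
Proof.
move=> al0; rewrite /ramp /pramp; have [x0|x0] := leP x 0.
  have h2 : x - al <= 0 by lra.
  have h1 : x / al <= 0 by rewrite pmulr_lle0 // invr_gt0.
  rewrite (max_idPr h1) (max_idPr h2) (min_idPl ler01) subrr mul0r.
  by constructor.
have h1 : 0 <= x / al by rewrite divr_ge0 // ltW.
rewrite (max_idPl h1); have [xa|xa] := leP x al.
  have h2 : x - al <= 0 by lra.
  have h3 : x / al <= 1 by rewrite ler_pdivrMr // mul1r.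
  rewrite (max_idPr h2) (min_idPl h3) expr0n subr0.
  have -> : x ^+ 2 / (2 * al) = (x / al) ^+ 2 * al / 2 by field; rewrite gt_eqF.
  by constructor => //; rewrite divfK // gt_eqF.
have h2 : 0 <= x - al by lra.
have h3 : 1 <= x / al by rewrite ler_pdivlMr // mul1r ltW.
rewrite (max_idPl h2) (min_idPr h3).
have -> : (x ^+ 2 - (x - al) ^+ 2) / (2 * al) = x - al / 2.
  by field; rewrite gt_eqF.
by constructor; exact: ltW.
Qed.

Lemma ramp_ge0 al x : 0 < al -> 0 <= ramp al x.
Proof. by move=> al0; case: rampP. Qed.

Lemma ramp_le1 al x : 0 < al -> ramp al x <= 1.
Proof. by move=> al0; case: rampP. Qed.

Lemma ramp_mono al x y : 0 < al -> x <= y -> ramp al x <= ramp al y.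
Proof. by move=> al0 xy; case: (rampP x al0); case: (rampP y al0) => // *; nra. Qed.

Lemma ramp_lip al x y : 0 < al -> x <= y -> ramp al y - ramp al x <= (y - x) / al.
Proof.
move=> al0 xy; rewrite ler_pdivlMr //.
case: (rampP x al0); case: (rampP y al0) => // *; nra.
Qed.

Lemma ramp0 al x : 0 < al -> x <= 0 -> ramp al x = 0.
Proof. by move=> al0 x0; case: rampP => // *; nra. Qed.

Lemma ramp1 al x : 0 < al -> al <= x -> ramp al x = 1.
Proof. by move=> al0 x0; case: rampP => // *; nra. Qed.

(** [pramp] is convex with derivative [ramp]. *)
Lemma pramp_step al x y : 0 < al -> x <= y ->
  (y - x) * ramp al x <= pramp al y - pramp al x <= (y - x) * ramp al y.
Proof.
move=> al0 xy; have sq u : 0 <= al * u ^+ 2 by rewrite mulr_ge0 ?sqr_ge0 // ltW.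
case: (rampP x al0) => [x0|u u0 u1 xE|x1]; case: (rampP y al0) => [y0|v v0 v1 yE|y1];
  apply/andP; split; first
    [ nra | by have := sq (v - u); nra | by have := sq (1 - u); nra
    | by have := sq (1 - v); nra].
Qed.

(** A trapezoid equal to [1] on [[a, b]] and to [0] outside [[a - al, b + al]]. *)
Definition trap al (a b x : R) : R := ramp al (x - a + al) - ramp al (x - b).
(** The primitive of the trapezoid, the test function of the concentration inequality. *)
Definition ptrap al (a b x : R) : R := pramp al (x - a + al) - pramp al (x - b).

Section Trap.
Variables (al a b : R).
Hypothesis (al0 : 0 < al) (ab : a <= b).

Lemma trap_ge0 x : 0 <= trap al a b x.
Proof. by rewrite subr_ge0 ramp_mono //; move: al0 ab; lra. Qed.

Lemma trap_le1 x : trap al a b x <= 1.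
Proof. have := ramp_le1 (x - a + al) al0; have := ramp_ge0 (x - b) al0; rewrite /trap; lra. Qed.

Lemma trap_eq1 x : a <= x <= b -> trap al a b x = 1.
Proof.
move=> /andP[ax xb]; rewrite /trap ramp1 // ?ramp0 ?subr0 //; lra.
Qed.

Lemma trap_eq0 x : x <= a - al -> trap al a b x = 0.
Proof. by move=> xa; rewrite /trap !ramp0 ?subr0 //; move: al0 ab; lra. Qed.

Lemma ptrap_ge0 x : 0 <= ptrap al a b x.
Proof.
have xy : x - b <= x - a + al by move: al0 ab; lra.
have /andP[+ _] := pramp_step al0 xy; apply: le_trans.
by rewrite mulr_ge0 ?ramp_ge0 // subr_ge0.
Qed.

Lemma ptrap_le x : ptrap al a b x <= b - a + al.
Proof.
have xy : x - b <= x - a + al by move: al0 ab; lra.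
have /andP[_ h] := pramp_step al0 xy; apply: (le_trans h).
have -> : x - a + al - (x - b) = b - a + al by ring.
by rewrite ler_piMr ?ramp_le1 //; move: al0 ab; lra.
Qed.

Lemma ptrap_eq0 x : x <= a - al -> ptrap al a b x = 0.
Proof.
move=> xa; have xy : x - b <= x - a + al by move: al0 ab; lra.
have := pramp_step al0 xy; rewrite !ramp0 //; last 2 first.
- by move: al0 ab; lra.
- by lra.
by rewrite !mulr0 => /andP[h1 h2]; apply/eqP; rewrite eq_le h1 h2.
Qed.

Lemma ptrap_lip x y : `|ptrap al a b y - ptrap al a b x| <= `|y - x|.
Proof.
wlog xy : x y / x <= y => [H|].
  have [|/ltW yx] := leP x y; first exact: H.
  by rewrite distrC [leRHS]distrC; exact: H.
have xy1 : x - a + al <= y - a + al by lra.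
have xy2 : x - b <= y - b by lra.
have /andP[h1 h2] := pramp_step al0 xy1.
have /andP[h3 h4] := pramp_step al0 xy2.
rewrite (ger0_norm (_ : 0 <= y - x)) ?subr_ge0 //.
have d0 : 0 <= y - x by lra.
have g1 : 0 <= (y - a + al - (x - a + al)) * ramp al (x - a + al).
  by rewrite mulr_ge0 ?ramp_ge0 //; lra.
have g2 : (y - a + al - (x - a + al)) * ramp al (y - a + al) <= y - x.
  have -> : y - a + al - (x - a + al) = y - x by ring.
  by rewrite ler_piMr ?ramp_le1.
have g3 : 0 <= (y - b - (x - b)) * ramp al (x - b).
  by rewrite mulr_ge0 ?ramp_ge0 //; lra.
have g4 : (y - b - (x - b)) * ramp al (y - b) <= y - x.
  have -> : y - b - (x - b) = y - x by ring.
  by rewrite ler_piMr ?ramp_le1.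
rewrite ler_norml /ptrap; apply/andP; split; lra.
Qed.

Lemma ptrap_step x d : 0 <= d ->
  `|ptrap al a b (x + d) - ptrap al a b x - d * trap al a b x| <= d ^+ 2 / al /\
  `|ptrap al a b (x + d) - ptrap al a b x - d * trap al a b (x + d)| <= d ^+ 2 / al.
Proof.
move=> d0.
have xy1 : x - a + al <= x + d - a + al by lra.
have xy2 : x - b <= x + d - b by lra.
have /andP[] := pramp_step al0 xy1.
have -> : x + d - a + al - (x - a + al) = d by ring.
move=> h1 h2.
have /andP[] := pramp_step al0 xy2.
have -> : x + d - b - (x - b) = d by ring.
move=> h3 h4.
have := ramp_lip al0 xy1; have := ramp_lip al0 xy2.
have -> : x + d - a + al - (x - a + al) = d by ring.
have -> : x + d - b - (x - b) = d by ring.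
move=> /(ler_wpM2l d0) l2 /(ler_wpM2l d0) l1.
have dE : d * (d / al) = d ^+ 2 / al by rewrite mulrA.
rewrite dE in l1 l2.
rewrite /trap /ptrap; split; rewrite ler_norml; apply/andP; split; lra.
Qed.

End Trap.

End Trapezoid.

(** * Discretized translations *)

(** The increment of a primitive over a translation by [y], with [`|y| <= 1], is the integral of
  the derivative against the signed indicator of the interval between [0] and [y].  On a grid of
  step [1 / L] this indicator becomes [kern y], and [node] gives the positions of the steps; the
  concentration inequality then involves finite sums only. *)

Section Kernel.
Variables (R : realType) (L : nat).
Hypothesis L0 : (0 < L)%N.
Local Notation d := (L%:R^-1 : R).

Definition node (l : bool * 'I_L) : R := if l.1 then - (l.2.+1%:R * d) else l.2%:R * d.
Definition steps (y : R) : nat := Num.truncn (Num.min (Num.max y 0) 1 * L%:R).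
Definition kern (y : R) (l : bool * 'I_L) : R :=
  if l.1 then (l.2 < steps y)%N%:R else - (l.2 < steps (- y))%N%:R.

Lemma dgt0 : 0 < d. Proof. by rewrite invr_gt0 ltr0n. Qed.

Lemma steps_bd y : (steps y)%:R * d <= Num.min (Num.max y 0) 1 <= (steps y)%:R * d + d.
Proof.
have L1 : 0 < L%:R :> R by rewrite ltr0n.
have m0 : 0 <= Num.min (Num.max y 0) 1 by rewrite le_min ler01 le_max lexx orbT.
have /truncn_itv : 0 <= Num.min (Num.max y 0) 1 * L%:R by rewrite mulr_ge0 // ltW.
rewrite -/(steps y) => /andP[h1 h2]; apply/andP; split.
  by rewrite ler_pdivrMr.
have -> : (steps y)%:R / L%:R + d = (steps y).+1%:R / L%:R.
  by rewrite -[X in _ + X]mul1r -mulrDl natr1.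
by rewrite ler_pdivlMr //; exact: ltW.
Qed.

Lemma steps_le y : (steps y <= L)%N.
Proof.
have /andP[h _] := steps_bd y.
rewrite -(ler_nat R) -[leRHS]mul1r -ler_pdivrMr ?ltr0n //; apply: (le_trans h).
by rewrite ge_min lexx orbT.
Qed.

Lemma steps_neg y : y <= 0 -> steps y = 0%N.
Proof.
by move=> y0; rewrite /steps (max_idPr y0) (min_idPl ler01) mul0r truncn0.
Qed.

Lemma sum_steps (f : nat -> R) n : (n <= L)%N ->
  \sum_(l < L) (l < n)%N%:R * f l = \sum_(l < n) f l.
Proof.
move=> nL; rewrite (big_ord_widen _ f nL) [RHS]big_mkcond; apply: eq_bigr => l _.
by case: ifP => _; rewrite ?mul1r ?mul0r.
Qed.

Lemma sum_kern (y : R) (f : bool * 'I_L -> R) (g : bool -> nat -> R) :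
  (forall l, f l = g l.1 l.2) ->
  \sum_l kern y l * f l =
  \sum_(l < steps y) g true l - \sum_(l < steps (- y)) g false l.
Proof.
move=> fg.
rewrite (eq_bigr (fun l => (fun b l => kern y (b, l) * f (b, l)) l.1 l.2)); last by case.
rewrite -(pair_bigA _ (fun b l => kern y (b, l) * f (b, l))) /= big_bool /=.
rewrite -(sum_steps _ (steps_le y)) -(sum_steps _ (steps_le (- y))) -sumrN.
congr +%R; apply: eq_bigr => l _; rewrite fg /kern /=; first by [].
by rewrite mulNr.
Qed.

Lemma steps_or y : steps y = 0%N \/ steps (- y) = 0%N.
Proof.
have [y0|/ltW y0] := leP y 0; first by left; exact: steps_neg.
by right; apply: steps_neg; rewrite oppr_le0.
Qed.

Lemma sqr_kern y l : kern y l ^+ 2 = `|kern y l|.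
Proof.
rewrite /kern; case: l.1; rewrite ?sqrrN ?normrN; case: (_ < _)%N; rewrite ?normr0 ?normr1 ?expr1n ?expr0n //.
Qed.

Lemma steps_norm y : (steps y)%:R * d + (steps (- y))%:R * d <= Num.min `|y| 1.
Proof.
have key z : 0 <= z -> (steps z)%:R * d <= Num.min `|z| 1.
  move=> z0; have /andP[h _] := steps_bd z.
  by apply: (le_trans h); rewrite (max_idPl z0) ger0_norm.
have [y0|y0] := leP 0 y.
  by rewrite (@steps_neg (- y)) ?oppr_le0 // mul0r addr0; exact: key.
rewrite (@steps_neg y) ?(ltW y0) // mul0r add0r -normrN; apply: key.
by rewrite oppr_ge0 ltW.
Qed.

Lemma steps_diff y :
  `|(steps y)%:R * d - (steps (- y))%:R * d - y| <= Num.max (`|y| - 1) 0 + d.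
Proof.
have d0 := dgt0.
have key z : 0 <= z -> `|(steps z)%:R * d - z| <= Num.max (`|z| - 1) 0 + d.
  move=> z0; have /andP[] := steps_bd z; rewrite (max_idPl z0) (ger0_norm z0).
  rewrite ler_norml; have [z1|z1] := leP z 1 => h1 h2.
    have z2 : z - 1 <= 0 by lra.
    by rewrite (max_idPr z2); apply/andP; split; lra.
  have z2 : 0 <= z - 1 by lra.
  by rewrite (max_idPl z2); apply/andP; split; lra.
have [y0|y0] := leP 0 y.
  by rewrite (@steps_neg (- y)) ?oppr_le0 // mul0r subr0; exact: key.
have := key (- y); rewrite oppr_ge0 (ltW y0) (normrN y) opprK => /(_ isT).
rewrite (@steps_neg y) ?(ltW y0) // mul0r -[in leLHS]normrN.
by have -> u : - (u + y) = 0 - u - y by ring.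
Qed.

Lemma kern_sum y : d * (\sum_l kern y l) = (steps y)%:R * d - (steps (- y))%:R * d.
Proof.
have := @sum_kern y (fun=> 1) (fun _ _ => 1) (fun=> erefl).
under eq_bigr do rewrite mulr1.
by move=> ->; rewrite !sumr_const !card_ord mulrBr mulrC [d * _]mulrC.
Qed.

Lemma abs_kern_sum y : d * (\sum_l `|kern y l|) <= Num.min `|y| 1.
Proof.
apply: le_trans (steps_norm y).
under eq_bigr do rewrite -sqr_kern expr2.
rewrite (@sum_kern y _ (fun b l => if b then (l < steps y)%N%:R else - (l < steps (- y))%N%:R)) //.
have E b : \sum_(l < steps b) (l < steps b)%N%:R = (steps b)%:R :> R.
  rewrite (eq_bigr (fun=> 1)); last by move=> l _; rewrite ltn_ord.
  by rewrite sumr_const card_ord.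
rewrite sumrN opprK !E mulrDr mulrC [d * _]mulrC //.
Qed.

Lemma kern_node y l : `|kern y l| * `|node l| <= `|kern y l| * Num.min `|y| 1.
Proof.
have d0 := dgt0; have h := steps_norm y.
rewrite /kern /node; case: l => -[] l /=.
- case: ltnP => [ls|_]; last by rewrite mulr0n normr0 !mul0r.
  rewrite mulr1n normr1 !mul1r normrN ger0_norm ?mulr_ge0 ?(ltW d0) //; apply: le_trans h.
  by rewrite ler_wpDr ?mulr_ge0 ?ler0n ?(ltW d0) // ler_wpM2r ?(ltW d0) // ler_nat.
- case: ltnP => [ls|_]; last by rewrite mulr0n oppr0 normr0 !mul0r.
  rewrite mulr1n normrN normr1 !mul1r ger0_norm ?mulr_ge0 ?(ltW d0) //; apply: le_trans h.
  by rewrite ler_wpDl ?mulr_ge0 ?ler0n ?(ltW d0) // ler_wpM2r ?(ltW d0) // ler_nat ltnW.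
Qed.

Lemma kern_node_sum y : d * (\sum_l `|kern y l| * `|node l|) <= Num.min `|y| 1 ^+ 2.
Proof.
have m0 : 0 <= Num.min `|y| 1 by rewrite le_min normr_ge0 ler01.
apply: le_trans (_ : d * (\sum_l `|kern y l| * Num.min `|y| 1) <= _).
  by rewrite ler_wpM2l ?(ltW dgt0) //; apply: ler_sum => l _; exact: kern_node.
by rewrite -mulr_suml mulrA expr2 ler_wpM2r // abs_kern_sum.
Qed.

Lemma node_le1 l : node l <= 1.
Proof.
have L1 : 0 < L%:R :> R by rewrite ltr0n.
case: l => -[] l; rewrite /node /=.
  by apply: (@le_trans _ _ 0) => //; rewrite oppr_le0 mulr_ge0 ?(ltW dgt0).
by rewrite ler_pdivrMr // mul1r ler_nat ltnW.
Qed.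

Section TrapKernel.
Variables (al a b : R).
Hypothesis (al0 : 0 < al) (ab : a <= b).
Local Notation P := (ptrap al a b).
Local Notation h := (trap al a b).

Lemma ptrap_down x n :
  `|P x - P (x - n%:R * d) - \sum_(l < n) d * h (x - l.+1%:R * d)| <= n%:R * (d ^+ 2 / al).
Proof.
have d0 := ltW dgt0.
elim: n => [|n IH]; first by rewrite big_ord0 !mul0r !subr0 subrr normr0.
rewrite big_ord_recr /=.
have [st _] := ptrap_step a b al0 (x - n.+1%:R * d) d0.
have e : x - n.+1%:R * d + d = x - n%:R * d by rewrite -natr1; ring.
rewrite e in st.
have -> : n.+1%:R * (d ^+ 2 / al) = n%:R * (d ^+ 2 / al) + d ^+ 2 / al.
  by rewrite -natr1 mulrDl mul1r.
apply: le_trans (lerD IH st).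
apply: le_trans (ler_normD _ _); rewrite le_eqVlt; apply/orP; left; apply/eqP.
by congr `|_|; ring.
Qed.

Lemma ptrap_up x n :
  `|P (x + n%:R * d) - P x - \sum_(l < n) d * h (x + l%:R * d)| <= n%:R * (d ^+ 2 / al).
Proof.
have d0 := ltW dgt0.
elim: n => [|n IH]; first by rewrite big_ord0 !mul0r addr0 !subr0 subrr normr0.
rewrite big_ord_recr /=.
have [st _] := ptrap_step a b al0 (x + n%:R * d) d0.
have e : x + n%:R * d + d = x + n.+1%:R * d by rewrite -natr1; ring.
rewrite e in st.
have -> : n.+1%:R * (d ^+ 2 / al) = n%:R * (d ^+ 2 / al) + d ^+ 2 / al.
  by rewrite -natr1 mulrDl mul1r.
apply: le_trans (lerD IH st).
apply: le_trans (ler_normD _ _); rewrite le_eqVlt; apply/orP; left; apply/eqP.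
by congr `|_|; ring.
Qed.

Lemma step_err n : (n <= L)%N -> n%:R * (d ^+ 2 / al) <= d / al.
Proof.
move=> nL; have L1 : 0 < L%:R :> R by rewrite ltr0n.
have -> : d / al = L%:R * (d ^+ 2 / al) by field; rewrite !gt_eqF.
by rewrite ler_wpM2r ?ler_nat // divr_ge0 ?sqr_ge0 // ltW.
Qed.

(** The first error comes from truncating [y] to [[-1, 1]], the second one from the grid. *)
Lemma kern_ptrap x y :
  `|P x - P (x - y) - d * \sum_l kern y l * h (x + node l)| <=
  Num.max (`|y| - 1) 0 + d * (1 + al^-1).
Proof.
rewrite (@sum_kern y _ (fun b l => if b then h (x - l.+1%:R * d) else h (x + l%:R * d))); last first.
  by case=> -[] l.
rewrite mulrBr !mulr_sumr.
have lip := ptrap_lip a b al0 (x - y).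
have := ptrap_down x (steps y); have := ptrap_up x (steps (- y)).
have := steps_diff y; have := step_err (steps_le y); have := step_err (steps_le (- y)).
have d0 := dgt0; have da : 0 <= d / al by rewrite divr_ge0 ?ltW.
have -> : d * (1 + al^-1) = d + d / al by ring.
have [->|->] := steps_or y.
  rewrite !big_ord0 !mul0r => e1 _ e3 e2 _.
  set S := \sum_(l < _) _ in e2 *; set u := _%:R * d in e2 e3 *.
  have e4 := lip (x + u).
  have eqn : x + u - (x - y) = - (0 - u - y) by ring.
  rewrite eqn normrN in e4.
  have -> : P x - P (x - y) - (0 - S) = - (P (x + u) - P x - S) + (P (x + u) - P (x - y)) by ring.
  apply: (le_trans (ler_normD _ _)); rewrite normrN; lra.
rewrite !big_ord0 !mul0r => _ e1 e3 _ e2.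
set S := \sum_(l < _) _ in e2 *; set u := _%:R * d in e2 e3 *.
have e4 := lip (x - u).
have eqn : x - u - (x - y) = - (u - 0 - y) by ring.
rewrite eqn normrN in e4.
have -> : P x - P (x - y) - (S - 0) = (P x - P (x - u) - S) + (P (x - u) - P (x - y)) by ring.
apply: (le_trans (ler_normD _ _)); lra.
Qed.

Lemma trap_node_sum x :
  d * (\sum_l h (x + node l)) <= b - a + al + d * (2 / al).
Proof.
rewrite (eq_bigr (fun l => (fun s l => h (x + node (s, l))) l.1 l.2)); last by case.
rewrite -(pair_bigA _ (fun s l => h (x + node (s, l)))) /= big_bool /= /node /=.
rewrite mulrDr !mulr_sumr.
have := ptrap_down x L; have := ptrap_up x L; have := step_err (leqnn L).
move=> e /ler_normlP[e1 _] /ler_normlP[e2 _].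
have := ptrap_le al0 ab (x + L%:R * d); have := ptrap_ge0 al0 ab (x - L%:R * d).
have -> : d * (2 / al) = d / al + d / al by ring.
lra.
Qed.

End TrapKernel.

End Kernel.


(** * The concentration inequality *)

Section Truncation.
Variables (R : realType) (F : lfield R).
Local Notation p := (expo F).

Lemma powR_ge1 (v q : R) : 1 <= v -> 0 <= q -> 1 <= v `^ q.
Proof. by move=> v1 q0; rewrite -[leLHS](powRr0 v) ler_powR. Qed.

Lemma powR_ge_id (v q : R) : 0 <= v -> v <= 1 -> 0 < q -> q <= 1 -> v <= v `^ q.
Proof.
move=> v0 v1 q0 q1; have [->|vn] := eqVneq v 0; first by rewrite powR_ge0.
have vp : 0 < v by rewrite lt_neqAle eq_sym vn.
rewrite -[leLHS]powRr1 //.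
by apply: ger_powR => //; rewrite vp v1.
Qed.

(** The place where [p <= 3] enters: the exponent [p - 2] is at most [1]. *)
Lemma min1_le (y v : R) : `|y| <= v -> Num.min `|y| 1 <= v `^ (p - 2).
Proof.
move=> yv; have p2 := p2 F; have p3 := p3 F; have v0 : 0 <= v := le_trans (normr_ge0 _) yv.
have [v1|v1] := leP v 1.
  rewrite ge_min (le_trans yv) //; apply: powR_ge_id => //; lra.
rewrite ge_min orbC powR_ge1 //; [exact: ltW|lra].
Qed.

Lemma powR_p1 (v : R) : 0 <= v -> v `^ (p - 1) = v * v `^ (p - 2).
Proof.
move=> v0; have p2 := p2 F; have -> : p - 1 = 1 + (p - 2) by ring.
by rewrite (@powR_split _ v 1 (p - 2)) ?powRr1 //; lra.
Qed.

Lemma min1_sqr_le (y v : R) : `|y| <= v -> Num.min `|y| 1 ^+ 2 <= v `^ (p - 1).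
Proof.
move=> yv; have v0 : 0 <= v := le_trans (normr_ge0 _) yv.
have m0 : 0 <= Num.min `|y| 1 by rewrite le_min normr_ge0 ler01.
rewrite powR_p1 // expr2 ler_pM // ?min1_le // ge_min yv //.
Qed.

Lemma max1_le (y v : R) : `|y| <= v -> Num.max (`|y| - 1) 0 <= v `^ (p - 1).
Proof.
move=> yv; have v0 : 0 <= v := le_trans (normr_ge0 _) yv.
rewrite ge_max powR_ge0 andbT; have [v1|/ltW v1] := leP v 1.
  by apply: (@le_trans _ _ 0); rewrite ?powR_ge0 // subr_le0 (le_trans yv).
have p2 := p2 F.
rewrite powR_p1 //; apply: (@le_trans _ _ v); first by lra.
by rewrite ler_peMr // powR_ge1 //; lra.
Qed.

End Truncation.

Section Concentration.
Variables (R : realType) (F : lfield R).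
Local Notation p := (expo F).
Local Notation k := (kap F).
Local Notation conf := (conf F).
Local Notation I := (site F).
Local Notation Gam := (Gam F).

(** The sum over the sites so far from [i] that it is independent of every function of [ball 3 i]. *)
Definition T (i : I) : conf -> R := SX (~: ball 5 i).

Section Far.
Variable i : I.
Hypothesis small : Gam <= 75^-1.

Lemma W_T w : W w = SX (ball 5 i) w + T i w.
Proof. exact: W_split. Qed.

Lemma E_SX2_ball : E (fun w : conf => SX (ball 5 i) w ^+ 2) <= 9^-1.
Proof. by apply: E_SX2_small => //; exact: card_ball. Qed.

Lemma E_T2 : E (fun w => T i w ^+ 2) <= 16 / 9.
Proof.
have := E_SX2_ball; have := E_W2 F => h1 h2.
apply: (@le_trans _ _ (E (fun w => (1 + 3^-1) * (W w ^+ 2) + 4 * SX (ball 5 i) w ^+ 2))).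
  apply: ler_E => w; rewrite (W_T w).
  set x := SX _ _; set t := T i w.
  (* [4 / 3 * (x + t) ^+ 2 + 4 * x ^+ 2 - t ^+ 2 = (t + 4 * x) ^+ 2 / 3]. *)
  have := sqr_ge0 (t + 4 * x); nra.
rewrite ED !EZ h1; lra.
Qed.

Lemma E_absT : E (fun w => `|T i w|) <= 4 / 3.
Proof.
apply: (@le_trans _ _ (E (fun w => 3 / 8 * (T i w ^+ 2) + 2 / 3))).
  apply: ler_E => w; have := sqr_ge0 (`|T i w| - 4 / 3).
  by rewrite sqrrB real_normK ?num_real //; lra.
by rewrite ED EZ E_cst; have := E_T2; lra.
Qed.

Lemma E_XW j : E (fun w : conf => X j w * W w) = E (fun w => X j w * Y j w).
Proof.
have -> : E (fun w : conf => X j w * W w) =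
  E (fun w => X j w * Y j w + X j w * SX (~: ball 1 j) w).
  by apply: eq_E => w; rewrite (W_split (ball 1 j)) mulrDr.
rewrite ED; suff -> : E (fun w => X j w * SX (~: ball 1 j) w) = 0 by rewrite addr0.
rewrite (@E_indep _ _ [set j] (~: ball 1 j)) ?E_X ?mul0r //.
- by move=> a b /set1P ->; rewrite !inE -ltnNge mul1n.
- by apply: dep_X; rewrite inE.
- exact: dep_SX.
Qed.

(** Most of the variance comes from far sites.  This provides the lower bound on the mass of
  the kernel in the concentration inequality. *)
Lemma sum_far_XY : 2 / 3 <= \sum_(j in ~: ball 5 i) E (fun w : conf => X j w * Y j w).
Proof.
under eq_bigr do rewrite -E_XW.
rewrite -E_sum.
apply: (@le_trans _ _ (E (fun w => 5 / 6 * W w ^+ 2 - 3 / 2 * SX (ball 5 i) w ^+ 2))).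
  have := E_SX2_ball; have := E_W2 F => h1 h2.
  rewrite EB !EZ h1; lra.
apply: ler_E => w; rewrite -mulr_suml -/(SX _ w) -/(T i w) (W_T w).
set x := SX _ _; set t := T i w.
have := sqr_ge0 (t - 2 * x); nra.
Qed.

End Far.

Section Inequality.
Variables (i0 : I) (G a b : conf -> R) (al c Q : R).
Local Notation S := (ball 3 i0).
Local Notation J := (~: ball 5 i0).
Hypothesis G0 : forall w, 0 <= G w.
Hypothesis dG : dep S G.
Hypothesis da : dep S a.
Hypothesis db : dep S b.
Hypothesis ab : forall w, a w <= b w.
Hypothesis al0 : 0 < al.
Hypothesis al1 : al <= 1.
Hypothesis c0 : 0 < c.
Hypothesis small : Gam <= 75^-1.
Hypothesis Q0 : 0 <= Q.
Hypothesis HQ : forall a' : conf -> R, dep S a' ->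
  E (fun w => G w * (a' w <= W w <= a' w + al)%R%:R) <= Q * E G.

Let f w x := ptrap al (a w) (b w) x.
Let h w x := trap al (a w) (b w) x.

Lemma EG0 : 0 <= E G. Proof. exact: E_ge0. Qed.

Lemma dep_inside j : j \in J -> S \subset ~: ball 1 j.
Proof.
rewrite !inE -ltnNge => jJ; apply/fintype.subsetP => s sS; rewrite !inE -ltnNge mul1n.
rewrite dist_sym; apply: (@far_ball _ F 3 0 5 i0 j s j) => //; last exact: ball_refl.
by rewrite inE -ltnNge.
Qed.

Lemma W_Y (j : I) (w : conf) : W w - Y j w = SX (~: ball 1 j) w.
Proof. by rewrite (W_split (ball 1 j)) /Y; ring. Qed.

(** Conditionally on [ball 3 i0], the far field is still centred and locally dependent; so
  [X j] is independent of [G], of the interval and of [W - Y j]. *)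
Lemma expand_far :
  E (fun w => G w * T i0 w * f w (W w)) =
  \sum_(j in J) E (fun w => G w * (X j w * (f w (W w) - f w (W w - Y j w)))).
Proof.
rewrite (eq_E (g := fun w => \sum_(j in J) G w * (X j w * f w (W w)))); last first.
  by move=> w; rewrite /T /SX mulr_sumr mulr_suml; apply: eq_bigr => j _; ring.
rewrite E_sum; apply: eq_bigr => j jJ.
have Z : E (fun w => X j w * (G w * f w (W w - Y j w))) = 0.
  rewrite (@E_indep _ _ [set j] (~: ball 1 j)) ?E_X ?mul0r //.
  - by move=> x y /set1P ->; rewrite !inE -ltnNge mul1n.
  - by apply: dep_X; rewrite inE.
  - have sub := dep_inside jJ.
    apply: dep2; first exact: dep_sub sub dG.
    move=> w w' H; rewrite /f !W_Y (dep_sub sub da H) (dep_sub sub db H).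
    by rewrite (dep_SX _ H).
rewrite -[LHS]subr0 -Z -EB; apply: eq_E => w; ring.
Qed.

Lemma lhs_bound :
  E (fun w => G w * T i0 w * f w (W w)) <=
  E (fun w => G w * ((b w - a w + al) * `|T i0 w|) * (a w - 2 <= W w)%R%:R).
Proof.
apply: ler_E => w; rewrite -!mulrA ler_wpM2l //.
have [Wa|Wa] := leP (a w - 2) (W w); last first.
  rewrite /f ptrap_eq0 ?mulr0 //; move: al1 Wa; lra.
rewrite mulr1; apply: le_trans (ler_norm _) _.
rewrite normrM mulrC ler_wpM2r // ger0_norm; first exact: ptrap_le.
exact: ptrap_ge0.
Qed.

(** ** Increments of the trapezoid *)

Lemma ramp_incr x s : 0 <= s -> s <= al ->
  ramp al (x + s) - ramp al x <=
  s / al * ((- al <= x <= - al + al)%R%:R + (0 <= x <= 0 + al)%R%:R).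
Proof.
move=> s0 sa; have sal : 0 <= s / al by rewrite divr_ge0 // ltW.
have lip : ramp al (x + s) - ramp al x <= s / al.
  have xs : x <= x + s by lra.
  have := ramp_lip al0 xs; by have -> : x + s - x = s by ring.
have [x1|x1] := ltP x (- al).
  rewrite !ramp0 // ?subrr; [|move: al0; lra..].
  by rewrite mulr_ge0 // addr_ge0.
have [x2|x2] := ltP al x.
  rewrite !ramp1 // ?subrr; [|lra..].
  by rewrite mulr_ge0 // addr_ge0.
apply: (le_trans lip); rewrite -[leLHS]mulr1 ler_wpM2l //.
rewrite add0r addNr x2 /=; case: (leP 0 x) => [x3|/ltW x3]; first by rewrite lerDr.
by rewrite x3 addr0.
Qed.

Lemma E_ramp_incr1 (c' : conf -> R) s : dep S c' -> 0 <= s -> s <= al ->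
  E (fun w => G w * (ramp al (W w - c' w + s) - ramp al (W w - c' w))) <=
  s / al * (2 * Q * E G).
Proof.
move=> dc s0 sa; have sal : 0 <= s / al by rewrite divr_ge0 // ltW.
apply: (@le_trans _ _ (E (fun w => s / al *
  (G w * (c' w - al <= W w <= c' w - al + al)%R%:R + G w * (c' w <= W w <= c' w + al)%R%:R)))).
  apply: ler_E => w; rewrite -mulrDr mulrCA ler_wpM2l //.
  apply: (le_trans (ramp_incr _ s0 sa)); rewrite ler_wpM2l //.
  have -> : (- al <= W w - c' w <= - al + al) = (c' w - al <= W w <= c' w - al + al).
    by congr andb; apply/idP/idP; lra.
  have -> // : (0 <= W w - c' w <= 0 + al) = (c' w <= W w <= c' w + al).
  by congr andb; apply/idP/idP; lra.
rewrite EZ ED ler_wpM2l //.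
have := HQ dc; have := HQ (dep1 (fun x => x - al) dc); lra.
Qed.

Lemma E_ramp_incr_n (c' : conf -> R) s n : dep S c' -> 0 <= s -> s <= al ->
  E (fun w => G w * (ramp al (W w - c' w + n%:R * s) - ramp al (W w - c' w))) <=
  n%:R * (s / al * (2 * Q * E G)).
Proof.
move=> dc s0 sa; elim: n => [|n IH].
  rewrite mul0r (eq_E (g := fun=> 0)) ?E_cst ?mul0r // => w.
  by rewrite addr0 subrr mulr0.
have d' : dep S (fun w => c' w - n%:R * s) by exact: (dep1 (fun x => x - n%:R * s)).
have := lerD IH (E_ramp_incr1 d' s0 sa); rewrite -ED.
set u := s / al * _; have -> : n%:R * u + u = n.+1%:R * u by rewrite -natr1 mulrDl mul1r.
apply: le_trans; rewrite le_eqVlt; apply/orP; left; apply/eqP; apply: eq_E => w.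
have -> : W w - (c' w - n%:R * s) = W w - c' w + n%:R * s by ring.
have -> : W w - c' w + n%:R * s + s = W w - c' w + n.+1%:R * s by rewrite -natr1; ring.
ring.
Qed.

Lemma E_ramp_incr (c' : conf -> R) s : dep S c' -> 0 <= s ->
  E (fun w => G w * (ramp al (W w - c' w + s) - ramp al (W w - c' w))) <=
  2 * s / al * Q * E G.
Proof.
move=> dc s0; pose n := (Num.truncn (s / al)).+1.
have n0 : 0 < n%:R :> R by rewrite ltr0n.
have sal : 0 <= s / al by rewrite divr_ge0 // ltW.
have sn : s / n%:R <= al.
  rewrite ler_pdivrMr // mulrC -ler_pdivrMr //.
  by have /andP[_ /ltW] := truncn_itv sal.
have := @E_ramp_incr_n c' (s / n%:R) n dc (divr_ge0 s0 (ltW n0)) sn.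
have nn : n%:R * (s / n%:R) = s by rewrite mulrC divfK // gt_eqF.
rewrite nn; have -> // : n%:R * (s / n%:R / al * (2 * Q * E G)) = 2 * s / al * Q * E G.
by rewrite -{2}nn; ring.
Qed.

Lemma E_ramp_incr_ge0 (c' : conf -> R) s : 0 <= s ->
  0 <= E (fun w => G w * (ramp al (W w - c' w + s) - ramp al (W w - c' w))).
Proof.
move=> s0; apply: E_ge0 => w; rewrite mulr_ge0 // subr_ge0 ramp_mono //.
by rewrite lerDl.
Qed.

(** The trapezoid varies only within [al] of its four corners, where [HQ] bounds the mass.
  Translations of [W] are turned into translations of the interval. *)
Lemma E_trap_incr s :
  `|E (fun w => G w * (h w (W w + s) - h w (W w)))| <= 2 * `|s| / al * Q * E G.
Proof.
have key (t : R) (a' b' : conf -> R) : 0 <= t -> dep S a' -> dep S b' ->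
    `|E (fun w => G w * (trap al (a' w) (b' w) (W w + t) - trap al (a' w) (b' w) (W w)))|
    <= 2 * t / al * Q * E G.
  move=> t0 da' db'.
  have d' : dep S (fun w => a' w - al) by exact: (dep1 (fun x => x - al)).
  rewrite (eq_E (g := fun w =>
     G w * (ramp al (W w - (a' w - al) + t) - ramp al (W w - (a' w - al))) -
     G w * (ramp al (W w - b' w + t) - ramp al (W w - b' w)))); last first.
    move=> w; rewrite /trap.
    have -> : W w + t - a' w + al = W w - (a' w - al) + t by ring.
    have -> : W w - a' w + al = W w - (a' w - al) by ring.
    have -> : W w + t - b' w = W w - b' w + t by ring.
    ring.
  rewrite EB ler_norml.
  have := E_ramp_incr d' t0; have := E_ramp_incr db' t0.
  have := E_ramp_incr_ge0 (fun w => a' w - al) t0; have := E_ramp_incr_ge0 b' t0.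
  move=> e1 e2 e3 e4; apply/andP; split; lra.
have [s0|s0] := leP 0 s; first by rewrite (ger0_norm s0); exact: key.
have s1 : 0 <= - s by lra.
rewrite (ltr0_norm s0) -normrN -EN.
have := key (- s) (fun w => a w - s) (fun w => b w - s) s1
  (dep1 (fun x => x - s) da) (dep1 (fun x => x - s) db).
apply: le_trans; rewrite le_eqVlt; apply/orP; left; apply/eqP; congr `|_|; apply: eq_E => w.
rewrite /h /trap.
have -> : W w + - s - (a w - s) + al = W w - a w + al by ring.
have -> : W w - (a w - s) + al = W w + s - a w + al by ring.
have -> : W w - (b w - s) = W w + s - b w by ring.
have -> : W w + - s - (b w - s) = W w - b w by ring.
ring.
Qed.

Section Discretized.
Variable L : nat.
Hypothesis L0 : (0 < L)%N.
Local Notation d := (L%:R^-1 : R).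
Local Notation node := (@node R L).
Local Notation kern := (@kern R L).

Let d0 : 0 < d. Proof. exact: dgt0. Qed.

Definition excess : R := \sum_(j in J) E (fun w : conf => `|X j w| * Num.max (`|Y j w| - 1) 0).
Definition absum : R := \sum_(j in J) E (fun w : conf => `|X j w|).
Definition Mj (l : bool * 'I_L) (j : I) (w : conf) : R := X j w * kern (Y j w) l.
(** The kernel of the representation of [T i0 * f (W)] as an integral of the trapezoid; it is a
  sum of local terms far away from [i0]. *)
Definition M (l : bool * 'I_L) (w : conf) : R := \sum_(j in J) Mj l j w.

Lemma excess_le : excess <= Gam.
Proof.
apply: le_trans (sum_third F); rewrite /excess [leRHS](bigID (mem J)) /=.
rewrite ler_wpDr //; first by apply: sumr_ge0 => j _; exact: third_ge0.
apply: ler_sum => j _; apply: le_trans (third_XV j); apply: ler_E => w.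
by rewrite ler_wpM2l // max1_le // Y_le_V.
Qed.

Lemma dep_Mj l j : dep (ball 1 j) (Mj l j).
Proof.
apply: (dep2 (fun x y => x * kern y l)); first by apply: dep_X; exact: ball_refl.
exact: dep_Y.
Qed.

Lemma far_S_Mj j x y : j \in J -> x \in S -> y \in ball 1 j -> (radius F < dist x y)%N.
Proof.
move=> jJ xS yj; apply: (@far_ball _ F 3 1 5 i0 j) => //; by move: jJ; rewrite inE.
Qed.

Lemma E_GM l (g : R -> R) :
  E (fun w => G w * g (M l w)) = E G * E (fun w => g (M l w)).
Proof.
apply: (@E_indep _ _ S (\bigcup_(j in J) ball 1 j)) => //.
  move=> x y xS /bigcupP[j jJ yj]; exact: far_S_Mj jJ xS yj.
apply: (dep1 g) => w w' H; apply: eq_bigr => j jJ; apply: dep_Mj => s sj.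
by apply: H; apply/bigcupP; exists j.
Qed.

Lemma var_M l : E (fun w => (M l w - E (M l)) ^+ 2) <=
  k * \sum_(j in J) E (fun w : conf => X j w ^+ 2 * `|kern (Y j w) l|).
Proof.
rewrite (eq_E (g := fun w => (\sum_(j in J) (Mj l j w - E (Mj l j))) ^+ 2)); last first.
  by move=> w; rewrite /M E_sum -sumrB.
apply: le_trans (@second_moment_le _ _ 3 _ _ isT _) _.
  move=> i j iJ jJ ji; rewrite (@E_indep _ _ (ball 1 i) (ball 1 j)).
  - by rewrite EB E_cst subrr mul0r.
  - by move=> x y xi yj; apply: (@far_ball _ F 1 1 3 i j).
  - by apply: (dep1 (fun x => x - E (Mj l i))); exact: dep_Mj.
  - by apply: (dep1 (fun x => x - E (Mj l j))); exact: dep_Mj.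
rewrite ler_wpM2l ?kap_ge0 //; apply: ler_sum => j _.
set m := E (Mj l j).
rewrite (eq_E (g := fun w => Mj l j w ^+ 2 - 2 * m * Mj l j w + m ^+ 2)); last first.
  by move=> w; rewrite sqrrB -mulr_natl; ring.
rewrite ED EB EZ E_cst -/m.
apply: (@le_trans _ _ (E (fun w => Mj l j w ^+ 2))).
  have := sqr_ge0 m; lra.
by rewrite le_eqVlt; apply/orP; left; apply/eqP; apply: eq_E => w; rewrite exprMn sqr_kern.
Qed.

(** Local dependence makes the variances of the kernel add up to a third-order quantity. *)
Lemma sum_var : d * (\sum_l E (fun w => (M l w - E (M l)) ^+ 2)) <= Gam.
Proof.
apply: le_trans (sum_sq_third F).
apply: (@le_trans _ _ (d * \sum_l k * \sum_(j in J) E (fun w : conf => X j w ^+ 2 * `|kern (Y j w) l|))).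
  by rewrite ler_wpM2l ?(ltW d0) //; apply: ler_sum => l _; exact: var_M.
rewrite -mulr_sumr exchange_big /= mulrCA -mulr_sumr ler_wpM2l ?kap_ge0 //.
rewrite mulr_sumr [leRHS](bigID (mem J)) /= ler_wpDr //.
  by apply: sumr_ge0 => j _; apply: E_ge0 => w; rewrite mulr_ge0 ?sqr_ge0 ?powR_ge0.
apply: ler_sum => j _; rewrite -E_sum -EZ; apply: ler_E => w.
rewrite -mulr_sumr mulrCA real_normK ?num_real // ler_wpM2l ?sqr_ge0 //.
by apply: (le_trans (abs_kern_sum L0 _)); apply: min1_le; exact: Y_le_V.
Qed.

Lemma sum_mean : 2 / 3 - (excess + d * absum) <= d * \sum_l E (M l).
Proof.
have -> : d * (\sum_l E (M l)) = \sum_(j in J) E (fun w => X j w * (d * \sum_l kern (Y j w) l)).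
  rewrite /M; under eq_bigr do rewrite E_sum.
  rewrite exchange_big mulr_sumr; apply: eq_bigr => j _; rewrite -E_sum -EZ.
  by apply: eq_E => w; rewrite /Mj -mulr_sumr mulrCA.
rewrite lerBlDr /excess /absum mulr_sumr -!big_split /=.
apply: le_trans (sum_far_XY i0 small) _; apply: ler_sum => j _.
rewrite -EZ -!ED; apply: ler_E => w; rewrite kern_sum //.
have := steps_diff L0 (Y j w); set u := (steps L (Y j w))%:R * _ - _ => H.
have : X j w * (Y j w - u) <= `|X j w| * (Num.max (`|Y j w| - 1) 0 + d).
  apply: le_trans (ler_norm _) _; rewrite normrM ler_wpM2l //.
  by rewrite distrC.
lra.
Qed.

(** Moving the trapezoid from [W + node l] back to [W] costs a first moment of the kernel. *)
Lemma sum_node : d * (\sum_l `|E (M l)| * `|node l|) <= Gam.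
Proof.
apply: le_trans (sum_third F).
apply: (@le_trans _ _ (d * \sum_l \sum_(j in J) E (fun w : conf => `|X j w| * (`|kern (Y j w) l| * `|node l|)))).
  rewrite ler_wpM2l ?(ltW d0) //; apply: ler_sum => l _.
  rewrite (eq_bigr (fun j => E (fun w => `|Mj l j w|) * `|node l|)); last first.
    move=> j _; rewrite -EZr; apply: eq_E => w; by rewrite /Mj normrM mulrA.
  rewrite -mulr_suml ler_wpM2r // /M E_sum; apply: le_trans (ler_norm_sum _ _ _) _.
  by apply: ler_sum => j _; exact: ler_norm_E.
rewrite exchange_big /= mulr_sumr [leRHS](bigID (mem J)) /= ler_wpDr //.
  by apply: sumr_ge0 => j _; exact: third_ge0.
apply: ler_sum => j _; apply: le_trans (third_XV j); rewrite -E_sum -EZ; apply: ler_E => w.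
rewrite -mulr_sumr mulrCA ler_wpM2l //.
by apply: (le_trans (kern_node_sum L0 _)); apply: min1_sqr_le; exact: Y_le_V.
Qed.

Lemma expand_kernel :
  d * (\sum_l E (fun w => G w * (M l w * h w (W w + node l)))) -
    E G * (excess + d * (1 + al^-1) * absum) <=
  E (fun w => G w * T i0 w * f w (W w)).
Proof.
rewrite expand_far lerBlDr.
have -> : excess + d * (1 + al^-1) * absum =
   \sum_(j in J) E (fun w : conf => `|X j w| * (Num.max (`|Y j w| - 1) 0 + d * (1 + al^-1))).
  rewrite /excess /absum mulr_sumr -big_split; apply: eq_bigr => j _ /=.
  by rewrite -EZ -ED; apply: eq_E => w; ring.
have -> : d * (\sum_l E (fun w => G w * (M l w * h w (W w + node l)))) =
  \sum_(j in J) E (fun w => G w * (X j w * (d * \sum_l kern (Y j w) l * h w (W w + node l)))).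
  rewrite -E_sum -EZ -E_sum; apply: eq_E => w.
  rewrite -!mulr_sumr mulrCA; congr (_ * _).
  rewrite /M /Mj; under eq_bigr do rewrite mulr_suml.
  rewrite exchange_big mulr_sumr; apply: eq_bigr => j _ /=.
  rewrite -mulrCA; congr (_ * _); rewrite mulr_sumr.
  by under eq_bigr do rewrite -mulrA; rewrite -mulr_sumr.
rewrite mulr_sumr -big_split /=; apply: ler_sum => j jJ.
rewrite -(@E_indep _ _ S (ball 1 j)) //; first last.
- apply: (dep2 (fun x y => `|x| * (Num.max (`|y| - 1) 0 + d * (1 + al^-1)))).
    by apply: dep_X; exact: ball_refl.
  exact: dep_Y.
- by move=> x y xS yj; exact: far_S_Mj jJ xS yj.
rewrite -ED; apply: ler_E => w; rewrite -mulrDr ler_wpM2l //.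
have := kern_ptrap L0 (a w) (b w) al0 (W w) (Y j w); rewrite -/(f w (W w)) -/(f w (W w - Y j w)).
set D := f w _ - _; set Z := d * _; set B := Num.max _ _ + _ => H.
have : X j w * (Z - D) <= `|X j w| * B.
  apply: le_trans (ler_norm _) _; rewrite normrM ler_wpM2l //.
  by rewrite distrC.
lra.
Qed.

Let P1 : R := E (fun w => G w * (a w <= W w <= b w)%R%:R).
Let H1 : R := E (fun w => G w * h w (W w)).
Let B1 : R := E (fun w => G w * ((b w - a w + al) * (a w - 2 <= W w)%R%:R)).

Lemma P1_le : P1 <= H1.
Proof.
apply: ler_E => w; rewrite ler_wpM2l //; case: (boolP (a w <= W w <= b w)) => [/andP[aW Wb]|_].
  by rewrite /h trap_eq1 // aW Wb.
exact: trap_ge0.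
Qed.

Lemma H1_le : H1 <= E G.
Proof. by apply: ler_E => w; rewrite ler_piMr // trap_le1. Qed.

Lemma H1_ge0 : 0 <= H1.
Proof. by apply: E_ge0 => w; rewrite mulr_ge0 // trap_ge0. Qed.

Lemma sum_h : d * (\sum_l E (fun w => G w * h w (W w + node l))) <= B1 + d * (2 / al) * E G.
Proof.
rewrite -E_sum -EZ -EZ -ED; apply: ler_E => w.
rewrite -mulr_sumr mulrCA [d * (2 / al) * _]mulrC -mulrDr ler_wpM2l //.
have d2 : 0 <= d * (2 / al) by rewrite mulr_ge0 ?(ltW d0) // divr_ge0 // ltW.
have [Wa|Wa] := leP (a w - 2) (W w).
  rewrite mulr1; exact: trap_node_sum.
rewrite mulr0 add0r big1 ?mulr0 // => l _; apply: trap_eq0 => //.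
have := @node_le1 R L L0 l; move: al1 Wa; lra.
Qed.

(** The fluctuation of the kernel is independent of [G].  It is separated from the trapezoid by the
  inequality [x * y <= c / 2 * y + x ^+ 2 / (2 * c)], valid for [y] in [[0, 1]]. *)
Lemma fluctuation :
  - (c / 2 * (B1 + d * (2 / al) * E G) + (2 * c)^-1 * (E G * Gam)) <=
  d * (\sum_l E (fun w => G w * ((M l w - E (M l)) * h w (W w + node l)))).
Proof.
have step l : - (c / 2 * E (fun w => G w * h w (W w + node l)) +
    (2 * c)^-1 * (E G * E (fun w => (M l w - E (M l)) ^+ 2))) <=
    E (fun w => G w * ((M l w - E (M l)) * h w (W w + node l))).
  rewrite -(E_GM l (fun x => (x - E (M l)) ^+ 2)) -!EZ -ED -EN; apply: ler_E => w.
  set x := M l w - _; set y := h w _.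
  have y0 : 0 <= y by exact: trap_ge0.
  have y1 : y <= 1 by exact: trap_le1.
  have yy : y ^+ 2 <= y by rewrite expr2 ler_piMr.
  have -> : - (c / 2 * (G w * y) + (2 * c)^-1 * (G w * x ^+ 2)) =
     G w * - (c / 2 * y + (2 * c)^-1 * x ^+ 2) by ring.
  rewrite ler_wpM2l // lerNl.
  have e : c / 2 * y + (2 * c)^-1 * x ^+ 2 + x * y =
    (2 * c)^-1 * (x + c * y) ^+ 2 + c / 2 * (y - y ^+ 2) by field; rewrite gt_eqF.
  rewrite -subr_ge0 opprK e addr_ge0 // mulr_ge0 ?sqr_ge0 ?invr_ge0 ?mulr_ge0 ?divr_ge0 ?subr_ge0 //; exact: ltW.
apply: (@le_trans _ _ (d * \sum_l - (c / 2 * E (fun w => G w * h w (W w + node l)) +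
    (2 * c)^-1 * (E G * E (fun w => (M l w - E (M l)) ^+ 2))))); last first.
  by rewrite ler_wpM2l ?(ltW d0) //; apply: ler_sum => l _; exact: step.
rewrite sumrN mulrN lerN2 big_split /= -!mulr_sumr mulrDr.
rewrite lerD // mulrCA ler_wpM2l ?divr_ge0 ?invr_ge0 ?mulr_ge0 ?(ltW c0) //.
  exact: sum_h.
rewrite mulrCA ler_wpM2l ?EG0 //; exact: sum_var.
Qed.

(** The mean of the kernel has total mass close to [2 / 3] at least, and is concentrated near [0]. *)
Lemma mean_part :
  2 / 3 * P1 - E G * (excess + d * absum) - 2 * Q * Gam / al * E G <=
  d * (\sum_l E (M l) * E (fun w => G w * h w (W w + node l))).
Proof.
have e1 : d * (\sum_l E (M l) * E (fun w => G w * h w (W w + node l))) =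
   (d * \sum_l E (M l)) * H1 +
   d * (\sum_l E (M l) * E (fun w => G w * (h w (W w + node l) - h w (W w)))).
  rewrite -mulrA -mulrDr mulr_suml -big_split /=; congr (_ * _); apply: eq_bigr => l _.
  by rewrite -mulrDr -ED; congr (_ * _); apply: eq_E => w; ring.
rewrite e1.
have u0 : 0 <= excess + d * absum.
  rewrite addr_ge0 ?mulr_ge0 ?(ltW d0) //; apply: sumr_ge0 => j _; apply: E_ge0 => w //.
have q1 : 2 / 3 * P1 - E G * (excess + d * absum) <= (d * \sum_l E (M l)) * H1.
  apply: le_trans (ler_wpM2r H1_ge0 sum_mean).
  have := P1_le; have := ler_wpM2r u0 H1_le; lra.
have q2 : - (2 * Q * Gam / al * E G) <=
    d * (\sum_l E (M l) * E (fun w => G w * (h w (W w + node l) - h w (W w)))).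
  rewrite lerNl -mulrN -sumrN.
  apply: (@le_trans _ _ (d * \sum_l (`|E (M l)| * `|node l|) * (2 / al * Q * E G))).
    rewrite ler_wpM2l ?(ltW d0) //; apply: ler_sum => l _.
    apply: le_trans (ler_norm _) _; rewrite normrN normrM -mulrA ler_wpM2l //.
    have := E_trap_incr (node l).
    by have -> : 2 * `|node l| / al * Q * E G = `|node l| * (2 / al * Q * E G) by ring.
  rewrite -mulr_suml mulrA.
  have -> : 2 * Q * Gam / al * E G = Gam * (2 / al * Q * E G) by ring.
  by rewrite ler_wpM2r ?sum_node // !mulr_ge0 ?EG0 // invr_ge0 ltW.
lra.
Qed.

Lemma concentration_discretized :
  2 / 3 * P1 <=
  E (fun w => G w * ((b w - a w + al) * (`|T i0 w| + c / 2) * (a w - 2 <= W w)%R%:R)) +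
  E G * (Gam / (2 * c) + 2 * Gam + 2 * Q * Gam / al) +
  E G * ((2 + al^-1) * absum + c / al) / L%:R.
Proof.
have := expand_kernel.
have -> : d * (\sum_l E (fun w => G w * (M l w * h w (W w + node l)))) =
  d * (\sum_l E (M l) * E (fun w => G w * h w (W w + node l))) +
  d * (\sum_l E (fun w => G w * ((M l w - E (M l)) * h w (W w + node l)))).
  rewrite -mulrDr -big_split /=; congr (_ * _); apply: eq_bigr => l _.
  by rewrite -EZ -ED; apply: eq_E => w; ring.
have -> : E (fun w => G w * ((b w - a w + al) * (`|T i0 w| + c / 2) * (a w - 2 <= W w)%R%:R)) =
   E (fun w => G w * ((b w - a w + al) * `|T i0 w|) * (a w - 2 <= W w)%R%:R) + c / 2 * B1.
  by rewrite -EZ -ED; apply: eq_E => w; ring.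
have := lhs_bound; have := fluctuation; have := mean_part.
have := ler_wpM2l EG0 excess_le.
have -> : E G * ((2 + al^-1) * absum + c / al) / L%:R =
  E G * (d * (1 + al^-1) * absum) + E G * (d * absum) + c / 2 * (d * (2 / al) * E G).
  by field; rewrite gt_eqF //= gt_eqF // ltr0n.
have -> : E G * (Gam / (2 * c) + 2 * Gam + 2 * Q * Gam / al) =
  (2 * c)^-1 * (E G * Gam) + 2 * (E G * Gam) + 2 * Q * Gam / al * E G.
  by field; rewrite !gt_eqF.
rewrite !mulrDr; lra.
Qed.

End Discretized.

(** The test function is the primitive [f] of the trapezoid [h] over [[a, b]].  The expectation of
  [G * T i0 * f (W)] is at most the first term on the right without [c].  It is also the expectation
  of [G] times the integral of [h (W + s)] against a kernel in [s] with mass at least [2 / 3], up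
  to errors of size [Gam].  The constant [Q] bounds a priori the mass of intervals of length [al]. *)
Theorem concentration :
  2 / 3 * E (fun w => G w * (a w <= W w <= b w)%R%:R) <=
  E (fun w => G w * ((b w - a w + al) * (`|T i0 w| + c / 2) * (a w - 2 <= W w)%R%:R)) +
  E G * (Gam / (2 * c) + 2 * Gam + 2 * Q * Gam / al).
Proof. by apply: le_of_le_addeps; exact: concentration_discretized. Qed.

End Inequality.

End Concentration.


Section UniformConcentration.
Variables (R : realType) (F : lfield R).
Local Notation conf := (conf F).
Local Notation I := (site F).
Local Notation Gam := (Gam F).
Implicit Types (G a b : conf -> R).

Lemma far_ball_compl r s (i x y : I) : (r < s)%N ->
  x \in ball r i -> y \in ~: ball s i -> (radius F < dist x y)%N.
Proof.
move=> rs xi; rewrite inE => yi.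
by apply: (@far_ball _ F r 0 s i y) => //; [rewrite addn0|exact: ball_refl].
Qed.

Lemma E_local_T i G g : dep (ball 3 i) G ->
  E (fun w => G w * g (T i w)) = E G * E (fun w => g (T i w)).
Proof.
move=> dG; apply: (@E_indep _ _ (ball 3 i) (~: ball 5 i)) => //.
  by move=> x y; exact: far_ball_compl.
by apply: dep1; exact: dep_SX.
Qed.

Definition conc_bound i al Q := forall G a, (forall w, 0 <= G w) ->
  dep (ball 3 i) G -> dep (ball 3 i) a ->
  E (fun w => G w * (a w <= W w <= a w + al)%R%:R) <= Q * E G.

Section Fixed.
Variables (i : I) (al : R).
Hypothesis small : Gam <= 75^-1.
Hypothesis al0 : 0 < al.
Hypothesis al1 : al <= 1.
Hypothesis Gal : 16 * Gam <= al.

(** The choice [c = 1 / 4], for which [concentration] improves the a priori constant: as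
  [16 * Gam <= al], only [3 / 16] of [Q] remains. *)
Lemma conc_general Q G a b : 0 <= Q -> conc_bound i al Q -> (forall w, 0 <= G w) ->
  dep (ball 3 i) G -> dep (ball 3 i) a -> dep (ball 3 i) b -> (forall w, a w <= b w) ->
  E (fun w => G w * (a w <= W w <= b w)%R%:R) <=
  9 / 4 * E (fun w => G w * (b w - a w)) + (3 * al + 3 / 16 * Q) * E G.
Proof.
move=> Q0 HQ G0 dG da db ab.
have c0 : 0 < 4^-1 :> R by rewrite invr_gt0.
have HQ' a' : dep (ball 3 i) a' -> E (fun w => G w * (a' w <= W w <= a' w + al)%R%:R) <= Q * E G.
  by move=> da'; exact: HQ.
have := concentration G0 dG da db ab al0 al1 c0 small Q0 HQ'.
have G1 : 0 <= E G by exact: E_ge0.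
have Gm := Gam_ge0 F.
have ba w : 0 <= b w - a w + al by move: (ab w) al0; lra.
have H1 : E (fun w => G w * ((b w - a w + al) * (`|T i w| + 4^-1 / 2) * (a w - 2 <= W w)%R%:R)) <=
    35 / 24 * (E (fun w => G w * (b w - a w)) + al * E G).
  apply: (@le_trans _ _ (E (fun w => G w * (b w - a w + al) * (`|T i w| + 4^-1 / 2)))).
    apply: ler_E => w; rewrite -!mulrA ler_wpM2l // ler_wpM2l //.
    by rewrite ler_piMr ?addr_ge0 ?divr_ge0 ?(ltW c0) ?lern1 ?leq_b1.
  have dGb : dep (ball 3 i) (fun w => G w * (b w - a w + al)).
    by move=> w w' H; rewrite (dG _ _ H) (da _ _ H) (db _ _ H).
  rewrite (@E_local_T _ _ (fun x => `|x| + 4^-1 / 2)) // ED E_cst.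
  have -> : E (fun w => G w * (b w - a w)) + al * E G = E (fun w => G w * (b w - a w + al)).
    by rewrite -EZ -ED; apply: eq_E => w; ring.
  rewrite mulrC ler_wpM2r //; last by have := E_absT i small; lra.
  by apply: E_ge0 => w; rewrite mulr_ge0.
have H2 : 2 * Q * Gam / al <= Q / 8.
  rewrite ler_pdivrMr //; have := ler_wpM2l Q0 Gal; lra.
have H3 : E G * (Gam / (2 * 4^-1) + 2 * Gam + 2 * Q * Gam / al) <= E G * (al / 4 + Q / 8).
  rewrite ler_wpM2l //; move: H2 Gal; lra.
have H4 : 0 <= E (fun w => G w * (b w - a w)).
  by apply: E_ge0 => w; rewrite mulr_ge0 // subr_ge0.
move=> H; have := mulr_ge0 (ltW al0) G1; move: H H1 H3 H4; lra.
Qed.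

(** Start from the trivial constant [1] and iterate [conc_general]; the excess over [7 * al] is
  at least halved each time. *)
Lemma conc_uniform : conc_bound i al (7 * al).
Proof.
have H n : conc_bound i al (7 * al + 2^-1 ^+ n).
  elim: n => [|n IH] G a G0 dG da.
    rewrite expr0 mulrDl mul1r; apply: (@le_trans _ _ (E G)).
      apply: ler_E => w; by rewrite ler_piMr // lern1 leq_b1.
    by rewrite lerDr mulr_ge0 ?E_ge0 // mulr_ge0 // ltW.
  have Q0 : 0 <= 7 * al + 2^-1 ^+ n.
    by rewrite addr_ge0 // ?exprn_ge0 ?invr_ge0 // mulr_ge0 // ltW.
  have db : dep (ball 3 i) (fun w => a w + al) by exact: (dep1 (fun x => x + al)).
  have ab w : a w <= a w + al by rewrite lerDl ltW.
  apply: le_trans (conc_general Q0 IH G0 dG da db ab) _.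
  have -> : E (fun w => G w * (a w + al - a w)) = E G * al.
    by rewrite -EZr; apply: eq_E => w; ring.
  have G1 : 0 <= E G by exact: E_ge0.
  have e0 : 0 <= 2^-1 ^+ n :> R by rewrite exprn_ge0 ?invr_ge0.
  rewrite exprS; set e := _ ^+ n in e0 *.
  have := mulr_ge0 G1 e0; have := mulr_ge0 G1 (ltW al0); lra.
move=> G a G0 dG da.
apply: (@le_of_le_addeps _ _ _ (E G)) => L L0.
apply: le_trans (H L G a G0 dG da) _; rewrite mulrDl lerD2l mulrC ler_wpM2l ?E_ge0 //.
rewrite exprVn ler_pV2 ?inE ?unitfE ?exprn_gt0 ?ltr0n ?pnatr_eq0 -?lt0n ?L0 ?andbT //=.
  by rewrite -natrX ler_nat ltnW // ltn_expl.
Qed.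

Theorem conc_interval G a b : (forall w, 0 <= G w) ->
  dep (ball 3 i) G -> dep (ball 3 i) a -> dep (ball 3 i) b -> (forall w, a w <= b w) ->
  E (fun w => G w * (a w <= W w <= b w)%R%:R) <=
  E (fun w => G w * (9 / 4 * (b w - a w) + 5 * al)).
Proof.
move=> G0 dG da db ab.
have Q0 : 0 <= 7 * al by rewrite mulr_ge0 // ltW.
apply: le_trans (conc_general Q0 conc_uniform G0 dG da db ab) _.
have -> : E (fun w => G w * (9 / 4 * (b w - a w) + 5 * al)) =
  9 / 4 * E (fun w => G w * (b w - a w)) + 5 * al * E G.
  by rewrite -!EZ -ED; apply: eq_E => w; ring.
have := mulr_ge0 (ltW al0) (E_ge0 G0); lra.
Qed.

End Fixed.
End UniformConcentration.


(** * Stein's identity under local dependence *)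

Section Taylor.
Variable R : realType.
Implicit Types f g : R -> R.

Lemma mean_value f g (x y : R) : (forall t, is_derive t (1 : R) f (g t)) ->
  exists t, [/\ Num.min x y <= t, t <= Num.max x y & f x - f y = (x - y) * g t].
Proof.
move=> fg.
have key a b : a <= b -> exists t, [/\ a <= t, t <= b & f b - f a = (b - a) * g t].
  move=> ab; have [] := @MVT_segment R f g a b ab.
    apply: derivable_within_continuous => t _; have := fg t => H; exact: ex_derive.
  by move=> t; rewrite in_itv /= => /andP[at_ tb] H; exists t; split => //; rewrite H mulrC.
case: (leP x y) => [xy|/ltW yx]; last exact: key.
have [t [h1 h2 H]] := key _ _ xy; exists t; split => //.
by rewrite -opprB H -mulNr opprB.
Qed.

End Taylor.

Section Decomposition.
Variables (R : realType) (F : lfield R).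
Local Notation conf := (conf F).
Local Notation I := (site F).

Definition Tc (i : I) : conf -> R := SX (~: ball 3 i).

Lemma norm_SX_sub (A B : {set I}) w : A \subset B -> `|SX B w - SX A w| <= AX B w.
Proof.
move=> AB; have -> : SX B w - SX A w = SX (B :\: A) w.
  by rewrite {1}/SX (big_setID A) /= (finset.setIidPr AB) -!/(SX _ w); ring.
by apply: (le_trans (norm_SX _ _)); apply: AX_sub; exact: subsetDl.
Qed.

Lemma W_Tc (i : I) (w : conf) : W w = SX (ball 3 i) w + Tc i w.
Proof. exact: W_split. Qed.

Lemma E_XfWY (i : I) (f : R -> R) : E (fun w : conf => X i w * f (W w - Y i w)) = 0.
Proof.
rewrite (@E_indep _ _ [set i] (~: ball 1 i)) ?E_X ?mul0r //.
- by move=> x y /set1P ->; rewrite !inE -ltnNge mul1n.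
- by apply: dep_X; rewrite inE.
- by move=> w w' H; rewrite !W_Y (dep_SX _ H).
Qed.

(** [X i] is centred and independent of [W - Y i], so the subtracted terms vanish. *)
Lemma E_Wf (f : R -> R) :
  E (fun w : conf => W w * f (W w)) =
  \sum_i E (fun w : conf => X i w * (f (W w) - f (W w - Y i w))).
Proof.
rewrite (eq_E (g := fun w => \sum_i X i w * f (W w))); last by move=> w; rewrite mulr_suml.
rewrite E_sum; apply: eq_bigr => i _.
by rewrite -[LHS]subr0 -(E_XfWY i f) -EB; apply: eq_E => w; rewrite mulrBr.
Qed.

Lemma sum_E_XY : \sum_i E (fun w : conf => X i w * Y i w) = 1.
Proof.
under eq_bigr do rewrite -E_XW.
by rewrite -E_sum -[RHS](E_W2 F); apply: eq_E => w; rewrite -mulr_suml expr2.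
Qed.

Variables (f g : R -> R) (chi r : I -> conf -> R).
Hypothesis fg : forall t, is_derive t (1 : R) f (g t).
Hypothesis chi01 : forall i w, 0 <= chi i w <= 1.
Hypothesis dchi : forall i, dep (ball 2 i) (chi i).
Hypothesis gr : forall i w s, `|s| <= V 3 i w -> `|g (Tc i w + s) - g (Tc i w)| <= r i w.

Lemma taylor_r (i : I) (w : conf) :
  `|f (W w) - f (W w - Y i w) - Y i w * g (Tc i w)| <= `|Y i w| * r i w.
Proof.
have [t [t1 t2 ->]] := mean_value (W w) (W w - Y i w) fg.
have -> : W w - (W w - Y i w) = Y i w by ring.
rewrite -mulrBr normrM ler_wpM2l //.
have -> : t = Tc i w + (t - Tc i w) by ring.
apply: gr; have := W_Tc i w => HW.
have h1 := norm_SX (ball 3 i) w.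
have h2 : `|SX (ball 3 i) w - Y i w| <= V 3 i w by apply: norm_SX_sub; exact: ball_mono.
rewrite -/(V 3 i w) in h1; move: t1 t2 h1 h2; rewrite HW.
set s := SX _ _; set y := Y _ _; set u := Tc _ _; set v := V _ _ _.
have -> : s + u - y = s - y + u by ring.
rewrite !ler_norml ge_min le_max => /orP[] q1 /orP[] q2 /andP[h1 h2] /andP[h3 h4];
  apply/andP; split; lra.
Qed.

Lemma gW_r (i : I) (w : conf) : `|g (W w) - g (Tc i w)| <= r i w.
Proof. by rewrite {1}(W_Tc i) [SX _ _ + _]addrC; apply: gr; exact: norm_SX. Qed.

Definition zeta (i : I) (w : conf) : R := chi i w * (`|X i w| * `|Y i w|).

(** At the sites where the cutoff [chi i] is [1], the increment of [f] is compared with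
  [Y i * g (Tc i)], and [Tc i] is independent of [X i] and [Y i].  Where it is [0], increments are
  bounded as they stand.  The uniform bound takes [chi i = 1]. *)
Theorem stein_decomposition :
  `|E (fun w : conf => g (W w)) - E (fun w : conf => W w * f (W w))| <=
  \sum_i (E (zeta i) * E (r i) + E (fun w => zeta i w * r i w) +
   (E (fun w : conf => (1 - chi i w) * (`|X i w| * `|Y i w|)) * E (fun w : conf => `|g (W w)|) +
    E (fun w : conf => (1 - chi i w) * (`|X i w| * `|f (W w) - f (W w - Y i w)|)))).
Proof.
rewrite E_Wf.
have -> : E (fun w : conf => g (W w)) =
    \sum_i E (fun w : conf => X i w * Y i w) * E (fun w : conf => g (W w)).
  by rewrite -mulr_suml sum_E_XY mul1r.
rewrite -sumrB.
apply: le_trans (ler_norm_sum _ _ _) _; apply: ler_sum => i _.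
set D := E (fun w : conf => X i w * (f (W w) - f (W w - Y i w))).
have chi0 w : 0 <= chi i w by have /andP[] := chi01 i w.
have chi1 w : 0 <= 1 - chi i w by rewrite subr_ge0; have /andP[] := chi01 i w.
pose a w := chi i w * (X i w * Y i w).
have za w : `|a w| = zeta i w by rewrite /a !normrM (ger0_norm (chi0 w)).
pose b w := (1 - chi i w) * (X i w * Y i w).
have da : dep (ball 2 i) a.
  move=> w w' H; rewrite /a (dchi H) (dep_X (ball_refl 2 i) H).
  by rewrite (dep_Y (@ball_mono _ F 1 2 i isT) H).
have e1 : E a * E (fun w : conf => g (Tc i w)) = E (fun w => a w * g (Tc i w)).
  rewrite (@E_indep _ _ (ball 2 i) (~: ball 3 i)) //.
    by move=> x y; exact: far_ball_compl.
  by apply: dep1; exact: dep_SX.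
have e2 : E (fun w : conf => X i w * Y i w) = E a + E b.
  by rewrite -ED; apply: eq_E => w; rewrite /a /b; ring.
have e3 : D = E (fun w : conf => chi i w * (X i w * (f (W w) - f (W w - Y i w)))) +
   E (fun w : conf => (1 - chi i w) * (X i w * (f (W w) - f (W w - Y i w)))).
  by rewrite -ED; apply: eq_E => w; ring.
have -> : E (fun w : conf => X i w * Y i w) * E (fun w : conf => g (W w)) - D =
  E a * E (fun w => g (W w) - g (Tc i w)) +
  - E (fun w : conf => chi i w * (X i w * (f (W w) - f (W w - Y i w) - Y i w * g (Tc i w)))) +
  (E b * E (fun w : conf => g (W w)) -
   E (fun w : conf => (1 - chi i w) * (X i w * (f (W w) - f (W w - Y i w))))).
  have -> : E (fun w : conf => chi i w * (X i w * (f (W w) - f (W w - Y i w) - Y i w * g (Tc i w)))) =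
    E (fun w : conf => chi i w * (X i w * (f (W w) - f (W w - Y i w)))) - E (fun w => a w * g (Tc i w)).
    by rewrite -EB; apply: eq_E => w; rewrite /a; ring.
  by rewrite EB e2 e3 -e1; ring.
apply: le_trans (ler_normD _ _) _; apply: lerD.
  apply: le_trans (ler_normD _ _) _; apply: lerD.
    rewrite normrM; apply: ler_pM => //.
      by apply: le_trans (ler_norm_E _) _; rewrite (eq_E za).
    by apply: le_trans (ler_norm_E _) _; apply: ler_E => w; exact: gW_r.
  rewrite normrN; apply: le_trans (ler_norm_E _) _; apply: ler_E => w.
  rewrite !normrM (ger0_norm (chi0 w)) /zeta -!mulrA ler_wpM2l // ler_wpM2l //.
  exact: taylor_r.
apply: le_trans (ler_normB _ _) _; apply: lerD.
  rewrite normrM; apply: ler_pM => //.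
    apply: le_trans (ler_norm_E _) _; apply: ler_E => w.
    by rewrite !normrM (ger0_norm (chi1 w)).
  exact: ler_norm_E.
apply: le_trans (ler_norm_E _) _; apply: ler_E => w.
by rewrite !normrM (ger0_norm (chi1 w)).
Qed.

End Decomposition.


(** * Tails of the sum *)

Section Derivatives.
Variable R : realType.
Implicit Types (f g : R -> R) (x a b : R).
Local Notation is_der f x a := (is_derive (x : R) (1 : R) (f : R -> R) (a : R)).

Lemma der_eq f x a b : is_der f x a -> a = b -> is_der f x b.
Proof. by move=> H <-. Qed.

Lemma der_id x : is_der (fun y => y) x 1.
Proof. exact: is_derive_id. Qed.

Lemma der_cst c x : is_der (fun=> c) x 0.
Proof. exact: is_derive_cst. Qed.

Lemma derD f g x a b : is_der f x a -> is_der g x b -> is_der (fun y => f y + g y) x (a + b).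
Proof. by move=> fa gb; exact: is_deriveD. Qed.

Lemma derB f g x a b : is_der f x a -> is_der g x b -> is_der (fun y => f y - g y) x (a - b).
Proof. by move=> fa gb; exact: is_deriveB. Qed.

Lemma derM f g x a b : is_der f x a -> is_der g x b ->
  is_der (fun y => f y * g y) x (f x * b + g x * a).
Proof. by move=> fa gb; exact: is_deriveM. Qed.

Lemma derX f n x a : is_der f x a -> is_der (fun y => f y ^+ n) x (n%:R * f x ^+ n.-1 * a).
Proof.
move=> fa; elim: n => [|n IH].
  by rewrite !mul0r; exact: der_cst.
have -> : (fun y => f y ^+ n.+1) = (fun y => f y * f y ^+ n).
  by apply/funext => y; rewrite exprS.
apply: der_eq (derM fa IH) _; rewrite -natr1 /=.
by case: n {IH} => [|n]; rewrite ?mulrA //= ?exprS; ring.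
Qed.

Lemma derV f x a : f x != 0 -> is_der f x a ->
  is_der (fun y => (f y)^-1) x (- (f x) ^- 2 * a).
Proof. by move=> fx fa; exact: is_deriveV. Qed.

Lemma derZ (c : R) f x a : is_der f x a -> is_der (fun y => c * f y) x (c * a).
Proof. by move=> fa; apply: der_eq (derM (der_cst c x) fa) _; rewrite mulr0 addr0. Qed.

Lemma der_scale f x a (c : R) : is_der f (x * c) a -> is_der (fun y => f (y * c)) x (a * c).
Proof.
move=> fa.
have gc : is_der (fun y => y * c) x c.
  by apply: der_eq (derM (der_id x) (der_cst c x)) _; rewrite mulr0 add0r mulr1.
exact: (@is_derive1_comp R f (fun y => y * c) x a c fa gc).
Qed.

Definition vf x := (1 + x ^+ 2)^-1.
(** Bounded substitute for [x ^+ 2]; the powers of [uf (W / z)] play the role of even moments. *)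
Definition uf x := x ^+ 2 * vf x.
(** Chosen such that [x * bump k x = uf x ^+ k.+1]; its derivative is [dpol k]. *)
Definition bump k x := x * vf x * uf x ^+ k.
Definition dpol k x := uf x ^+ k * (vf x * ((2 * k + 1)%:R * vf x - uf x)).

Lemma one_sqr_gt0 x : 0 < 1 + x ^+ 2.
Proof. by rewrite ltr_wpDr ?sqr_ge0. Qed.

Lemma vf_gt0 x : 0 < vf x. Proof. by rewrite invr_gt0 one_sqr_gt0. Qed.

Lemma uvE x : uf x = 1 - vf x.
Proof.
rewrite /uf /vf; apply: (mulIf (lt0r_neq0 (one_sqr_gt0 x))).
by rewrite divfK ?mulrBl ?mulVf ?lt0r_neq0 ?one_sqr_gt0 //; ring.
Qed.

Lemma uf_ge0 x : 0 <= uf x. Proof. by rewrite mulr_ge0 ?sqr_ge0 // ltW ?vf_gt0. Qed.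
Lemma uf_le1 x : uf x <= 1. Proof. by rewrite uvE; have := vf_gt0 x; lra. Qed.

Lemma der_vf x : is_der vf x (- (2 * x * vf x ^+ 2)).
Proof.
have h : is_der (fun y => 1 + y ^+ 2) x (2 * x).
  apply: der_eq (derD (der_cst 1 x) (derX 2 (der_id x))) _.
  by rewrite add0r mulr1 expr1.
apply: der_eq (derV _ h) _; first by rewrite gt_eqF ?one_sqr_gt0.
by rewrite /vf -exprVn mulNr mulrC.
Qed.

Lemma der_uf x : is_der uf x (2 * x * vf x ^+ 2).
Proof.
have -> : uf = (fun y => 1 - vf y) by apply/funext => y; exact: uvE.
by apply: der_eq (derB (der_cst 1 x) (der_vf x)) _; rewrite sub0r opprK.
Qed.

Lemma der_bump k x : is_der (bump k) x (dpol k x).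
Proof.
apply: der_eq (derM (derM (der_id x) (der_vf x)) (derX k (der_uf x))) _.
rewrite /dpol; set u := uf x; set v := vf x.
have xv : x ^+ 2 * v = u by [].
have uv : u = 1 - v by exact: uvE.
case: k => [|k].
  rewrite !mul0r !mulr0 add0r !expr0 muln0 add0n !mul1r mulr1.
  have -> : x * - (2 * x * v ^+ 2) = - 2 * (x ^+ 2 * v) * v by ring.
  by rewrite xv uv; ring.
rewrite /= (exprS u k).
have -> : x * v * (k.+1%:R * u ^+ k * (2 * x * v ^+ 2)) = k.+1%:R * u ^+ k * 2 * v ^+ 2 * (x ^+ 2 * v) by ring.
have -> : x * - (2 * x * v ^+ 2) = - 2 * (x ^+ 2 * v) * v by ring.
rewrite xv natrD natrM -natr1.
have -> : v * 1 = v * (u + v) by rewrite uv subrK.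
ring.
Qed.

Lemma uf_lip x y : `|uf x - uf y| <= `|x - y|.
Proof.
have -> : uf x - uf y = (x - y) * ((x + y) * (vf x * vf y)).
  by rewrite !uvE /vf; field; rewrite !gt_eqF ?one_sqr_gt0.
rewrite normrM ler_piMr // normrM (gtr0_norm (mulr_gt0 (vf_gt0 x) (vf_gt0 y))).
rewrite /vf -invfM ler_pdivrMr ?mulr_gt0 ?one_sqr_gt0 // mul1r.
apply: le_trans (ler_normD _ _) _.
have h (t : R) : `|t| <= (1 + t ^+ 2) / 2.
  by have := sqr_ge0 (`|t| - 1); rewrite sqrrB real_normK ?num_real //; lra.
have := h x; have := h y; have := mulr_ge0 (sqr_ge0 x) (sqr_ge0 y).
have := sqr_ge0 x; have := sqr_ge0 y; lra.
Qed.

Lemma exp_lip k (s t : R) : 0 <= s <= 1 -> 0 <= t <= 1 -> `|s ^+ k - t ^+ k| <= k%:R * `|s - t|.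
Proof.
move=> /andP[s0 s1] /andP[t0 t1]; elim: k => [|k IH].
  by rewrite !expr0 subrr normr0 mul0r.
have -> : s ^+ k.+1 - t ^+ k.+1 = s * (s ^+ k - t ^+ k) + (s - t) * t ^+ k.
  by rewrite !exprS; ring.
apply: le_trans (ler_normD _ _) _; rewrite -natr1 [leRHS]mulrDl mul1r; apply: lerD.
  rewrite normrM (ger0_norm s0); apply: le_trans IH.
  by rewrite ler_piMl.
rewrite normrM ler_piMr // ger0_norm ?exprn_ge0 // exprn_ile1 //.
Qed.

Definition dlip k : R := (2 * k + 2)%:R * (k + 2)%:R.

Lemma dpol_lip k x y : `|dpol k x - dpol k y| <= dlip k * `|x - y|.
Proof.
pose q u : R := (1 - u) * ((2 * k + 1)%:R * (1 - u) - u).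
have dE z : dpol k z = uf z ^+ k * q (uf z).
  by rewrite /dpol /q; have -> : vf z = 1 - uf z by rewrite uvE; ring.
have b z : 0 <= uf z <= 1 by rewrite uf_ge0 uf_le1.
have n0 : 0 <= k%:R :> R by [].
have qb u : 0 <= u <= 1 -> `|q u| <= (2 * k + 2)%:R.
  move=> /andP[u0 u1]; rewrite /q natrD natrM natrD.
  rewrite normrM -[leRHS]mul1r ler_pM // ?ler_norml; first by apply/andP; split; lra.
  have := mulr_ge0 n0 u0; have u1' : 0 <= 1 - u by lra.
  by have := mulr_ge0 n0 u1'; move=> *; apply/andP; split; lra.
have ql u t : 0 <= u <= 1 -> 0 <= t <= 1 -> `|q u - q t| <= (2 * k + 2)%:R * 2 * `|u - t|.
  move=> /andP[u0 u1] /andP[t0 t1].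
  have -> : q u - q t = (u - t) * ((2 * k + 2)%:R * ((u - 1) + (t - 1)) + 1).
    by rewrite /q; ring.
  rewrite normrM mulrC ler_wpM2r // natrD natrM ler_norml.
  have := mulr_ge0 n0 u0; have := mulr_ge0 n0 t0.
  have u1' : 0 <= 1 - u by lra.
  have t1' : 0 <= 1 - t by lra.
  have := mulr_ge0 n0 u1'; have := mulr_ge0 n0 t1'.
  by move=> *; apply/andP; split; lra.
rewrite !dE.
have -> : uf x ^+ k * q (uf x) - uf y ^+ k * q (uf y) =
  (uf x ^+ k - uf y ^+ k) * q (uf x) + uf y ^+ k * (q (uf x) - q (uf y)) by ring.
apply: le_trans (ler_normD _ _) _; rewrite (normrM _ (q _)) (normrM (uf y ^+ k)).
have ul := uf_lip x y.
have h1 : `|uf x ^+ k - uf y ^+ k| * `|q (uf x)| <= k%:R * `|x - y| * (2 * k + 2)%:R.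
  apply: ler_pM => //; last exact: qb.
  by apply: le_trans (exp_lip k (b x) (b y)) _; rewrite ler_wpM2l.
have h2 : `|uf y ^+ k| * `|q (uf x) - q (uf y)| <= (2 * k + 2)%:R * 2 * `|x - y|.
  apply: le_trans (_ : `|q (uf x) - q (uf y)| <= _).
    rewrite ler_piMl // ger0_norm ?exprn_ge0 ?uf_ge0 // exprn_ile1 ?uf_ge0 ?uf_le1 //.
  apply: le_trans (ql _ _ (b x) (b y)) _; rewrite ler_wpM2l //.
have -> : dlip k * `|x - y| =
  k%:R * `|x - y| * (2 * k + 2)%:R + (2 * k + 2)%:R * 2 * `|x - y| by rewrite /dlip; ring.
exact: lerD.
Qed.

(** The factor [uf x ^+ k] on the right closes the recursion for the moments. *)
Lemma dpol_le k x : dpol k x <= (2 * k + 1)%:R * uf x ^+ k.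
Proof.
rewrite /dpol mulrC ler_wpM2r ?exprn_ge0 ?uf_ge0 //.
have := vf_gt0 x; have := uf_ge0 x; have := uf_le1 x; have := uvE x.
set v := vf x; move=> -> u1 u0 v0.
have n0 : 0 <= (2 * k + 1)%:R :> R by [].
have v1 : 0 <= 1 + v by lra.
have := mulr_ge0 (mulr_ge0 n0 u0) v1; have := mulr_ge0 (ltW v0) u0; lra.
Qed.

Lemma dpol_min k x y : `|dpol k x - dpol k y| <= dlip k * Num.min `|x - y| 1.
Proof.
rewrite minr_pMr; last by rewrite /dlip mulr_ge0.
rewrite le_min dpol_lip mulr1 /=.
have n0 : 0 <= k%:R :> R by [].
have bd z : `|dpol k z| <= (2 * k + 2)%:R.
  rewrite ler_norml; apply/andP; split.
    rewrite /dpol; have uk : 0 <= uf z ^+ k by rewrite exprn_ge0 ?uf_ge0.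
    have uk1 : uf z ^+ k <= 1 by rewrite exprn_ile1 ?uf_ge0 ?uf_le1.
    have v0 := vf_gt0 z; have u0 := uf_ge0 z; have u1 := uf_le1 z; have uv := uvE z.
    have h : - 1 <= vf z * ((2 * k + 1)%:R * vf z - uf z).
      have n1 : 0 <= (2 * k + 1)%:R :> R by [].
      have := mulr_ge0 n1 (sqr_ge0 (vf z)).
      have : vf z * uf z <= 1 by rewrite -[leRHS]mulr1 ler_pM // ?(ltW v0) //; lra.
      rewrite expr2; lra.
    apply: (@le_trans _ _ (- 1)); first by rewrite lerN2 natrD natrM; lra.
    by have := ler_wpM2l uk h; lra.
  apply: le_trans (dpol_le k z) _; apply: (@le_trans _ _ (2 * k + 1)%:R); last by rewrite ler_nat leq_add2l.
  by rewrite ler_piMr // exprn_ile1 ?uf_ge0 ?uf_le1.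
apply: le_trans (ler_normB _ _) _; have := bd x; have := bd y.
have : (2 * k + 2)%:R * 2 <= dlip k by rewrite /dlip ler_wpM2l // ler_nat leq_addl.
lra.
Qed.

Lemma uf_ge_half x : 1 <= `|x| -> 2^-1 <= uf x.
Proof.
move=> x1; have x2 : 1 <= x ^+ 2 by rewrite -real_normK ?num_real // exprn_ege1.
rewrite uvE /vf; have : (1 + x ^+ 2)^-1 <= 2^-1 by rewrite lef_pV2 ?posrE ?one_sqr_gt0 //; lra.
lra.
Qed.

End Derivatives.

Section Tail.
Variable R : realType.

(** The test function [bump k (w / z)] in Stein's identity gives a recursion for
  the moments of [uf (W / z)], which behave like the probability of [`|W| >= z]; each step
  gains a factor [z^-1 ^+ 2], up to an error of size [Gam * z `^ (- p)]. *)
Lemma tail_moment_step (k : nat) (F : lfield R) (z : R) : 1 <= z ->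
  E (fun w : conf F => uf (W w / z) ^+ k.+1) <=
  (2 * k + 1)%:R * z^-1 ^+ 2 * E (fun w : conf F => uf (W w / z) ^+ k) +
  2 * dlip R k * Gam F * z `^ (- expo F).
Proof.
move=> z1; set p := expo F; have p2 : 2 < p := p2 F; have p3 : p <= 3 := p3 F.
have z0 : 0 < z by exact: lt_le_trans z1.
have zi0 : 0 <= z^-1 by rewrite invr_ge0 ltW.
have n0 : 0 <= dlip R k by rewrite /dlip mulr_ge0.
pose f w := bump k (w * z^-1); pose g w := dpol k (w * z^-1) * z^-1.
have fg t : is_derive (t : R) (1 : R) f (g t) by apply: der_scale; exact: der_bump.
pose c := dlip R k * z^-1 * z `^ (- (p - 2)).
have c0 : 0 <= c by rewrite !mulr_ge0 ?powR_ge0.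
pose r i (w : conf F) := c * V 5 i w `^ (p - 2).
have gr i (w : conf F) s : `|s| <= V 3 i w -> `|g (Tc i w + s) - g (Tc i w)| <= r i w.
  move=> sV; have sV5 : `|s| <= V 5 i w by apply: le_trans sV _; exact: V_mono.
  rewrite /g -mulrBl normrM (ger0_norm zi0) /r /c.
  have -> : dlip R k * z^-1 * z `^ (- (p - 2)) * V 5 i w `^ (p - 2) =
    dlip R k * (V 5 i w * z^-1) `^ (p - 2) * z^-1.
    rewrite powRM ?V_ge0 // -powR_inv1 ?(ltW z0) // -powRrM mulN1r; ring.
  rewrite ler_wpM2r //; apply: le_trans (dpol_min _ _ _) _.
  rewrite ler_wpM2l //; apply: min1_le; rewrite -mulrBl addrC addKr normrM (ger0_norm zi0).
  by rewrite ler_wpM2r.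
have := @stein_decomposition R F f g (fun _ _ => 1) r fg (fun i w => _) (fun i => _) gr.
set B := \sum_i _ => /(_ _ _) HB.
have HB' : `|E (fun w : conf F => g (W w)) - E (fun w : conf F => W w * f (W w))| <= B.
  by apply: HB => // i w; rewrite ler01 lexx.
have BG : B <= 2 * c * Gam F.
  apply: (@le_trans _ _ (\sum_i 2 * c * third i)); last first.
    have c2 : 0 <= 2 * c by rewrite mulr_ge0.
    rewrite -mulr_sumr; apply: (ler_wpM2l c2); exact: sum_third.
  apply: ler_sum => i _.
  have z1E : zeta (fun _ _ => 1) i =1 (fun w : conf F => `|X i w| * `|Y i w|).
    by move=> w; rewrite /zeta mul1r.
  have -> : E (fun w : conf F => (1 - 1) * (`|X i w| * `|Y i w|)) = 0.
    by rewrite (eq_E (g := fun=> 0)) ?E_cst // => w; rewrite subrr mul0r.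
  have -> : E (fun w : conf F => (1 - 1) * (`|X i w| * `|f (W w) - f (W w - Y i w)|)) = 0.
    by rewrite (eq_E (g := fun=> 0)) ?E_cst // => w; rewrite subrr mul0r.
  rewrite mul0r !addr0 (eq_E z1E) /r EZ.
  have -> : E (fun w : conf F => zeta (fun _ _ => 1) i w * (c * V 5 i w `^ (p - 2))) =
    c * E (fun w : conf F => `|X i w| * `|Y i w| * V 5 i w `^ (p - 2)).
    by rewrite -EZ; apply: eq_E => w; rewrite z1E; ring.
  have -> : 2 * c * third i = c * third i + c * third i by ring.
  rewrite mulrCA; apply: lerD; rewrite ler_wpM2l //.
    exact: third_XY_V.
  exact: third_XYV.
have uE (w : conf F) : uf (W w / z) ^+ k.+1 = z^-1 * (W w * f (W w)).
  by rewrite /f /bump exprS {1}/uf; ring.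
rewrite (eq_E uE) EZ.
have gE : E (fun w : conf F => g (W w)) <= (2 * k + 1)%:R * z^-1 * E (fun w : conf F => uf (W w / z) ^+ k).
  rewrite -EZ; apply: ler_E => w; rewrite /g.
  have := ler_wpM2r zi0 (dpol_le k (W w * z^-1)); by rewrite [X in _ <= X -> _]mulrAC.
have -> : 2 * dlip R k * Gam F * z `^ (- p) = z^-1 * (2 * c * Gam F).
  rewrite /c; have -> : z `^ (- p) = z^-1 * z^-1 * z `^ (- (p - 2)).
    have -> : - p = - 1 + (- 1 + - (p - 2)) by ring.
    by rewrite !powRD ?(gt_eqF z0) ?implybT // -!powR_inv1 ?(ltW z0) // mulrA.
  ring.
have -> : (2 * k + 1)%:R * z^-1 ^+ 2 * E (fun w : conf F => uf (W w / z) ^+ k) =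
  z^-1 * ((2 * k + 1)%:R * z^-1 * E (fun w : conf F => uf (W w / z) ^+ k)) by ring.
rewrite -mulrDr ler_wpM2l //.
move: HB' => /ler_normlP[h1 _]; rewrite -lerBlDl.
apply: le_trans BG; apply: le_trans h1; rewrite opprB lerD2l lerN2; exact: gE.
Qed.

Lemma tail_moment (k : nat) : exists2 C : R, 0 <= C & forall (F : lfield R) (z : R), 1 <= z ->
  E (fun w : conf F => uf (W w / z) ^+ k) <=
  C * (z^-1 ^+ (2 * k) + Gam F * z `^ (- expo F)).
Proof.
elim: k => [|k [C C0 IH]].
  exists 1 => // F z z1; rewrite mul1r (eq_E (g := fun=> 1)) ?E_cst //.
  by rewrite muln0 expr0 lerDl mulr_ge0 ?powR_ge0 ?Gam_ge0.
exists ((2 * k + 1)%:R * C + 2 * dlip R k).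
  by rewrite addr_ge0 // ?mulr_ge0 // /dlip mulr_ge0.
move=> F z z1; apply: le_trans (tail_moment_step k F z1) _.
have z0 : 0 < z by exact: lt_le_trans z1.
have zi0 : 0 <= z^-1 by rewrite invr_ge0 ltW.
have zi1 : z^-1 ^+ 2 <= 1 by rewrite exprn_ile1 // invf_le1.
have G0 : 0 <= Gam F * z `^ (- expo F) by rewrite mulr_ge0 ?powR_ge0 ?Gam_ge0.
have dl : 0 <= dlip R k by rewrite /dlip mulr_ge0.
have zk : 0 <= z^-1 ^+ (2 * k) by rewrite exprn_ge0.
have n0 : 0 <= (2 * k + 1)%:R :> R by [].
have zz : 0 <= z^-1 ^+ 2 by rewrite exprn_ge0.
have nz : 0 <= (2 * k + 1)%:R * z^-1 ^+ 2 by rewrite mulr_ge0.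
have h1 := ler_wpM2l nz (IH F z z1).
have -> : z^-1 ^+ (2 * k.+1) = z^-1 ^+ 2 * z^-1 ^+ (2 * k) by rewrite mulnS exprD.
have h2 : (2 * k + 1)%:R * C * (z^-1 ^+ 2 * (Gam F * z `^ (- expo F))) <=
   (2 * k + 1)%:R * C * (Gam F * z `^ (- expo F)).
  by rewrite ler_wpM2l ?mulr_ge0 // ler_piMl.
have h3 : 0 <= dlip R k * (z^-1 ^+ 2 * z^-1 ^+ (2 * k)) by rewrite !mulr_ge0.
lra.
Qed.

Lemma tail_prob (k : nat) : exists2 C : R, 0 <= C & forall (F : lfield R) (z : R), 1 <= z ->
  E (fun w : conf F => (z <= `|W w|)%R%:R) <=
  C * (z^-1 ^+ (2 * k) + Gam F * z `^ (- expo F)).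
Proof.
have [C C0 H] := tail_moment k.
exists (2 ^+ k * C); first by rewrite mulr_ge0 ?exprn_ge0.
move=> F z z1; rewrite -mulrA; apply: (@le_trans _ _ (2 ^+ k * E (fun w : conf F => uf (W w / z) ^+ k))); last first.
  by rewrite ler_wpM2l ?exprn_ge0 // H.
have z0 : 0 < z by exact: lt_le_trans z1.
rewrite -EZ; apply: ler_E => w; case: (leP z `|W w|) => [zW|_] /=; last first.
  by rewrite mulr_ge0 ?exprn_ge0 ?uf_ge0.
rewrite -exprMn exprn_ege1 // -ler_pdivrMl // mulr1; apply: uf_ge_half.
by rewrite normrM (gtr0_norm (_ : 0 < z^-1)) ?invr_gt0 // ler_pdivlMr // mul1r.
Qed.

End Tail.


(** * The normal distribution and Stein's equation *)

Section Gauss.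
Variable R : realType.
Local Open Scope classical_set_scope.
Local Notation mu := (@lebesgue_measure R).
Implicit Types (x y z : R) (K : R -> R).

Definition npdf x : R := normal_pdf 0 1 x.

Lemma npdfE x : npdf x = normal_peak 1 * expR (- (x ^+ 2 / 2)).
Proof.
rewrite /npdf normal_pdfE ?oner_neq0 // /normal_fun subr0 expr1n mulNr.
by [].
Qed.

Lemma npdf_gt0 x : 0 < npdf x.
Proof. by rewrite npdfE mulr_gt0 ?expR_gt0 // normal_peak_gt0 ?oner_neq0. Qed.

Lemma npdf_ge0 x : 0 <= npdf x. Proof. exact: ltW (npdf_gt0 x). Qed.

Lemma npdf_cont : continuous npdf.
Proof. exact: continuous_normal_pdf (oner_neq0 _). Qed.

Lemma npdf_int : mu.-integrable setT (EFin \o npdf).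
Proof. exact: integrable_normal_pdf. Qed.

Definition Phi x : R := fine (normal_prob 0 1 `]-oo, x] : \bar R).

Lemma std_normal_cdfE x : std_normal_cdf x = (Phi x)%:E.
Proof. by rewrite /std_normal_cdf /Phi fineK // fin_num_measure. Qed.

Lemma PhiE x : Phi x = \int[mu]_(t in `]-oo, x]) npdf t.
Proof. by []. Qed.

Definition Ileft K x : R := \int[mu]_(t in `]-oo, x]) K t.
Definition Iall K : R := \int[mu]_t K t.

Lemma Iall_npdf : Iall npdf = 1.
Proof. by rewrite /Iall /Rintegral integral_normal_pdf. Qed.

(** Satisfied by the density and by its product with a smoothed indicator. *)
Definition dominated K := [/\ continuous K, (forall x, 0 <= K x) & (forall x, K x <= npdf x)].

Lemma dominated_npdf : dominated npdf.
Proof. by split=> [|x|//]; [exact: npdf_cont|exact: npdf_ge0]. Qed.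

Lemma dom_int K : dominated K -> mu.-integrable setT (EFin \o K).
Proof.
move=> [cK K0 Kn]; apply: (le_integrable _ _ _ npdf_int) => //.
  by apply/measurable_EFinP; exact: continuous_measurable_fun.
move=> x _ /=; rewrite lee_fin ger0_norm // ger0_norm ?npdf_ge0 //.
Qed.

Lemma dom_intS K (A : set R) : dominated K -> measurable A -> mu.-integrable A (EFin \o K).
Proof. by move=> dK mA; apply: integrableS (dom_int dK). Qed.

(** The fundamental theorem of calculus. *)
Lemma der_Ileft K x : dominated K -> is_derive x (1 : R) (Ileft K) (K x).
Proof.
move=> dK; have [cK _ _] := dK.
have xx : x < x + 1 by rewrite ltrDl.
have := @continuous_FTC1 R K -oo%O x (x + 1) xx (dom_intS dK (measurable_itv _)) (ltNyr x) (cK x).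
move=> [d1 d2]; apply: DeriveDef; first exact: d1.
by rewrite -derive1E; exact: d2.
Qed.

Lemma Ileft_ge0 K x : dominated K -> 0 <= Ileft K x.
Proof. by move=> [_ K0 _]; apply: Rintegral_ge0. Qed.

Lemma Ileft_le K x : dominated K -> Ileft K x <= Phi x.
Proof.
move=> dK; have [_ _ Kn] := dK; rewrite PhiE.
by apply: le_Rintegral => //; [exact: dom_intS|exact: dom_intS dominated_npdf _].
Qed.

Lemma Iall_split K x : dominated K ->
  Iall K - Ileft K x = \int[mu]_(t in `]x, +oo[) K t.
Proof.
move=> dK; rewrite /Iall /Ileft -set_itvNyy; apply: Rintegral_itvB => //.
by rewrite set_itvNyy; exact: dom_int.
Qed.

Lemma Iright_ge0 K x : dominated K -> 0 <= Iall K - Ileft K x.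
Proof. by move=> dK; rewrite Iall_split //; have [_ K0 _] := dK; apply: Rintegral_ge0. Qed.

Lemma Iright_le K x : dominated K -> Iall K - Ileft K x <= 1 - Phi x.
Proof.
move=> dK; rewrite -[1]Iall_npdf PhiE -/(Ileft npdf x) !Iall_split //; last exact: dominated_npdf.
have [_ _ Kn] := dK.
by apply: le_Rintegral => //; [exact: dom_intS|exact: dom_intS dominated_npdf _].
Qed.

Lemma Phi_ge0 x : 0 <= Phi x.
Proof. by rewrite PhiE; apply: Rintegral_ge0 => t _; exact: npdf_ge0. Qed.

Lemma Phi_le1 x : Phi x <= 1.
Proof. have := Iright_ge0 x dominated_npdf; rewrite Iall_npdf -/(Phi x) subr_ge0 //. Qed.

Lemma der_Phi x : is_derive x (1 : R) Phi (npdf x).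
Proof. exact: der_Ileft dominated_npdf. Qed.

Lemma der_npdf x : is_derive x (1 : R) npdf (- x * npdf x).
Proof.
have -> : npdf = (fun x => normal_peak 1 * expR (- (x ^+ 2 / 2))).
  by apply/funext => t; exact: npdfE.
have h : is_derive x (1 : R) (fun t : R => - 2^-1 * t ^+ 2) (- x).
  apply: der_eq (derZ (- 2^-1) (derX 2 (der_id x))) _; rewrite expr1 mulr1; lra.
have h2 := derZ (normal_peak 1) (@is_derive1_comp R expR (fun t : R => - 2^-1 * t ^+ 2) x _ _ (is_derive_expR _) h).
have e (t : R) : - (t ^+ 2 / 2) = - 2^-1 * t ^+ 2 by ring.
have -> : (fun t : R => normal_peak 1 * expR (- (t ^+ 2 / 2))) =
   (fun t : R => normal_peak 1 * (expR \o (fun t : R => - 2^-1 * t ^+ 2)) t).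
  by apply/funext => t; rewrite /= e.
by apply: der_eq h2 _; rewrite /= e; ring.
Qed.

Lemma der_mono (f g : R -> R) (x y : R) : (forall t, x <= t -> is_derive t (1 : R) f (g t)) ->
  (forall t, x <= t -> g t <= 0) -> x <= y -> f y <= f x.
Proof.
move=> fg g0 xy; have [] := @MVT_segment R f g x y xy.
  by move=> t; rewrite in_itv /= => /andP[/ltW xt _]; exact: fg.
  apply: derivable_within_continuous => t; rewrite in_itv /= => /andP[xt _].
  by have := fg t xt => H; exact: ex_derive.
move=> c; rewrite in_itv /= => /andP[xc _] H.
by rewrite -subr_le0 H mulr_le0_ge0 ?g0 // subr_ge0.
Qed.

Let idTR : measurableTypeR R -> R := idfun.
#[local] HB.instance Definition _ :=
  @isMeasurableFun.Build _ _ _ _ idTR (@measurable_id _ _ setT).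

Lemma Phi_cvg1 (e : R) : 0 < e -> exists M : R, forall x, M <= x -> 1 - Phi x <= e.
Proof.
move=> e0; have := @cvg_cdfy1 _ _ R (normal_prob 0 1) (idTR : {RV _ >-> R}).
move=> /fine_cvgP[_ /cvgrPdist_le /(_ e e0)] [M [Mr HM]].
exists (M + 1) => x Mx; have /HM : M < x by apply: lt_le_trans Mx; rewrite ltrDl.
by move=> /ler_normlP[_]; exact.
Qed.

Lemma Phi_cvg0 (e : R) : 0 < e -> exists M : R, forall x, x <= M -> Phi x <= e.
Proof.
move=> e0; have := @cvg_cdfNy0 _ _ R (normal_prob 0 1) (idTR : {RV _ >-> R}).
move=> /fine_cvgP[_ /cvgrPdist_le /(_ e e0)] [M [Mr HM]].
exists (M - 1) => x Mx; have /HM : x < M by apply: le_lt_trans Mx _; rewrite ltrBlDr ltrDl.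
by rewrite sub0r normrN => /ler_normlP[_]; exact.
Qed.

Lemma npdfN x : npdf (- x) = npdf x.
Proof. by rewrite !npdfE sqrrN. Qed.

(** The function [Phi t + Phi (- t)] has derivative [0] and limit [1]. *)
Lemma PhiN x : Phi (- x) = 1 - Phi x.
Proof.
pose s t := Phi t + Phi (t * -1).
have ds t : is_derive t (1 : R) s 0.
  apply: der_eq (derD (der_Phi t) (der_scale (der_Phi _))) _.
  by rewrite !mulrN1 npdfN subrr.
have sc t u : s t = s u.
  by have [c [_ _]] := mean_value t u ds; rewrite mulr0 => /eqP; rewrite subr_eq0 => /eqP.
have s1 : s x = 1.
  apply/eqP; rewrite -subr_eq0 -normr_le0; apply/ler_addgt0Pr => e e0; rewrite add0r.
  have e2 : 0 < e / 2 by rewrite divr_gt0.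
  have [M HM] := Phi_cvg1 e2; have [M' HM'] := Phi_cvg0 e2.
  pose t := Num.max M (- M'); rewrite (sc x t) /s mulrN1.
  have h1 := HM t; have h2 := HM' (- t); have h3 := Phi_le1 t; have h4 := Phi_ge0 (- t).
  have {}h1 := h1 (_ : M <= t); have {}h2 := h2 (_ : - t <= M').
  have q1 : M <= t by rewrite le_max lexx.
  have q2 : - t <= M' by rewrite lerNl le_max lexx orbT.
  move: (h1 q1) (h2 q2) => {}h1 {}h2; rewrite ler_norml; apply/andP; split; lra.
by move: s1; rewrite /s mulrN1 => <-; rewrite addrAC subrr add0r.
Qed.

(** The function [npdf t / t + Phi t] is nonincreasing for [t >= x] and has limit [1]. *)
Lemma mills x : 0 < x -> x * (1 - Phi x) <= npdf x.
Proof.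
move=> x0; rewrite -ler_pdivlMl //.
pose q t := npdf t * t^-1 + Phi t.
have dq t : x <= t -> is_derive t (1 : R) q (- (npdf t * t ^- 2)).
  move=> xt; have t0 : 0 < t by exact: lt_le_trans xt.
  apply: der_eq (derD (derM (der_npdf t) (derV (lt0r_neq0 t0) (der_id t))) (der_Phi t)) _.
  by field; rewrite gt_eqF.
have q0 t : x <= t -> - (npdf t * t ^- 2) <= 0.
  by move=> _; rewrite oppr_le0 mulr_ge0 ?npdf_ge0 // invr_ge0 sqr_ge0.
apply/ler_addgt0Pr => e e0; have [M HM] := Phi_cvg1 e0.
pose y := Num.max M x.
have xy : x <= y by rewrite le_max lexx orbT.
have := HM y; rewrite le_max lexx => /(_ isT) h1.
have := der_mono dq q0 xy; rewrite /q.
have : 0 <= npdf y * y^-1.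
  by rewrite mulr_ge0 ?npdf_ge0 // invr_ge0 (le_trans (ltW x0)).
rewrite [x^-1 * _]mulrC; lra.
Qed.

Lemma peak_bounds : 3^-1 <= normal_peak (1 : R) <= 2^-1.
Proof.
rewrite /normal_peak expr1n mul1r.
have pi2 := @pi_ge2 R; have pi4 : pi < (4 : R).
  by have := @pihalf_lt2 R; rewrite ltr_pdivrMr //; lra.
have s0 : 0 < Num.sqrt (pi *+ 2 : R) by rewrite sqrtr_gt0 mulrn_wgt0 // pi_gt0.
have s9 : Num.sqrt (pi *+ 2 : R) <= 3.
  have -> : (3 : R) = Num.sqrt (3 ^+ 2) by rewrite sqrtr_sqr ger0_norm.
  rewrite ler_wsqrtr // -mulr_natl; lra.
have s1 : 2 <= Num.sqrt (pi *+ 2 : R).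
  have -> : (2 : R) = Num.sqrt (2 ^+ 2) by rewrite sqrtr_sqr ger0_norm.
  rewrite ler_wsqrtr // -mulr_natl; lra.
apply/andP; split; first by rewrite lef_pV2 ?posrE.
by rewrite lef_pV2 ?posrE //; lra.
Qed.

Lemma npdf_le x : npdf x <= 2^-1 * expR (- (x ^+ 2 / 2)).
Proof. by rewrite npdfE ler_wpM2r ?expR_ge0 //; have /andP[] := peak_bounds. Qed.

Lemma npdf_ge x : `|x| <= 1 -> 6^-1 <= npdf x.
Proof.
move=> x1; have x2 : x ^+ 2 <= 1 by rewrite -real_normK ?num_real // exprn_ile1.
rewrite npdfE; have -> : 6^-1 = 3^-1 * 2^-1 :> R by lra.
apply: ler_pM => //; first by have /andP[] := peak_bounds.
have := @expR_ge1Dx R (- (x ^+ 2 / 2)); lra.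
Qed.

Lemma Phi_mono x y : x <= y -> Phi x <= Phi y.
Proof.
move=> xy; have [t [_ _]] := mean_value y x der_Phi => H.
by rewrite -subr_ge0 H mulr_ge0 ?npdf_ge0 // subr_ge0.
Qed.

Lemma Phi_lip x y : x <= y -> Phi y - Phi x <= (y - x) / 2.
Proof.
move=> xy; have [t [_ _ ->]] := mean_value y x der_Phi.
rewrite ler_wpM2l ?subr_ge0 //; apply: le_trans (npdf_le t) _.
rewrite ler_piMr ?invr_ge0 // -[leRHS]expR0 ler_expR oppr_le0 divr_ge0 ?sqr_ge0 //.
Qed.

Lemma Phi_incr x y : 0 <= x -> x <= y -> Phi y - Phi x <= (y - x) * expR (- (x ^+ 2 / 2)).
Proof.
move=> x0 xy; have [t [t1 t2 ->]] := mean_value y x der_Phi.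
rewrite ler_wpM2l ?subr_ge0 //; apply: le_trans (npdf_le t) _.
apply: (@le_trans _ _ (expR (- (t ^+ 2 / 2)))).
  by rewrite ler_piMl ?expR_ge0 // invf_le1 //; lra.
rewrite ler_expR lerN2 ler_wpM2r ?invr_ge0 // lerXn2r ?nnegrE //.
  by apply: le_trans t1; rewrite le_min x0 (le_trans x0 xy).
by apply: le_trans t1; rewrite le_min xy lexx.
Qed.

Lemma mills_norm x : `|x| * Num.min (Phi x) (1 - Phi x) <= npdf x.
Proof.
have [x0|x0|->] := ltgtP x 0; last by rewrite normr0 mul0r npdf_ge0.
- rewrite ltr0_norm // -npdfN; apply: le_trans (mills (x := - x) _); last by rewrite oppr_gt0.
  have -> : 1 - Phi (- x) = Phi x by rewrite PhiN; lra.
  by rewrite ler_wpM2l ?oppr_ge0 ?(ltW x0) // ge_min lexx.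
- rewrite gtr0_norm //; apply: le_trans (mills x0).
  by rewrite ler_wpM2l ?(ltW x0) // ge_min lexx orbT.
Qed.

Lemma ratio_le6 x : Num.min (Phi x) (1 - Phi x) / npdf x <= 6.
Proof.
have m1 : Num.min (Phi x) (1 - Phi x) <= 1 by rewrite ge_min Phi_le1.
have n0 := npdf_gt0 x; rewrite ler_pdivrMr //.
have m0 : 0 <= Num.min (Phi x) (1 - Phi x) by rewrite le_min Phi_ge0 subr_ge0 Phi_le1.
have [x1|/ltW x1] := leP `|x| 1; first by have := npdf_ge x1; lra.
have := mills_norm x; have := ler_wpM2r m0 x1; lra.
Qed.

Section Solution.
Variables (z al : R).
Hypothesis al0 : 0 < al.

(** [smooth] decreases linearly from [1] to [0] on [[z, z + al]], [sol] solves Stein's equation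
  for it, and [dsol] is the derivative of [sol]. *)
Definition smooth x : R := 1 - ramp al (x - z).
Definition smooth_pdf x : R := smooth x * npdf x.
Definition smooth_mean : R := Iall smooth_pdf.
Definition sol x : R := (Ileft smooth_pdf x - smooth_mean * Phi x) / npdf x.
Definition dsol x : R := x * sol x + smooth x - smooth_mean.

Lemma smooth_ge0 x : 0 <= smooth x. Proof. by rewrite subr_ge0 ramp_le1. Qed.
Lemma smooth_le1 x : smooth x <= 1. Proof. by rewrite gerBl ramp_ge0. Qed.

Lemma ramp_lip_norm x y : `|ramp al x - ramp al y| <= `|x - y| / al.
Proof.
have [xy|/ltW yx] := leP x y.
  rewrite distrC (distrC x) !ger0_norm ?subr_ge0 ?ramp_mono //; exact: ramp_lip.
rewrite !ger0_norm ?subr_ge0 ?ramp_mono //; exact: ramp_lip.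
Qed.

Lemma smooth_lip x y : `|smooth x - smooth y| <= `|x - y| / al.
Proof.
have -> : smooth x - smooth y = - (ramp al (x - z) - ramp al (y - z)) by rewrite /smooth; ring.
rewrite normrN; apply: le_trans (ramp_lip_norm _ _) _.
by have -> : x - z - (y - z) = x - y by ring.
Qed.

Lemma smooth1 x : x <= z -> smooth x = 1.
Proof. by move=> xz; rewrite /smooth ramp0 ?subr0 // subr_le0. Qed.

Lemma smooth0 x : z + al <= x -> smooth x = 0.
Proof. by move=> xz; rewrite /smooth ramp1 ?subrr //; lra. Qed.

Lemma smooth_cont : continuous smooth.
Proof.
move=> x; apply/cvgrPdist_le => e e0; near=> y.
apply: le_trans (smooth_lip x y) _; rewrite ler_pdivrMr //.
near: y; apply: (@cvgr_dist_le _ _ _ _ _ id x) => //; exact: mulr_gt0.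
Unshelve. all: by end_near. Qed.

Lemma dominated_smooth : dominated smooth_pdf.
Proof.
split=> [x|x|x]; first by apply: cvgM; [exact: smooth_cont|exact: npdf_cont].
  by rewrite mulr_ge0 ?smooth_ge0 ?npdf_ge0.
by rewrite ler_piMl ?npdf_ge0 ?smooth_le1.
Qed.

Lemma mean_ge0 : 0 <= smooth_mean.
Proof.
have := Iright_ge0 0 dominated_smooth; have := Ileft_ge0 0 dominated_smooth.
rewrite /smooth_mean; lra.
Qed.

Lemma mean_le1 : smooth_mean <= 1.
Proof.
have := Iright_le 0 dominated_smooth; have := Ileft_le 0 dominated_smooth.
rewrite /smooth_mean; lra.
Qed.

Lemma Ileft_eq x : x <= z -> Ileft smooth_pdf x = Phi x.
Proof.
move=> xz; rewrite PhiE; apply: eq_Rintegral => t; rewrite inE /= in_itv /= => tx.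
by rewrite /smooth_pdf smooth1 ?mul1r // (le_trans tx).
Qed.

Lemma mean_ge : Phi z <= smooth_mean.
Proof. by rewrite -subr_ge0 -Ileft_eq //; exact: Iright_ge0 dominated_smooth. Qed.

Lemma mean_le : smooth_mean <= Phi (z + al).
Proof.
have := Iall_split (z + al) dominated_smooth; have := Ileft_le (z + al) dominated_smooth.
have -> : \int[mu]_(t in `](z + al), +oo[) smooth_pdf t = 0.
  rewrite (@eq_Rintegral _ _ _ mu _ (fun=> 0)); first by rewrite /Rintegral integral0.
  move=> t; rewrite inE /= in_itv /= andbT => tz.
  by rewrite /smooth_pdf smooth0 ?mul0r // ltW.
rewrite /smooth_mean; lra.
Qed.

Lemma der_sol x : is_derive x (1 : R) sol (dsol x).
Proof.
have n0 := npdf_gt0 x.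
have h := derB (der_Ileft x dominated_smooth) (derZ smooth_mean (der_Phi x)).
apply: der_eq (derM h (derV (lt0r_neq0 n0) (der_npdf x))) _.
by rewrite /dsol /sol /smooth_pdf; field; rewrite gt_eqF.
Qed.

(** The numerator of [sol] is the covariance of [smooth] and of the indicator of a half line under
  the normal distribution; it can be computed from either side. *)
Lemma num_le x : `|Ileft smooth_pdf x - smooth_mean * Phi x| <= Num.min (Phi x) (1 - Phi x).
Proof.
have m0 := mean_ge0; have m1 := mean_le1; have P0 := Phi_ge0 x; have P1 := Phi_le1 x.
have a0 := Ileft_ge0 x dominated_smooth; have a1 := Ileft_le x dominated_smooth.
have b0 := Iright_ge0 x dominated_smooth; have b1 := Iright_le x dominated_smooth.
rewrite -/smooth_mean in b0 b1; have P2 : 0 <= 1 - Phi x by lra.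
have q1 := ler_wpM2r P0 m1; have q2 := ler_wpM2r P2 m1.
have q3 := mulr_ge0 m0 P0; have q4 := mulr_ge0 m0 P2.
by rewrite ler_norml le_min; apply/andP; split; first (rewrite lerNl le_min; apply/andP; split); lra.
Qed.

Lemma sol_le x : `|sol x| <= 6.
Proof.
rewrite /sol normrM (gtr0_norm (_ : 0 < (npdf x)^-1)) ?invr_gt0 ?npdf_gt0 //.
by apply: le_trans (ratio_le6 x); rewrite ler_wpM2r ?invr_ge0 ?npdf_ge0 // num_le.
Qed.

Lemma xsol_le x : `|x * sol x| <= 1.
Proof.
rewrite /sol !normrM (gtr0_norm (_ : 0 < (npdf x)^-1)) ?invr_gt0 ?npdf_gt0 //.
rewrite mulrA ler_pdivrMr ?npdf_gt0 // mul1r; apply: le_trans (mills_norm x).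
by rewrite ler_wpM2l // num_le.
Qed.

Lemma dsol_le x : `|dsol x| <= 2.
Proof.
have := xsol_le x; rewrite /dsol; have := smooth_ge0 x; have := smooth_le1 x.
have := mean_ge0; have := mean_le1; rewrite !ler_norml => *; apply/andP; lra.
Qed.

(** ** The solution is tiny to the left of [z] *)

(** The coefficient is [(1 - (3 / 4) ^+ 2) / 2], which makes [eps] the ratio of the densities at [z]
  and at [3 / 4 * z]. *)
Definition eps : R := expR (- (7 / 32 * z ^+ 2)).

Lemma eps_ge0 : 0 <= eps. Proof. exact: expR_ge0. Qed.

Lemma tail_eps : 1 <= z -> 1 - Phi z <= eps.
Proof.
move=> z1; have z0 : 0 < z by exact: lt_le_trans z1.
have := mills z0; have P2 : 0 <= 1 - Phi z by rewrite subr_ge0 Phi_le1.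
have := ler_wpM2r P2 z1; have := npdf_le z.
have : expR (- (z ^+ 2 / 2)) <= eps.
  by rewrite ler_expR; have := sqr_ge0 z; lra.
have := expR_ge0 (- (z ^+ 2 / 2)); lra.
Qed.

(** To the left of [z] the solution is [(1 - smooth_mean) * Phi x / npdf x], where the first factor
  is at most the upper tail at [z]. *)
Lemma sol_left x : 1 <= z -> x <= 3 / 4 * z ->
  [/\ `|sol x| <= 6 * eps, `|x * sol x| <= eps & `|dsol x| <= 2 * eps].
Proof.
move=> z1 xz; have z0 : 0 < z by exact: lt_le_trans z1.
have xz' : x <= z by lra.
have te := tail_eps z1; have e0 := eps_ge0.
have N1 : 0 <= 1 - smooth_mean by rewrite subr_ge0 mean_le1.
have Ne : 1 - smooth_mean <= eps by have := mean_ge; lra.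
have n0 := npdf_gt0 x.
have solE : sol x = (1 - smooth_mean) * (Phi x / npdf x).
  by rewrite /sol Ileft_eq //; ring.
have q0 : 0 <= Phi x / npdf x by rewrite divr_ge0 ?Phi_ge0 ?npdf_ge0.
have s0 : 0 <= sol x by rewrite solE mulr_ge0.
have [h1 h2] : `|sol x| <= 6 * eps /\ `|x * sol x| <= eps.
  rewrite (normrM x (sol x)) (ger0_norm s0).
  have [x0|x0] := leP x 0.
    have Px : Phi x <= 1 - Phi x.
      have := Phi_mono (_ : x <= - x); rewrite PhiN; apply; lra.
    have := ratio_le6 x; have := mills_norm x; rewrite (min_idPl Px) => m1 m2.
    split; rewrite solE; first by rewrite mulrC; apply: ler_pM.
    have -> : `|x| * ((1 - smooth_mean) * (Phi x / npdf x)) =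
      (1 - smooth_mean) * (`|x| * Phi x / npdf x) by ring.
    rewrite -[leRHS]mulr1; apply: ler_pM => //; first by rewrite divr_ge0 ?mulr_ge0 ?Phi_ge0 ?npdf_ge0.
    by rewrite ler_pdivrMr // mul1r.
  have k1 : sol x <= eps / z.
    have Nz : 1 - smooth_mean <= npdf z / z.
      by have := mills z0; rewrite ler_pdivlMr // mulrC; have := mean_ge; nra.
    have Pn : Phi x / npdf x <= (npdf x)^-1 by rewrite ler_piMl ?Phi_le1 // invr_ge0 npdf_ge0.
    rewrite solE; apply: (le_trans (ler_pM N1 q0 Nz Pn)).
    rewrite mulrAC ler_wpM2r ?invr_ge0 ?(ltW z0) // ler_pdivrMr // !npdfE mulrCA.
    have pk : 0 <= normal_peak (1 : R) by exact: normal_peak_ge0.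
    rewrite ler_wpM2l // /eps -expRD ler_expR.
    have xx : x ^+ 2 <= (3 / 4 * z) ^+ 2 by rewrite lerXn2r ?nnegrE // ?mulr_ge0 ?ltW //; lra.
    by move: xx; rewrite exprMn; lra.
  have k2 : eps / z <= eps by rewrite ler_pdivrMr // ler_peMr.
  rewrite (gtr0_norm x0); split; first by lra.
  have := ler_wpM2l (ltW x0) k1.
  have : x * (eps / z) <= eps.
    rewrite mulrCA ler_piMr // ler_pdivrMr // mul1r; lra.
  lra.
split=> //; rewrite /dsol smooth1 // -addrA.
by apply: le_trans (ler_normD _ _) _; rewrite (ger0_norm N1); lra.
Qed.

Lemma xsol_lip x y : `|x * sol x - y * sol y| <= `|x - y| * (6 + 2 * `|y|).
Proof.
have [t [_ _ H]] := mean_value x y der_sol.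
have -> : x * sol x - y * sol y = (x - y) * sol x + y * (sol x - sol y) by ring.
rewrite H; have -> : (x - y) * sol x + y * ((x - y) * dsol t) = (x - y) * (sol x + y * dsol t) by ring.
rewrite normrM ler_wpM2l //.
apply: le_trans (ler_normD _ _) _; rewrite lerD ?sol_le // (normrM y (dsol t)) mulrC ler_wpM2r //.
exact: dsol_le.
Qed.

Lemma xsol_lip_left x y : 1 <= z -> x <= 3 / 4 * z -> y <= 3 / 4 * z ->
  `|x * sol x - y * sol y| <= `|x - y| * (6 + 2 * `|y|) * eps.
Proof.
move=> z1 xz yz; have [t [_ t2 H]] := mean_value x y der_sol.
have tz : t <= 3 / 4 * z by apply: le_trans t2 _; rewrite ge_max xz yz.
have [_ _ dt] := sol_left z1 tz; have [sx _ _] := sol_left z1 xz.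
have -> : x * sol x - y * sol y = (x - y) * sol x + y * (sol x - sol y) by ring.
rewrite H; have -> : (x - y) * sol x + y * ((x - y) * dsol t) = (x - y) * (sol x + y * dsol t) by ring.
rewrite normrM -mulrA ler_wpM2l //.
apply: le_trans (ler_normD _ _) _; rewrite mulrDl lerD // (normrM y (dsol t)).
have -> : 2 * `|y| * eps = `|y| * (2 * eps) by ring.
by rewrite ler_wpM2l.
Qed.

Lemma sol_small x : 1 <= z -> `|sol x| <= 2 / z + 6 * eps.
Proof.
move=> z1; have z0 : 0 < z by exact: lt_le_trans z1.
have [xz|/ltW xz] := leP x (3 / 4 * z).
  by have [h _ _] := sol_left z1 xz; rewrite ler_wpDl // divr_ge0 // ltW.
apply: ler_wpDr; first by rewrite mulr_ge0 ?eps_ge0.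
have x0 : 0 < x by apply: lt_le_trans xz; rewrite mulr_gt0 // divr_gt0.
have := xsol_le x; rewrite normrM (gtr0_norm x0) -ler_pdivlMl // mulr1 => /le_trans; apply.
rewrite -[x^-1]mul1r ler_pdivrMr // mulrAC ler_pdivlMr //; lra.
Qed.

End Solution.

Lemma expR_ge_pow (n : nat) x : 0 <= x -> (x / n.+1%:R) ^+ n.+1 <= expR x.
Proof.
move=> x0; have n0 : 0 < n.+1%:R :> R by [].
have {2}-> : x = n.+1%:R * (x / n.+1%:R) by rewrite mulrC divfK // gt_eqF.
rewrite expRM_natl lerXn2r ?nnegrE ?divr_ge0 ?expR_ge0 //.
by apply: le_trans (expR_ge1Dx _); rewrite ler_wpDl.
Qed.

Lemma eps_poly (n : nat) : exists2 C : R, 0 <= C & forall z, 1 <= z ->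
  eps z <= C * z^-1 ^+ (2 * n.+1).
Proof.
exists ((n.+1%:R * (32 / 7)) ^+ n.+1); first by rewrite exprn_ge0 // mulr_ge0 // divr_ge0.
move=> z z1; have z0 : 0 < z by exact: lt_le_trans z1.
have y0 : 0 <= 7 / 32 * z ^+ 2 by rewrite mulr_ge0 ?sqr_ge0 // divr_ge0.
have yp : 0 < 7 / 32 * z ^+ 2 / n.+1%:R by rewrite !mulr_gt0 ?exprn_gt0 ?invr_gt0.
rewrite /eps expRN exprM -exprMn.
have key (t : R) : 0 < t -> t * (32 / 7) * z^-1 ^+ 2 = (7 / 32 * z ^+ 2 / t)^-1.
  by move=> t0; field; rewrite !gt_eqF.
rewrite key ?ltr0n //.
by rewrite exprVn lef_pV2 ?posrE ?expR_gt0 ?exprn_gt0 // expR_ge_pow.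
Qed.

End Gauss.


(** * The uniform bound *)

Section Uniform.
Variables (R : realType) (F : lfield R).
Local Notation p := (expo F).
Local Notation conf := (conf F).
Local Notation I := (site F).
Local Notation Gam := (Gam F).

Lemma norm_Tc_T i (w : conf) : `|Tc i w| <= `|T i w| + V 5 i w.
Proof.
have -> : Tc i w = T i w + (SX (ball 5 i) w - SX (ball 3 i) w).
  have := W_T i w; rewrite (W_Tc i w) => H; lra.
apply: le_trans (ler_normD _ _) _; rewrite lerD2l.
by apply: norm_SX_sub; exact: ball_mono.
Qed.

Lemma norm_W_Tc i (w : conf) : `|W w - Tc i w| <= V 3 i w.
Proof. by rewrite (W_Tc i w) addrK; exact: norm_SX. Qed.

Lemma V_powR_mono i (w : conf) : V 3 i w `^ (p - 2) <= V 5 i w `^ (p - 2).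
Proof.
have p2 := p2 F; rewrite ge0_ler_powR ?nnegrE ?V_ge0 ?V_mono //; lra.
Qed.

Lemma V_le_powR i (w : conf) : V 3 i w <= 1 -> V 3 i w <= V 3 i w `^ (p - 2).
Proof.
have p2 := p2 F; have p3 := p3 F.
by move=> V1; apply: powR_ge_id => //; [exact: V_ge0|lra|lra].
Qed.

Lemma smooth_change (z al : R) i (w : conf) s : 0 < al -> `|s| <= V 3 i w ->
  `|smooth z al (Tc i w + s) - smooth z al (Tc i w)| <=
  Num.min (V 3 i w / al) 1 * (z - 2 * V 3 i w <= W w <= z + al + 2 * V 3 i w)%R%:R.
Proof.
move=> al0; have V0 := V_ge0 3 i w; rewrite ler_norml => /andP[].
have := norm_W_Tc i w; rewrite ler_norml => /andP[].
set t := Tc i w; set v := V 3 i w in V0 * => t1 t2 s1 s2.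
have [h1|h1] := leP (z - 2 * v) (W w); last first.
  by rewrite !smooth1 ?subrr ?normr0 ?mulr0 //; lra.
have [h2|h2] := leP (W w) (z + al + 2 * v); last first.
  by rewrite !smooth0 ?subrr ?normr0 ?mulr0 //; lra.
rewrite mulr1 le_min; apply/andP; split.
  apply: le_trans (smooth_lip _ al0 _ _) _.
  rewrite addrAC subrr add0r ler_pM2r ?invr_gt0 // ler_norml; apply/andP; split; lra.
have := smooth_ge0 z al0 (t + s); have := smooth_le1 z al0 (t + s).
have := smooth_ge0 z al0 t; have := smooth_le1 z al0 t.
by move=> *; rewrite ler_norml; apply/andP; split; lra.
Qed.

Section Fixed.
Variables (z al : R).
Hypothesis small : Gam <= 75^-1.
Hypothesis al0 : 0 < al.
Hypothesis al1 : al <= 1.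
Hypothesis Gal : 16 * Gam <= al.

(** The oscillation of the smoothed indicator near [i]: it requires [W] to be close to the jump. *)
Definition rjump i (w : conf) : R :=
  Num.min (V 3 i w / al) 1 * (z - 2 * V 3 i w <= W w <= z + al + 2 * V 3 i w)%R%:R.

Lemma min_Val i (w : conf) : 0 <= Num.min (V 3 i w / al) 1.
Proof. by rewrite le_min ler01 divr_ge0 ?V_ge0 // ltW. Qed.

Lemma min_len (v : R) : 0 <= v ->
  Num.min (v / al) 1 * (9 / 4 * (al + 4 * v) + 5 * al) <= 65 / 4 * v.
Proof.
move=> v0; have [va|av] := leP v al.
  apply: (@le_trans _ _ (v / al * (65 / 4 * al))).
    apply: ler_pM => //.
    - by rewrite le_min ler01 divr_ge0 // ltW.
    - by rewrite !addr_ge0 ?mulr_ge0 ?divr_ge0 ?addr_ge0 ?mulr_ge0 ?(ltW al0).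
    - by rewrite ge_min lexx.
    - lra.
  by rewrite mulrCA mulfVK ?gt_eqF // mulrC.
apply: (@le_trans _ _ (1 * (9 / 4 * (al + 4 * v) + 5 * al))).
  rewrite ler_wpM2r // ?ge_min ?lexx ?orbT //.
  by rewrite !addr_ge0 ?mulr_ge0 ?divr_ge0 ?addr_ge0 ?mulr_ge0 ?(ltW al0).
move: al0; lra.
Qed.

Lemma E_rjump i (G : conf -> R) : (forall w, 0 <= G w) -> dep (ball 3 i) G ->
  E (fun w => G w * rjump i w) <= 65 / 4 * E (fun w => G w * V 3 i w).
Proof.
move=> G0 dG.
have dV : dep (ball 3 i) (V 3 i : conf -> R) by apply: dep_V.
rewrite (eq_E (g := fun w => G w * Num.min (V 3 i w / al) 1 *
   (z - 2 * V 3 i w <= W w <= z + al + 2 * V 3 i w)%R%:R)); last first.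
  by move=> w; rewrite /rjump mulrA.
apply: le_trans (conc_interval small al0 al1 Gal (i := i) _ _ _ _ _) _.
- by move=> w; rewrite mulr_ge0 ?min_Val.
- by move=> w w' H; rewrite (dG _ _ H) (dV _ _ H).
- by move=> w w' H; rewrite (dV _ _ H).
- by move=> w w' H; rewrite (dV _ _ H).
- by move=> w; have := V_ge0 3 i w; move: al0; lra.
rewrite -EZ; apply: ler_E => w; rewrite -mulrA [leRHS]mulrCA ler_wpM2l //.
have := min_len (V_ge0 3 i w).
by have -> : z + al + 2 * V 3 i w - (z - 2 * V 3 i w) = al + 4 * V 3 i w by ring.
Qed.

Lemma E_local_T2 i (G : conf -> R) (c : R) : (forall w, 0 <= G w) -> dep (ball 3 i) G ->
  E (fun w => G w * (c + 2 * `|T i w|)) <= (c + 8 / 3) * E G.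
Proof.
move=> G0 dG; rewrite (E_local_T (fun x => c + 2 * `|x|) dG) ED EZ E_cst mulrC.
rewrite ler_wpM2r ?E_ge0 //; have := E_absT i small; lra.
Qed.

(** The oscillation of [w * sol w] near [i]; the second term is for large local sums, where the
  bound [xsol_le] is used instead. *)
Definition rsmooth i (w : conf) : R :=
  V 3 i w `^ (p - 2) * (8 + 2 * `|T i w|) + 2 * V 5 i w `^ (p - 2).

Lemma rsmoothP i (w : conf) s : `|s| <= V 3 i w ->
  `|(Tc i w + s) * sol z al (Tc i w + s) - Tc i w * sol z al (Tc i w)| <= rsmooth i w.
Proof.
move=> sV; have p2 := p2 F.
have a0 : 0 <= V 3 i w `^ (p - 2) * (8 + 2 * `|T i w|).
  by rewrite mulr_ge0 ?powR_ge0 // addr_ge0 // mulr_ge0.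
have [v5|/ltW v5] := leP (V 5 i w) 1; last first.
  apply: (@le_trans _ _ 2).
    apply: le_trans (ler_normB _ _) _.
    have := xsol_le z al0 (Tc i w + s); have := xsol_le z al0 (Tc i w); lra.
  rewrite /rsmooth; have : 1 <= V 5 i w `^ (p - 2) by apply: powR_ge1 => //; lra.
  lra.
apply: ler_wpDr; first by rewrite mulr_ge0 ?powR_ge0.
apply: le_trans (xsol_lip z al0 _ _) _; rewrite addrAC subrr add0r.
apply: ler_pM => //.
  apply: le_trans sV _; apply: V_le_powR; apply: le_trans v5; exact: V_mono.
have := norm_Tc_T i w; lra.
Qed.

Definition runif i (w : conf) : R :=
  V 3 i w `^ (p - 2) * (1 < V 3 i w)%R%:R +
  (V 3 i w <= 1)%R%:R * rjump i w + rsmooth i w.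

Lemma runifP i (w : conf) s : `|s| <= V 3 i w ->
  `|dsol z al (Tc i w + s) - dsol z al (Tc i w)| <= runif i w.
Proof.
move=> sV; have p2 := p2 F.
have -> : dsol z al (Tc i w + s) - dsol z al (Tc i w) =
  (smooth z al (Tc i w + s) - smooth z al (Tc i w)) +
  ((Tc i w + s) * sol z al (Tc i w + s) - Tc i w * sol z al (Tc i w)).
  by rewrite /dsol; ring.
apply: le_trans (ler_normD _ _) _; apply: lerD; last exact: rsmoothP.
apply: le_trans (smooth_change z al0 sV) _.
case: (leP (V 3 i w) 1) => [v1|v1]; first by rewrite mulr0 mul1r add0r.
rewrite mul0r mulr1 addr0; apply: (@le_trans _ _ 1).
  by rewrite mulr_ile1 ?min_Val // ?ge_min ?lexx ?orbT // lern1 leq_b1.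
apply: powR_ge1; [exact: ltW|lra].
Qed.

(** The constant is at least [65 / 4 + (8 + 8 / 3) + 2]. *)
Lemma E_runif i (ze : conf -> R) : (forall w, 0 <= ze w) -> dep (ball 2 i) ze ->
  E (fun w => ze w * runif i w) <= 29 * E (fun w => ze w * V 5 i w `^ (p - 2)).
Proof.
move=> z0 dz; have dz3 : dep (ball 3 i) ze by apply: dep_sub dz; exact: ball_mono.
have dV : dep (ball 3 i) (V 3 i : conf -> R) by apply: dep_V.
rewrite (eq_E (g := fun w => ze w * V 3 i w `^ (p - 2) * (1 < V 3 i w)%R%:R +
   ze w * (V 3 i w <= 1)%R%:R * rjump i w +
   (ze w * V 3 i w `^ (p - 2) * (8 + 2 * `|T i w|) + 2 * (ze w * V 5 i w `^ (p - 2))))); last first.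
  by move=> w; rewrite /runif /rsmooth; ring.
rewrite !ED EZ.
have h1 := @E_rjump i (fun w => ze w * (V 3 i w <= 1)%R%:R).
have {}h1 := h1 (fun w => mulr_ge0 (z0 w) (ler0n _ _)).
have {}h1 := h1 (dep2 (fun x y => x * (y <= 1)%R%:R) dz3 dV).
have h2 := @E_local_T2 i (fun w => ze w * V 3 i w `^ (p - 2)) 8.
have {}h2 := h2 (fun w => mulr_ge0 (z0 w) (powR_ge0 _ _)).
have {}h2 := h2 (dep2 (fun x y => x * y `^ (p - 2)) dz3 dV).
have h3 : E (fun w => ze w * V 3 i w `^ (p - 2) * (1 < V 3 i w)%R%:R) +
    65 / 4 * E (fun w => ze w * (V 3 i w <= 1)%R%:R * V 3 i w) <=
    65 / 4 * E (fun w => ze w * V 3 i w `^ (p - 2)).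
  rewrite -!EZ -ED; apply: ler_E => w.
  have := mulr_ge0 (z0 w) (powR_ge0 (V 3 i w) (p - 2)).
  case: (leP (V 3 i w) 1) => [v1|v1] /=; rewrite ?mulr0 ?mulr1 ?mul0r; last by lra.
  have := ler_wpM2l (z0 w) (V_le_powR v1); lra.
have h4 : E (fun w => ze w * V 3 i w `^ (p - 2)) <= E (fun w => ze w * V 5 i w `^ (p - 2)).
  by apply: ler_E => w; rewrite ler_wpM2l ?V_powR_mono.
have h5 : 0 <= E (fun w => ze w * V 5 i w `^ (p - 2)).
  by apply: E_ge0 => w; rewrite mulr_ge0 ?powR_ge0.
lra.
Qed.

(** Each of the two kinds of terms of the decomposition contributes [29 * third i]. *)
Theorem uniform_smooth :
  `|E (fun w : conf => smooth z al (W w)) - smooth_mean z al| <= 58 * Gam.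
Proof.
have fg t := der_sol z al0 t.
have := @stein_decomposition R F (sol z al) (dsol z al) (fun _ _ => 1) runif fg _ (fun i => _) runifP.
set B := \sum_i _ => HB.
have : `|E (fun w : conf => dsol z al (W w)) - E (fun w : conf => W w * sol z al (W w))| <= B.
  by apply: HB => // i w; rewrite ler01 lexx.
have -> : E (fun w : conf => dsol z al (W w)) - E (fun w : conf => W w * sol z al (W w)) =
   E (fun w : conf => smooth z al (W w)) - smooth_mean z al.
  by rewrite -EB -(E_cst F (smooth_mean z al)) -EB; apply: eq_E => w; rewrite /dsol; ring.
move=> /le_trans; apply.
apply: (@le_trans _ _ (\sum_i 58 * third i)); last first.
  by rewrite -mulr_sumr; apply: ler_wpM2l => //; exact: sum_third.
apply: ler_sum => i _.
have zE : zeta (fun _ _ => 1) i =1 (fun w : conf => `|X i w| * `|Y i w|).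
  by move=> w; rewrite /zeta mul1r.
have -> : E (fun w : conf => (1 - 1) * (`|X i w| * `|Y i w|)) = 0.
  by rewrite (eq_E (g := fun=> 0)) ?E_cst // => w; rewrite subrr mul0r.
have -> : E (fun w : conf => (1 - 1) * (`|X i w| * `|sol z al (W w) - sol z al (W w - Y i w)|)) = 0.
  by rewrite (eq_E (g := fun=> 0)) ?E_cst // => w; rewrite subrr mul0r.
rewrite mul0r !addr0 (eq_E zE).
have -> : E (fun w : conf => zeta (fun _ _ => 1) i w * runif i w) =
    E (fun w : conf => `|X i w| * `|Y i w| * runif i w).
  by apply: eq_E => w; rewrite zE.
have dXY : dep (ball 2 i) (fun w : conf => `|X i w| * `|Y i w|).
  move=> w w' H; rewrite (dep_X (ball_refl 2 i) H).
  by rewrite (dep_Y (@ball_mono _ F 1 2 i isT) H).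
have h1 := @E_runif i (fun w : conf => `|X i w| * `|Y i w|) (fun w => mulr_ge0 (normr_ge0 _) (normr_ge0 _)) dXY.
have h2 := @E_runif i (fun _ => 1) (fun=> ler01) (fun w w' _ => erefl).
have h2' : E (runif i) <= 29 * E (fun w : conf => V 5 i w `^ (p - 2)).
  rewrite (eq_E (g := fun w => 1 * runif i w)) => [|w]; last by rewrite mul1r.
  rewrite [X in _ <= _ * X](eq_E (g := fun w : conf => 1 * V 5 i w `^ (p - 2))) // => w.
  by rewrite mul1r.
have xy0 : 0 <= E (fun w : conf => `|X i w| * `|Y i w|) by apply: E_ge0 => w; rewrite mulr_ge0.
have t1 := third_XYV i; have t2 := third_XY_V i.
have h3 := ler_wpM2l xy0 h2'.
have -> : 58 * third i = 29 * third i + 29 * third i by ring.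
apply: lerD.
  by apply: le_trans h3 _; rewrite mulrCA ler_wpM2l.
by apply: le_trans h1 _; rewrite ler_wpM2l.
Qed.

End Fixed.

Definition Pr (A : conf -> bool) : R := E (fun w => (A w)%:R).

Lemma Pr_ge0 A : 0 <= Pr A. Proof. by apply: E_ge0. Qed.
Lemma Pr_le1 A : Pr A <= 1.
Proof. by rewrite -(E_cst F 1); apply: ler_E => w; rewrite lern1 leq_b1. Qed.

Lemma Pr_le_smooth z al : 0 < al -> Pr (fun w => W w <= z) <= E (fun w : conf => smooth z al (W w)).
Proof.
move=> al0; apply: ler_E => w; case: (leP (W w) z) => [Wz|_]; first by rewrite smooth1.
exact: smooth_ge0.
Qed.

Lemma smooth_le_Pr z al : 0 < al ->
  E (fun w : conf => smooth (z - al) al (W w)) <= Pr (fun w => W w < z).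
Proof.
move=> al0; apply: ler_E => w; case: (ltP (W w) z) => [_|Wz]; first exact: smooth_le1.
by rewrite smooth0 // subrK.
Qed.

(** Smoothing costs [al / 2], the density being at most [1 / 2].  With [al = 16 * Gam] the
  total is [58 * Gam + 8 * Gam].  If [75 * Gam > 1] there is nothing to prove. *)
Theorem uniform_bound z :
  Pr (fun w => W w <= z) - Phi z <= 75 * Gam /\ Phi z - Pr (fun w => W w < z) <= 75 * Gam.
Proof.
have G0 := Gam_ge0 F.
have [small|/ltW big] := leP Gam 75^-1; last first.
  have b1 : 1 <= 75 * Gam by lra.
  have := Pr_le1 (fun w => W w <= z); have := Pr_ge0 (fun w => W w < z).
  have := Phi_ge0 z; have := Phi_le1 z; split; lra.
suff H : forall L : nat, (0 < L)%N ->
   Pr (fun w => W w <= z) - Phi z <= 66 * Gam + 4^-1 / L%:R /\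
   Phi z - Pr (fun w => W w < z) <= 66 * Gam + 4^-1 / L%:R.
  split; apply: (@le_trans _ _ (66 * Gam)); try lra.
    by apply: (@le_of_le_addeps _ _ _ 4^-1) => L /H[].
  by apply: (@le_of_le_addeps _ _ _ 4^-1) => L /H[].
(* The term in [L] makes [al] positive. *)
move=> L L0; pose al := 16 * Gam + 2^-1 / L%:R.
have L1 : 0 < 2^-1 / L%:R :> R by rewrite divr_gt0 // ltr0n.
have L2 : 2^-1 / L%:R <= 2^-1 :> R by rewrite ler_piMr // invf_le1 ?ler1n ?ltr0n.
have al0 : 0 < al by rewrite /al; lra.
have al1 : al <= 1 by rewrite /al; lra.
have Gal : 16 * Gam <= al by rewrite /al lerDl ltW.
have alE : 58 * Gam + al / 2 = 66 * Gam + 4^-1 / L%:R.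
  by rewrite /al; set l := L%:R^-1; lra.
rewrite -alE; split.
  have /ler_normlP[_ h] := uniform_smooth z small al0 al1 Gal.
  have := Pr_le_smooth z al0; have := mean_le z al0.
  have zz : z <= z + al by rewrite lerDl ltW.
  have := Phi_lip zz; rewrite addrAC subrr add0r; lra.
have /ler_normlP[h _] := uniform_smooth (z - al) small al0 al1 Gal.
have := smooth_le_Pr z al0; have := mean_ge (z - al) al0.
have zz : z - al <= z by rewrite gerBl ltW.
have := Phi_lip zz; have -> : z - (z - al) = al by ring.
lra.
Qed.

End Uniform.


(** * The bound far from the origin *)

Section NonUniform.
Variables (R : realType) (F : lfield R).
Local Notation p := (expo F).
Local Notation conf := (conf F).
Local Notation I := (site F).
Local Notation Gam := (Gam F).
Local Notation k := (kap F).
Local Notation Pr := (@Pr R F).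

Variables (z al Ct Ce : R).
Local Notation zi := (z^-1).
Hypothesis z16 : 16 <= z.
Hypothesis al0 : 0 < al.
Hypothesis al1 : al <= 1.
Hypothesis Gal : Gam * z ^+ 4 <= al.
Hypothesis Gz : Gam <= zi ^+ 24.
Hypothesis Ct0 : 0 <= Ct.
Hypothesis Ce0 : 0 <= Ce.
Hypothesis tailW : Pr (fun w => z / 8 <= `|W w|) <= Ct * zi ^+ 8.
Hypothesis epsz : eps z <= Ce * zi ^+ 8.

Let z1 : 1 <= z. Proof. by apply: le_trans z16; rewrite ler1n. Qed.
Let z0 : 0 < z. Proof. exact: lt_le_trans z1. Qed.
Let zi0 : 0 <= zi. Proof. by rewrite invr_ge0 ltW. Qed.
Let zi1 : zi <= 1. Proof. by rewrite invf_le1. Qed.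

Lemma zi_exp m n : (m <= n)%N -> zi ^+ n <= zi ^+ m.
Proof. by move=> mn; rewrite ler_wiXn2l ?zi0 ?zi1. Qed.

Lemma zi_exp_le1 n : zi ^+ n <= 1.
Proof. by rewrite exprn_ile1 ?zi0 ?zi1. Qed.

Lemma zzi m n : (m <= n)%N -> z ^+ m * zi ^+ n = zi ^+ (n - m).
Proof.
by move=> mn; rewrite -{1}(subnK mn) exprD mulrCA -exprMn divff ?gt_eqF ?z0 // expr1n mulr1.
Qed.

Lemma Gam_small : Gam <= 75^-1.
Proof.
apply: (le_trans Gz); apply: (@le_trans _ _ (zi ^+ 2)); first exact: zi_exp.
have -> : zi ^+ 2 = (z ^+ 2)^-1 by rewrite exprVn.
rewrite lef_pV2 ?posrE ?exprn_gt0 ?z0 //.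
have : 16 ^+ 2 <= z ^+ 2 by rewrite lerXn2r ?nnegrE ?(ltW z0).
lra.
Qed.

Lemma Gam_al : 16 * Gam <= al.
Proof.
apply: le_trans Gal; rewrite mulrC ler_wpM2l ?Gam_ge0 //.
by apply: (le_trans z16); rewrite -[leLHS]expr1 ler_eXn2l //; move: z16; lra.
Qed.

Section AtSite.
Variable i : I.

Definition locmom : R := k `^ p * avgmom i.
(** The norm of order [p] of the local sum [V 5 i]. *)
Definition locsize : R := locmom `^ p^-1.

Lemma locmom_ge0 : 0 <= locmom.
Proof. by rewrite mulr_ge0 ?powR_ge0 ?avgmom_ge0. Qed.

Lemma locsize_ge0 : 0 <= locsize. Proof. exact: powR_ge0. Qed.

Lemma locsize_pow : locsize `^ p = locmom.
Proof.
by rewrite /locsize -powRrM mulVf ?powRr1 ?locmom_ge0 // gt_eqF ?p0.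
Qed.

Lemma locsize_le : locsize <= zi ^+ 8.
Proof.
have p3 := p3 F; have pp := p0 F.
have z80 : 0 <= zi ^+ 8 by rewrite exprn_ge0 ?zi0.
rewrite -[leRHS]powRr1 // -(mulfV (lt0r_neq0 pp)) powRrM /locsize.
rewrite ge0_ler_powR ?invr_ge0 ?(ltW pp) ?nnegrE ?locmom_ge0 ?powR_ge0 //.
apply: (le_trans (avgmom_le_gam i)); apply: (le_trans Gz).
have -> : zi ^+ 24 = (zi ^+ 8) `^ 3.
  by rewrite powR_mulrn // -exprM.
apply: ger_powR => //; rewrite zi_exp_le1 andbT exprn_gt0 // invr_gt0.
exact: z0.
Qed.

Lemma locsize_le1 : locsize <= 1.
Proof. exact: le_trans locsize_le (zi_exp_le1 _). Qed.

Lemma locmom_le n : (n <= 16)%N -> locmom <= zi ^+ n * locsize `^ (p - 2).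
Proof.
move=> n16; have p2 := p2 F.
rewrite -locsize_pow; have -> : p = 2 + (p - 2) by ring.
rewrite (@powR_split _ _ 2 (p - 2)) ?locsize_ge0 //; last by lra.
have -> : 2 + (p - 2) - 2 = p - 2 by ring.
rewrite ler_wpM2r ?powR_ge0 // powR_mulrn ?locsize_ge0 //.
apply: (@le_trans _ _ ((zi ^+ 8) ^+ 2)).
  by rewrite lerXn2r ?nnegrE ?locsize_ge0 ?exprn_ge0 ?zi0 ?locsize_le.
by rewrite -exprM zi_exp.
Qed.

Lemma locmom_E : E (fun w : conf => V 5 i w `^ p) = locmom.
Proof.
rewrite /locmom /avgmom -EZ; apply: eq_E => w.
have {1}-> : V 5 i w = k * (V 5 i w / k) by rewrite mulrC divfK // gt_eqF ?kap_gt0.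
by rewrite powRM ?kap_ge0 // divr_ge0 ?V_ge0 ?kap_ge0.
Qed.

(** Markov's inequality, as [z / 16 >= 1]. *)
Lemma Pr_V5 (A : conf -> bool) (B : {set I}) : (forall w, A w -> z / 16 <= AX B w) ->
  B \subset ball 5 i -> Pr A <= locmom.
Proof.
move=> AB B5; rewrite -locmom_E; apply: ler_E => w.
have := AB w; case: (A w) => [/(_ isT) H|_]; last exact: powR_ge0.
apply: powR_ge1; last exact: ltW (p0 F).
apply: le_trans (AX_sub w B5); apply: le_trans H.
by rewrite ler_pdivlMr // mul1r.
Qed.

(** The part of the local sum that is independent of [ball 2 i]. *)
Definition V53 : conf -> R := AX (ball 5 i :\: ball 3 i).

Lemma norm_Tc_T53 w : `|Tc i w - T i w| <= V53 w.
Proof.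
have -> : Tc i w - T i w = SX (ball 5 i) w - SX (ball 3 i) w.
  have := W_T i w; rewrite (W_Tc i w) => H; lra.
have -> : SX (ball 5 i) w - SX (ball 3 i) w = SX (ball 5 i :\: ball 3 i) w.
  have AB := @ball_mono _ F 3 5 i isT.
  by rewrite {1}/SX (big_setID (ball 3 i)) /= (finset.setIidPr AB) -!/(SX _ w); ring.
exact: norm_SX.
Qed.

Lemma Pr_V53 : Pr (fun w => z / 8 < V53 w) <= locmom.
Proof.
apply: (@Pr_V5 _ (ball 5 i :\: ball 3 i)); last exact: subsetDl.
move=> w /ltW; apply: le_trans; move: z0; lra.
Qed.

Lemma Pr_T : Pr (fun w => z / 4 <= T i w) <= (Ct + 1) * zi ^+ 8.
Proof.
apply: (@le_trans _ _ (Pr (fun w => z / 8 <= `|W w|) + Pr (fun w => z / 8 <= V 5 i w))).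
  rewrite -ED; apply: ler_E => w.
  case: (leP (z / 4) (T i w)) => [h|_]; last by rewrite addr_ge0.
  case: (leP (z / 8) `|W w|) => [_|h1]; first by rewrite lerDl.
  case: (leP (z / 8) (V 5 i w)) => [_|h2]; first by rewrite lerDr.
  have := norm_SX (ball 5 i) w; rewrite -/(V 5 i w) => h3.
  have := W_T i w; have := ler_norm (W w); have := ler_norm (- SX (ball 5 i) w).
  rewrite normrN; lra.
rewrite mulrDl mul1r; apply: lerD => //.
apply: (@le_trans _ _ locmom).
  apply: (@Pr_V5 _ (ball 5 i)) => // w; apply: le_trans; move: z0; lra.
apply: (le_trans (avgmom_le_gam i)); apply: (le_trans Gz); exact: zi_exp.
Qed.

Lemma sq_split (lam t : R) (b : bool) : 0 < lam ->
  `|t| * b%:R <= (lam * t ^+ 2 + lam^-1 * b%:R) / 2.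
Proof.
move=> l0; case: b; rewrite ?mulr1 ?mulr0 ?addr0; last first.
  by rewrite divr_ge0 // mulr_ge0 ?sqr_ge0 // ltW.
have : 0 <= lam * (`|t| - lam^-1) ^+ 2 by rewrite mulr_ge0 ?sqr_ge0 // ltW.
rewrite sqrrB real_normK ?num_real // mulrDr mulrBr -mulr_natl.
have -> : lam * (2 * (`|t| * lam^-1)) = 2 * `|t| * (lam * lam^-1) by ring.
have -> : lam * lam^-1 ^+ 2 = lam^-1 * (lam * lam^-1) by ring.
rewrite divff ?gt_eqF //; lra.
Qed.

(** Up to a constant, the Lipschitz bound of [w * sol w] near [T i] and also the weight in
  [concentration] for [c = 2 * z ^+ 4]. *)
Definition far_weight (w : conf) : R := `|T i w| + z ^+ 4.

Lemma far_weight_ge0 w : 0 <= far_weight w.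
Proof. by rewrite addr_ge0 // exprn_ge0 // ltW ?z0. Qed.

Lemma far_weight_eps : E (fun w => far_weight w) <= 2 * z ^+ 4.
Proof.
rewrite ED E_cst; have := E_absT i Gam_small.
have : z <= z ^+ 4 by rewrite -[leLHS]expr1 ler_eXn2l //; move: z16; lra.
by move: z16; lra.
Qed.

Lemma far_weight_T :
  E (fun w => far_weight w * (z / 4 <= T i w)%R%:R) <= (2 * Ct + 4) * zi ^+ 4.
Proof.
have l0 : 0 < zi ^+ 4 by rewrite exprn_gt0 // invr_gt0 z0.
apply: (@le_trans _ _ (E (fun w => (zi ^+ 4 / 2) * T i w ^+ 2 +
   (3 / 2 * z ^+ 4) * (z / 4 <= T i w)%R%:R))).
  apply: ler_E => w; rewrite /far_weight mulrDl.
  have := sq_split (T i w) (z / 4 <= T i w) l0.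
  rewrite exprVn invrK; lra.
rewrite ED !EZ; have := E_T2 i Gam_small => hT.
have hP : z ^+ 4 * E (fun w => (z / 4 <= T i w)%R%:R) <= (Ct + 1) * zi ^+ 4.
  have -> : zi ^+ 4 = z ^+ 4 * zi ^+ 8 by rewrite zzi.
  by rewrite mulrCA ler_wpM2l ?exprn_ge0 ?(ltW z0) //; exact: Pr_T.
have := ler_wpM2l (ltW l0) hT; have := mulr_ge0 Ct0 (ltW l0); lra.
Qed.

Lemma far_weight_V53 :
  E (fun w => far_weight w * (z / 8 < V53 w)%R%:R) <= 3 * zi ^+ 4 * locsize `^ (p - 2).
Proof.
set c := locsize; have c0 : 0 <= c := locsize_ge0; have c1 : c <= 1 := locsize_le1.
have p2 := p2 F; have p3 := p3 F.
set P := E (fun w => (z / 8 < V53 w)%R%:R).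
have P0 : 0 <= P by exact: E_ge0.
have Pc : P <= c `^ p by rewrite locsize_pow; exact: Pr_V53.
have cp : c `^ p = c * (c * c `^ (p - 2)).
  have {1}-> : p = 1 + (1 + (p - 2)) by ring.
  rewrite (@powR_split _ _ 1 (1 + (p - 2))) ?(@powR_split _ _ 1 (p - 2)) ?powRr1 //; lra.
have q0 : 0 <= c `^ (p - 2) by exact: powR_ge0.
have cq : c <= c `^ (p - 2) by apply: powR_ge_id => //; lra.
have c8 : c <= zi ^+ 8 := locsize_le.
have zz4 : z ^+ 4 * zi ^+ 8 = zi ^+ 4 by rewrite zzi.
have z40 : 0 <= z ^+ 4 by rewrite exprn_ge0 ?(ltW z0).
have zi40 : 0 <= zi ^+ 4 by rewrite exprn_ge0 ?zi0.
have hc : z ^+ 4 * c <= zi ^+ 4 by rewrite -zz4 ler_wpM2l.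
have h1 : z ^+ 4 * P <= zi ^+ 4 * c `^ (p - 2).
  apply: (le_trans (ler_wpM2l z40 Pc)); rewrite cp !mulrA; apply: ler_wpM2r => //.
  by apply: le_trans hc; rewrite ler_piMr // mulr_ge0.
have h2 : E (fun w => `|T i w| * (z / 8 < V53 w)%R%:R) <= 2 * zi ^+ 4 * c `^ (p - 2).
  (* The multiplier [zi ^+ 4 * c] would be optimal, but [c] may vanish. *)
  apply: (@le_of_le_addeps _ _ _ (zi ^+ 4)) => L L0.
  have e0 : 0 < L%:R^-1 :> R by rewrite invr_gt0 ltr0n.
  set e := L%:R^-1 in e0 *; have ce : 0 < c + e by rewrite ltr_wpDl.
  have l0 : 0 < zi ^+ 4 * (c + e) by rewrite mulr_gt0 // exprn_gt0 // invr_gt0 z0.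
  apply: (@le_trans _ _ (E (fun w => (zi ^+ 4 * (c + e)) / 2 * T i w ^+ 2 +
     (zi ^+ 4 * (c + e))^-1 / 2 * (z / 8 < V53 w)%R%:R))).
    by apply: ler_E => w; have := sq_split (T i w) (z / 8 < V53 w) l0; lra.
  rewrite ED !EZ -/P.
  have hT := ler_wpM2l (ltW l0) (E_T2 i Gam_small).
  have hP : (zi ^+ 4 * (c + e))^-1 * P <= zi ^+ 4 * c `^ (p - 2).
    rewrite mulrC ler_pdivrMr //; apply: (le_trans Pc); rewrite cp.
    have u : c <= (c + e) by rewrite lerDl ltW.
    have -> : zi ^+ 4 * c `^ (p - 2) * (zi ^+ 4 * (c + e)) = (c + e) * (zi ^+ 8 * c `^ (p - 2)).
      have -> : zi ^+ 8 = zi ^+ 4 * zi ^+ 4 by rewrite -exprD.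
      ring.
    apply: ler_pM => //; first by rewrite mulr_ge0.
    by rewrite ler_wpM2r.
  have := ler_wpM2l zi40 cq; have := mulr_ge0 zi40 q0; have := mulr_ge0 zi40 (ltW e0).
  lra.
rewrite (eq_E (g := fun w => `|T i w| * (z / 8 < V53 w)%R%:R + z ^+ 4 * (z / 8 < V53 w)%R%:R)).
  by rewrite ED EZ -/P; lra.
by move=> w; rewrite /far_weight mulrDl.
Qed.

End AtSite.
(** If the local sums [V 3 i] and [V53 i] are at most [z / 8], then either [W <= z / 2], where the
  solution is of size [eps z], or [T i >= z / 4], which is a rare event independent of [ball 3 i]. *)
Definition rfar i (w : conf) : R :=
  4 * (z / 8 < V 3 i w)%R%:R + 4 * (z / 8 < V53 i w)%R%:R +
  (V 3 i w <= z / 8)%R%:R * rjump z al i w +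
  (V 3 i w <= z / 8)%R%:R * (V 3 i w * (2 * far_weight i w * (eps z + (z / 4 <= T i w)%R%:R))).

Lemma rfarP i (w : conf) s : `|s| <= V 3 i w ->
  `|dsol z al (Tc i w + s) - dsol z al (Tc i w)| <= rfar i w.
Proof.
move=> sV; have fw0 := far_weight_ge0 i w; have e0 := eps_ge0 z.
have v0 := V_ge0 3 i w.
have big : `|dsol z al (Tc i w + s) - dsol z al (Tc i w)| <= 4.
  apply: le_trans (ler_normB _ _) _.
  have := dsol_le z al0 (Tc i w + s); have := dsol_le z al0 (Tc i w); lra.
have j0 : 0 <= rjump z al i w by rewrite /rjump mulr_ge0 // min_Val.
have K0 : 0 <= V 3 i w * (2 * far_weight i w * (eps z + (z / 4 <= T i w)%R%:R)).
  by rewrite !mulr_ge0 // addr_ge0.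
rewrite /rfar; have [v8|v8] := ltP (z / 8) (V 3 i w).
  rewrite !mul0r; apply: (le_trans big).
  by rewrite !addr0 mulr1 lerDl mulr_ge0.
rewrite mulr0 add0r !mul1r; have [u8|u8] := ltP (z / 8) (V53 i w).
  apply: (le_trans big); rewrite mulr1; lra.
rewrite mulr0 add0r.
have -> : dsol z al (Tc i w + s) - dsol z al (Tc i w) =
  (smooth z al (Tc i w + s) - smooth z al (Tc i w)) +
  ((Tc i w + s) * sol z al (Tc i w + s) - Tc i w * sol z al (Tc i w)).
  by rewrite /dsol; ring.
apply: le_trans (ler_normD _ _) _; apply: lerD; first exact: smooth_change.
have zz : z <= z ^+ 4 by rewrite -[leLHS]expr1 ler_eXn2l //; move: z16; lra.
have tt : 6 + 2 * `|Tc i w| <= 2 * far_weight i w.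
  have : `|Tc i w| <= `|T i w| + z / 8.
    have -> : Tc i w = T i w + (Tc i w - T i w) by ring.
    apply: le_trans (ler_normD _ _) _; rewrite lerD2l.
    exact: le_trans (norm_Tc_T53 i w) u8.
  rewrite /far_weight; move: z16; lra.
have := norm_W_Tc i w; rewrite ler_norml => /andP[t1 t2].
have := sV; rewrite ler_norml => /andP[s1 s2].
have ss : `|Tc i w + s - Tc i w| <= V 3 i w by rewrite addrAC subrr add0r.
have [Wz|Wz] := leP (W w) (z / 2).
  apply: le_trans (xsol_lip_left al0 z1 _ _) _; [by move: z16; lra|by move: z16; lra|].
  apply: (@le_trans _ _ (V 3 i w * (2 * far_weight i w * eps z))).
    rewrite -mulrA; apply: ler_pM => //; first by rewrite mulr_ge0 // addr_ge0 // mulr_ge0.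
    by apply: ler_wpM2r.
  by rewrite ler_wpM2l // ler_wpM2l ?mulr_ge0 // lerDl.
have -> : z / 4 <= T i w.
  have := norm_Tc_T53 i w; rewrite ler_norml => /andP[r1 r2]; lra.
apply: le_trans (xsol_lip z al0 _ _) _; apply: ler_pM => //.
apply: (le_trans tt); rewrite ler_peMr ?mulr_ge0 // lerDr //.
Qed.

Section Weight.
Variables (i : I) (ze : conf -> R).
Hypothesis ze0 : forall w, 0 <= ze w.
Hypothesis dze : dep (ball 2 i) ze.

Let dze3 : dep (ball 3 i) ze.
Proof. by apply: dep_sub dze; exact: ball_mono. Qed.
Let dV3 : dep (ball 3 i) (V 3 i : conf -> R).
Proof. exact: dep_V. Qed.

Definition capped (w : conf) : R := ze w * (V 3 i w <= z / 8)%R%:R * V 3 i w.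

Lemma capped_ge0 w : 0 <= capped w.
Proof. by rewrite !mulr_ge0 // V_ge0. Qed.

Lemma dep_capped : dep (ball 3 i) capped.
Proof. by move=> w w' H; rewrite /capped (dze3 H) (dV3 H). Qed.

Lemma E_capped : E capped <= z * E (fun w => ze w * V 5 i w `^ (p - 2)).
Proof.
have p2 := p2 F; have p3 := p3 F.
rewrite -EZ; apply: ler_E => w; rewrite /capped -mulrA [leRHS]mulrCA ler_wpM2l //.
apply: (@le_trans _ _ (z * V 3 i w `^ (p - 2))); last first.
  by rewrite ler_wpM2l ?(ltW z0) // V_powR_mono.
have v0 := V_ge0 3 i w; have [v8|v8] := leP (V 3 i w) (z / 8); last first.
  by rewrite mul0r mulr_ge0 ?powR_ge0 // ltW.
rewrite mul1r; have [v1|/ltW v1] := leP (V 3 i w) 1.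
  apply: le_trans (V_le_powR v1) _; by rewrite ler_peMl ?powR_ge0.
apply: (@le_trans _ _ z); first by move: z0; lra.
by rewrite ler_peMr ?(ltW z0) // powR_ge1 //; lra.
Qed.

Lemma E_capped_T (g : R -> R) :
  E (fun w => capped w * g (T i w)) = E capped * E (fun w => g (T i w)).
Proof. exact: E_local_T dep_capped. Qed.

Lemma E_ze_V53 : E (fun w => ze w * (far_weight i w * (z / 8 < V53 i w)%R%:R)) =
  E ze * E (fun w => far_weight i w * (z / 8 < V53 i w)%R%:R).
Proof.
apply: (@E_indep _ _ (ball 2 i) (~: ball 3 i)) => //.
  by move=> x y; exact: far_ball_compl.
move=> w w' H; rewrite /far_weight.
have -> : T i w = T i w'.
  by apply: (dep_SX _ H); rewrite finset.setCS; exact: ball_mono.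
have -> // : V53 i w = V53 i w'.
apply: (dep_AX _ H); apply/fintype.subsetP => x; by rewrite !inE => /andP[].
Qed.

Let c := locsize i.
Let q : R := c `^ (p - 2).
Let m1 : R := E capped.

Lemma m1_ge0 : 0 <= m1. Proof. exact: E_ge0 capped_ge0. Qed.

(** In the concentration inequality with [c = 2 * z ^+ 4] the event [a - 2 <= W] forces [T i] or
  [V53 i] to be large; the terms without this event are of size [Gam / al <= z^-1 ^+ 4]. *)
Lemma E_jump_far :
  E (fun w => ze w * (V 3 i w <= z / 8)%R%:R * rjump z al i w) <=
  (18 * Ct + 62) * zi ^+ 4 * m1 + 27 * zi ^+ 3 * (E ze * q).
Proof.
have small := Gam_small; have G16 := Gam_al; have G0 := Gam_ge0 F.
pose G w := ze w * (V 3 i w <= z / 8)%R%:R * Num.min (V 3 i w / al) 1.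
pose a (w : conf) : R := z - 2 * V 3 i w; pose b (w : conf) : R := z + al + 2 * V 3 i w.
have mV w : 0 <= Num.min (V 3 i w / al) 1 := min_Val al0 i w.
have Gg w : 0 <= G w by rewrite !mulr_ge0.
have dG : dep (ball 3 i) G by move=> w w' H; rewrite /G (dze3 H) (dV3 H).
have da : dep (ball 3 i) a by move=> w w' H; rewrite /a (dV3 H).
have db : dep (ball 3 i) b by move=> w w' H; rewrite /b (dV3 H).
have ab w : a w <= b w by rewrite /a /b; have := V_ge0 3 i w; move: al0; lra.
have cc : 0 < 2 * z ^+ 4 by rewrite mulr_gt0 // exprn_gt0.
have Q0 : 0 <= 7 * al by rewrite mulr_ge0 // ltW.
have HQ a' : dep (ball 3 i) a' -> E (fun w => G w * (a' w <= W w <= a' w + al)%R%:R) <= 7 * al * E G.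
  by move=> da'; exact: (conc_uniform small al0 al1 G16 Gg dG da').
have := concentration Gg dG da db ab al0 al1 cc small Q0 HQ.
rewrite (eq_E (g := fun w => ze w * (V 3 i w <= z / 8)%R%:R * rjump z al i w)); last first.
  by move=> w; rewrite /G /rjump mulrA.
have e1 : E (fun w => G w * ((b w - a w + al) * (`|T i w| + 2 * z ^+ 4 / 2) * (a w - 2 <= W w)%R%:R)) <=
  6 * (E (fun w => capped w * (far_weight i w * (z / 4 <= T i w)%R%:R)) +
       z * E (fun w => ze w * (far_weight i w * (z / 8 < V53 i w)%R%:R))).
  rewrite -EZ -ED -EZ; apply: ler_E => w.
  have fw0 := far_weight_ge0 i w; have v0 := V_ge0 3 i w.
  have -> : `|T i w| + 2 * z ^+ 4 / 2 = far_weight i w by rewrite /far_weight; field.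
  have r0 : 0 <= 6 * (capped w * (far_weight i w * (z / 4 <= T i w)%R%:R) +
     z * (ze w * (far_weight i w * (z / 8 < V53 i w)%R%:R))).
    rewrite mulr_ge0 // addr_ge0 // !mulr_ge0 ?capped_ge0 //; exact: ltW.
  have [v8|v8] := leP (V 3 i w) (z / 8); last by rewrite /G (lt_geF v8) mulr0 !mul0r.
  have [aW|aW] := leP (a w - 2) (W w); last by rewrite !mulr0.
  rewrite mulr1 /G /capped v8 mulr1.
  have -> : b w - a w + al = 2 * al + 4 * V 3 i w by rewrite /a /b; ring.
  have len : Num.min (V 3 i w / al) 1 * (2 * al + 4 * V 3 i w) <= 6 * V 3 i w.
    have [va|av] := leP (V 3 i w) al.
      apply: (@le_trans _ _ (V 3 i w / al * (6 * al))).
        apply: ler_pM => //; [by rewrite addr_ge0 ?mulr_ge0 ?(ltW al0)|by rewrite ge_min lexx|lra].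
      by rewrite mulrCA mulfVK ?gt_eqF // mulrC.
    apply: (@le_trans _ _ (1 * (2 * al + 4 * V 3 i w))).
      by rewrite ler_wpM2r // ?ge_min ?lexx ?orbT // addr_ge0 ?mulr_ge0 ?(ltW al0).
    lra.
  have ind : far_weight i w <= far_weight i w * (z / 4 <= T i w)%R%:R + far_weight i w * (z / 8 < V53 i w)%R%:R.
    have [u8|u8] := ltP (z / 8) (V53 i w); first by rewrite mulr1 lerDr mulr_ge0.
    have -> : z / 4 <= T i w.
      have := norm_Tc_T53 i w; rewrite ler_norml => /andP[r1 r2].
      have := norm_W_Tc i w; rewrite ler_norml => /andP[t1 t2].
      by move: aW z16; rewrite /a; lra.
    by rewrite mulr1 mulr0 addr0.
  have -> : ze w * Num.min (V 3 i w / al) 1 * ((2 * al + 4 * V 3 i w) * far_weight i w) =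
    ze w * ((Num.min (V 3 i w / al) 1 * (2 * al + 4 * V 3 i w)) * far_weight i w) by ring.
  have zV : V 3 i w <= z by move: z0; lra.
  set A := far_weight i w * (z / 4 <= T i w)%R%:R; set B := far_weight i w * (z / 8 < V53 i w)%R%:R.
  have B0 : 0 <= B by rewrite mulr_ge0.
  apply: (@le_trans _ _ (ze w * (6 * V 3 i w * (A + B)))).
    by rewrite ler_wpM2l // ler_pM // mulr_ge0 // addr_ge0 ?mulr_ge0 ?(ltW al0).
  have -> : 6 * (ze w * V 3 i w * A + z * (ze w * B)) = ze w * (6 * (V 3 i w * A + z * B)) by ring.
  rewrite ler_wpM2l // -mulrA ler_wpM2l // mulrDr lerD2l ler_wpM2r //.
have e2 : E G * (Gam / (2 * (2 * z ^+ 4)) + 2 * Gam + 2 * (7 * al) * Gam / al) <= 17 * zi ^+ 4 * m1.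
  have EG0' : 0 <= E G by exact: E_ge0.
  have -> : 2 * (7 * al) * Gam / al = 14 * Gam by field; rewrite gt_eqF.
  have g1 : Gam / (2 * (2 * z ^+ 4)) <= Gam.
    rewrite ler_piMr // invf_le1 //; last by rewrite !mulr_gt0 // exprn_gt0.
    have : 1 <= z ^+ 4 by rewrite exprn_ege1.
    lra.
  apply: (@le_trans _ _ (E G * (17 * Gam))); first by rewrite ler_wpM2l //; lra.
  have Gm : E G <= al^-1 * m1.
    rewrite -EZ; apply: ler_E => w; rewrite /G /capped [leRHS]mulrCA ler_wpM2l ?mulr_ge0 //.
    by rewrite [leRHS]mulrC ge_min lexx.
  have Ga : Gam * al^-1 <= zi ^+ 4.
    by rewrite ler_pdivrMr // exprVn mulrC ler_pdivlMr ?exprn_gt0.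
  have := ler_wpM2r m1_ge0 Ga; have := ler_wpM2l G0 Gm; lra.
move=> H; rewrite E_ze_V53 in e1.
rewrite (E_capped_T (fun t => (`|t| + z ^+ 4) * (z / 4 <= t)%R%:R)) in e1.
have h1 := ler_wpM2l m1_ge0 (far_weight_T i).
have h2 := ler_wpM2l (E_ge0 ze0) (far_weight_V53 i).
have h3 : z * (E ze * (3 * zi ^+ 4 * locsize i `^ (p - 2))) = 3 * zi ^+ 3 * (E ze * q).
  have -> : zi ^+ 3 = z ^+ 1 * zi ^+ 4 by rewrite zzi.
  by rewrite expr1 /q /c; ring.
have h4 := ler_wpM2l (ltW z0) h2; rewrite h3 in h4.
have h5 : 0 <= zi ^+ 4 * m1 by rewrite mulr_ge0 ?m1_ge0 // exprn_ge0.
have {}h1 : E capped * E (fun w : conf => (`|T i w| + z ^+ 4) * (z / 4 <= T i w)%R%:R) <=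
  m1 * ((2 * Ct + 4) * zi ^+ 4) by exact: h1.
move: H e1 e2 h1 h4 h5.
set A1 := E (fun w => ze w * _ * _); set A2 := E (fun w => G w * _); set A3 := E capped * _.
set A4 := z * (_ * _); set A5 := 3 * zi ^+ 3 * _.
set A6 := E G * _; set A7 := zi ^+ 4.
move=> H e1; rewrite -[17 * _ * _]mulrA => e2 h1 h4 h5.
have -> : (18 * Ct + 62) * A7 * m1 = 9 * (m1 * ((2 * Ct + 4) * A7)) + 26 * (A7 * m1) by ring.
have -> : 27 * zi ^+ 3 * (E ze * q) = 9 * A5 by rewrite /A5; ring.
lra.
Qed.

Let w5 : R := E (fun w => ze w * V 5 i w `^ (p - 2)).

Lemma m1_small : zi ^+ 4 * m1 <= zi ^+ 3 * w5.
Proof.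
have -> : zi ^+ 3 * w5 = zi ^+ 4 * (z * w5).
  by have -> : zi ^+ 3 = z ^+ 1 * zi ^+ 4 by [rewrite zzi]; ring.
by rewrite ler_wpM2l ?exprn_ge0 // E_capped.
Qed.

Lemma E_smooth_far :
  E (fun w => capped w * (2 * far_weight i w * (eps z + (z / 4 <= T i w)%R%:R))) <=
  (4 * Ce + 4 * Ct + 8) * zi ^+ 4 * m1.
Proof.
rewrite (@E_capped_T (fun t => 2 * (`|t| + z ^+ 4) * (eps z + (z / 4 <= t)%R%:R))) -/m1.
rewrite mulrC ler_wpM2r ?m1_ge0 //.
rewrite (eq_E (g := fun w => 2 * eps z * far_weight i w +
  2 * (far_weight i w * (z / 4 <= T i w)%R%:R))); last by move=> w; rewrite /far_weight; ring.
rewrite ED !EZ; have h1 := far_weight_T i; have h2 := far_weight_eps i.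
have e0 := eps_ge0 z; have h3 := ler_wpM2l e0 h2.
have h4 : eps z * (2 * z ^+ 4) <= 2 * Ce * zi ^+ 4.
  have -> : zi ^+ 4 = z ^+ 4 * zi ^+ 8 by rewrite zzi.
  have := ler_wpM2r (exprn_ge0 4 (ltW z0)) epsz; lra.
lra.
Qed.

Lemma E_rfar :
  E (fun w => ze w * rfar i w) <= 4 * E (fun w => ze w * (z / 8 < V 3 i w)%R%:R) +
   zi ^+ 3 * (31 * (E ze * q) + (22 * Ct + 4 * Ce + 70) * w5).
Proof.
rewrite (eq_E (g := fun w => 4 * (ze w * (z / 8 < V 3 i w)%R%:R) +
  4 * (ze w * (z / 8 < V53 i w)%R%:R) +
  ze w * (V 3 i w <= z / 8)%R%:R * rjump z al i w +
  capped w * (2 * far_weight i w * (eps z + (z / 4 <= T i w)%R%:R)))); last first.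
  by move=> w; rewrite /rfar /capped; ring.
have split4 (a1 a2 a3 a4 b : R) : a2 + a3 + a4 <= b -> a1 + a2 + a3 + a4 <= a1 + b by lra.
rewrite !ED !EZ; apply: split4.
have h1 : E (fun w => ze w * (z / 8 < V53 i w)%R%:R) <= zi ^+ 3 * (E ze * q).
  rewrite (@E_indep _ _ (ball 2 i) (~: ball 3 i)) //; last 2 first.
  - by move=> x y; exact: far_ball_compl.
  - move=> w w' H; have -> // : V53 i w = V53 i w'.
    by apply: (dep_AX _ H); apply/fintype.subsetP => x; rewrite !inE => /andP[].
  rewrite mulrCA ler_wpM2l ?(E_ge0 ze0) //.
  by apply: (le_trans (Pr_V53 i)); exact: locmom_le.
have h2 := E_jump_far; have h3 := E_smooth_far; have h4 := m1_small.
have h5 : (22 * Ct + 4 * Ce + 70) * (zi ^+ 4 * m1) <= (22 * Ct + 4 * Ce + 70) * (zi ^+ 3 * w5).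
  by apply: ler_wpM2l h4; move: Ct0 Ce0; lra.
move: h1 h2 h3 h5; set a0 := E ze; set a1 := E _; set a2 := E _; set a3 := E _; set b := zi ^+ 3; set d := zi ^+ 4 * m1.
have e x : x * zi ^+ 4 * m1 = x * d by rewrite /d mulrA.
rewrite !e.
have -> : 27 * b * (a0 * q) = 27 * (b * (a0 * q)) by ring.
have -> : b * (31 * (a0 * q) + (22 * Ct + 4 * Ce + 70) * w5) =
  31 * (b * (a0 * q)) + (22 * Ct + 4 * Ce + 70) * (b * w5) by ring.
set u := b * (a0 * q); set t := b * w5; lra.
Qed.

End Weight.

(** A cutoff at a scale smaller than the [z / 8] of [rfar], so that [V 3 i > z / 8] forces the part
  of the local sum outside [ball 2 i] to be large. *)
Definition chifar i (w : conf) : R := (V 2 i w <= z / 16)%R%:R.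

(** The sum of the constants of the four kinds of terms in [stein_decomposition]. *)
Definition Kfar : R := 1234 + 46 * Ct + 3082 * Ce.

Lemma E_rfar_site i : E (rfar i) <=
  zi ^+ 3 * (35 * locsize i `^ (p - 2) + (22 * Ct + 4 * Ce + 70) * E (fun w => V 5 i w `^ (p - 2))).
Proof.
have := @E_rfar i (fun=> 1) (fun=> ler01) (fun w w' _ => erefl).
rewrite E_cst mul1r (eq_E (g := rfar i)) => [|w]; last by rewrite mul1r.
rewrite (eq_E (f := fun w => 1 * (z / 8 < V 3 i w)%R%:R) (g := fun w => (z / 8 < V 3 i w)%R%:R)) => [|w];
  last by rewrite mul1r.
rewrite (eq_E (f := fun w => 1 * V 5 i w `^ (p - 2)) (g := fun w => V 5 i w `^ (p - 2))) => [|w];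
  last by rewrite mul1r.
have h1 : E (fun w => (z / 8 < V 3 i w)%R%:R) <= zi ^+ 3 * locsize i `^ (p - 2).
  apply: le_trans (locmom_le i (isT : (3 <= 16)%N)).
  apply: (@Pr_V5 _ _ (ball 3 i)); last exact: ball_mono.
  by move=> w /ltW; apply: le_trans; move: z0; lra.
move=> h2; apply: (le_trans h2); lra.
Qed.

Let dXY i : dep (ball 2 i) (fun w : conf => `|X i w| * `|Y i w|).
Proof.
move=> w w' H; rewrite (dep_X (ball_refl 2 i) H).
by rewrite (dep_Y (@ball_mono _ F 1 2 i isT) H).
Qed.

Lemma dep_chifar i : dep (ball 2 i) (chifar i).
Proof. by move=> w w' H; rewrite /chifar (dep_V _ H). Qed.

Lemma zeta_far_ge0 i w : 0 <= zeta chifar i w.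
Proof. by rewrite /zeta !mulr_ge0 // /chifar. Qed.

Lemma zeta_far_le i w : zeta chifar i w <= `|X i w| * `|Y i w|.
Proof. by rewrite /zeta ler_piMl ?mulr_ge0 // /chifar lern1 leq_b1. Qed.

(** Where the cutoff is [1] and [V 3 i > z / 8], the sum over the shell between the balls of
  radius [2] and [3] exceeds [z / 16].  It is independent of [X i] and [Y i], so this event
  contributes a product of expectations. *)
Lemma E_rfar_zeta i : E (fun w => zeta chifar i w * rfar i w) <=
  zi ^+ 3 * ((105 + 22 * Ct + 4 * Ce) * third i).
Proof.
have dz : dep (ball 2 i) (zeta chifar i).
  by move=> w w' H; rewrite /zeta (dep_chifar H) (dXY H).
apply: le_trans (E_rfar (zeta_far_ge0 i) dz) _.
have xy : E (zeta chifar i) <= E (fun w : conf => `|X i w| * `|Y i w|).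
  by apply: ler_E => w; exact: zeta_far_le.
have h1 : E (fun w => zeta chifar i w * (z / 8 < V 3 i w)%R%:R) <= zi ^+ 3 * third i.
  apply: (@le_trans _ _ (E (fun w => `|X i w| * `|Y i w| *
      (z / 16 < AX (ball 3 i :\: ball 2 i) w)%R%:R))).
    apply: ler_E => w; rewrite /zeta /chifar.
    case: (leP (V 2 i w) (z / 16)) => [v2|_]; last by rewrite !mul0r !mulr_ge0.
    rewrite mul1r ler_wpM2l ?mulr_ge0 // ler_nat; case: (ltP (z / 8) (V 3 i w)) => // v3.
    have : V 3 i w = V 2 i w + AX (ball 3 i :\: ball 2 i) w.
      have AB := @ball_mono _ F 2 3 i isT.
      by rewrite {1}/V {1}/AX (big_setID (ball 2 i)) /= (finset.setIidPr AB).
    case: (ltP (z / 16)) => // h e; move: v2 v3; rewrite e; lra.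
  rewrite (@E_indep _ _ (ball 1 i) (~: ball 2 i)).
  - apply: (@le_trans _ _ (E (fun w : conf => `|X i w| * `|Y i w|) * (zi ^+ 3 * locsize i `^ (p - 2)))).
      apply: ler_wpM2l; first by apply: E_ge0 => w; rewrite mulr_ge0.
      apply: le_trans (locmom_le i (isT : (3 <= 16)%N)).
      apply: (@Pr_V5 _ _ (ball 3 i :\: ball 2 i)); first by move=> w /ltW.
      by apply: fintype.subset_trans (subsetDl _ _) (ball_mono _ _).
    rewrite mulrCA ler_wpM2l ?exprn_ge0 //; apply: third_XY_cst; first exact: locsize_ge0.
    by rewrite locsize_pow.
  - by move=> x y; exact: far_ball_compl.
  - move=> w w' H; rewrite (dep_X (ball_refl 1 i) H).
    by rewrite (dep_Y (@ball_mono _ F 1 1 i isT) H).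
  - move=> w w' H; have -> // : AX (ball 3 i :\: ball 2 i) w = AX (ball 3 i :\: ball 2 i) w'.
    by apply: (dep_AX _ H); apply/fintype.subsetP => x; rewrite !inE => /andP[].
have h2 : E (zeta chifar i) * locsize i `^ (p - 2) <= third i.
  apply: le_trans (_ : E (fun w : conf => `|X i w| * `|Y i w|) * locsize i `^ (p - 2) <= _).
    by rewrite ler_wpM2r ?powR_ge0.
  by apply: third_XY_cst; rewrite ?locsize_ge0 ?locsize_pow.
have h3 : E (fun w => zeta chifar i w * V 5 i w `^ (p - 2)) <= third i.
  apply: le_trans (third_XYV i); apply: ler_E => w.
  by rewrite ler_wpM2r ?powR_ge0 // zeta_far_le.
have h4 : zi ^+ 3 * (31 * (E (zeta chifar i) * locsize i `^ (p - 2)) +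
   (22 * Ct + 4 * Ce + 70) * E (fun w => zeta chifar i w * V 5 i w `^ (p - 2))) <=
   zi ^+ 3 * (31 * third i + (22 * Ct + 4 * Ce + 70) * third i).
  rewrite ler_wpM2l ?exprn_ge0 // lerD ?ler_wpM2l //.
  by move: Ct0 Ce0; lra.
apply: (le_trans (lerD (ler_wpM2l _ h1) h4)) => //.
by rewrite le_eqVlt; apply/orP; left; apply/eqP; ring.
Qed.

Lemma E_rfar_cst i : E (zeta chifar i) * E (rfar i) <=
  zi ^+ 3 * ((105 + 22 * Ct + 4 * Ce) * third i).
Proof.
have xy0 : 0 <= E (fun w : conf => `|X i w| * `|Y i w|) by apply: E_ge0 => w; rewrite mulr_ge0.
apply: (@le_trans _ _ (E (fun w : conf => `|X i w| * `|Y i w|) * (zi ^+ 3 *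
   (35 * locsize i `^ (p - 2) + (22 * Ct + 4 * Ce + 70) * E (fun w => V 5 i w `^ (p - 2)))))).
  apply: ler_pM; last exact: E_rfar_site.
  - by apply: E_ge0 => w; exact: zeta_far_ge0.
  - apply: E_ge0 => w; apply: (le_trans (normr_ge0 (dsol z al (Tc i w + 0) - dsol z al (Tc i w)))).
    by apply: rfarP; rewrite normr0 V_ge0.
  - by apply: ler_E => w; exact: zeta_far_le.
rewrite mulrCA ler_wpM2l ?exprn_ge0 //.
have h1 : E (fun w : conf => `|X i w| * `|Y i w|) * locsize i `^ (p - 2) <= third i.
  by apply: third_XY_cst; rewrite ?locsize_ge0 ?locsize_pow.
have h2 := third_XY_V i.
have h3 : (22 * Ct + 4 * Ce + 70) * (E (fun w : conf => `|X i w| * `|Y i w|) * E (fun w => V 5 i w `^ (p - 2)))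
   <= (22 * Ct + 4 * Ce + 70) * third i by apply: ler_wpM2l h2; move: Ct0 Ce0; lra.
rewrite mulrDr !(mulrCA (E (fun w : conf => `|X i w| * `|Y i w|))); lra.
Qed.

Let zp : R := z `^ (- p).

Lemma zi3_zp : zi ^+ 3 <= zp.
Proof.
have p3 := p3 F; rewrite exprVn /zp powRN lef_pV2 ?posrE ?powR_gt0 ?exprn_gt0 //.
by rewrite -powR_mulrn ?(ltW z0) // ler_powR.
Qed.

(** Where the cutoff vanishes, [V 5 i >= 1]; and [dsol (W)] is small unless [W] is large. *)
Lemma E_far_D1 i :
  E (fun w : conf => (1 - chifar i w) * (`|X i w| * `|Y i w|)) * E (fun w : conf => `|dsol z al (W w)|) <=
  zp * ((2 * Ct + 2 * Ce) * third i).
Proof.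
have p2 := p2 F.
have h1 : E (fun w : conf => (1 - chifar i w) * (`|X i w| * `|Y i w|)) <= third i.
  apply: le_trans (third_XYV i); apply: ler_E => w.
  rewrite mulrC ler_wpM2l ?mulr_ge0 // /chifar; case: (leP (V 2 i w) (z / 16)) => [_|v2].
    by rewrite subrr powR_ge0.
  rewrite subr0; apply: powR_ge1; last by lra.
  have : V 2 i w <= V 5 i w by exact: V_mono.
  by move: z16; lra.
have h2 : E (fun w : conf => `|dsol z al (W w)|) <= (2 * Ct + 2 * Ce) * zi ^+ 8.
  apply: (@le_trans _ _ (E (fun w => 2 * (z / 8 <= `|W w|)%R%:R + 2 * eps z))).
    apply: ler_E => w; have e0 := eps_ge0 z; case: (leP (z / 8) `|W w|) => [_|wz].
      rewrite mulr1; have := dsol_le z al0 (W w); lra.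
    rewrite mulr0 add0r; have [|_ _ //] := sol_left al0 z1 (_ : W w <= 3 / 4 * z).
    by have := ler_norm (W w); move: z0; lra.
  rewrite ED EZ E_cst; move: tailW epsz; rewrite /Pr; lra.
apply: (@le_trans _ _ (third i * ((2 * Ct + 2 * Ce) * zi ^+ 8))).
  apply: ler_pM => //; [|by apply: E_ge0].
  by apply: E_ge0 => w; rewrite !mulr_ge0 // subr_ge0 /chifar lern1 leq_b1.
have -> : third i * ((2 * Ct + 2 * Ce) * zi ^+ 8) = zi ^+ 8 * ((2 * Ct + 2 * Ce) * third i) by ring.
rewrite ler_wpM2r //; first by rewrite mulr_ge0 ?third_ge0 //; move: Ct0 Ce0; lra.
by apply: le_trans zi3_zp; exact: zi_exp.
Qed.

(** Where the cutoff vanishes, [V 5 i >= z / 16], which supplies [z `^ (1 - p)]; the remaining factor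
  [z^-1] is the size of [sol]. *)
Lemma E_far_D2 i :
  E (fun w : conf => (1 - chifar i w) * (`|X i w| * `|sol z al (W w) - sol z al (W w - Y i w)|)) <=
  zp * ((1024 + 3072 * Ce) * third i).
Proof.
have p2 := p2 F; have p3 := p3 F.
have zpE : zp = zi * z `^ (1 - p).
  rewrite -powR_inv1 ?(ltW z0) // -powRD; last by rewrite (gt_eqF z0) implybT.
  by congr (_ `^ _); ring.
have hs x y : `|sol z al x - sol z al y| <= (4 + 12 * Ce) * zi.
  apply: le_trans (ler_normB _ _) _.
  have := sol_small al0 x z1; have := sol_small al0 y z1.
  have : eps z <= Ce * zi.
    by apply: (le_trans epsz); rewrite ler_wpM2l // -[leRHS]expr1 zi_exp.
  lra.
have h1 : E (fun w : conf => (1 - chifar i w) * (`|X i w| * `|sol z al (W w) - sol z al (W w - Y i w)|)) <=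
   E (fun w : conf => (256 * (4 + 12 * Ce) * zp) * (`|X i w| * V 5 i w `^ (p - 1))).
  apply: ler_E => w; rewrite /chifar; case: (leP (V 2 i w) (z / 16)) => [_|v2].
    by rewrite subrr mul0r !mulr_ge0 ?powR_ge0 // ?addr_ge0 // mulr_ge0.
  rewrite subr0 mul1r [leRHS]mulrCA ler_wpM2l //; apply: (le_trans (hs _ _)).
  rewrite zpE; have -> : 256 * (4 + 12 * Ce) * (zi * z `^ (1 - p)) * V 5 i w `^ (p - 1) =
    (4 + 12 * Ce) * zi * (256 * z `^ (1 - p) * V 5 i w `^ (p - 1)) by ring.
  rewrite ler_peMr ?mulr_ge0 ?addr_ge0 ?mulr_ge0 //.
  have v5 : z / 16 <= V 5 i w by apply: (le_trans (ltW v2)); exact: V_mono.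
  apply: (@le_trans _ _ (256 * z `^ (1 - p) * (z / 16) `^ (p - 1))); last first.
    rewrite ler_wpM2l ?mulr_ge0 ?powR_ge0 // ge0_ler_powR ?nnegrE ?V_ge0 //; first by lra.
    by rewrite divr_ge0 // ltW.
  have e1 : z `^ (1 - p) * z `^ (p - 1) = 1.
    rewrite -powRD; last by rewrite (gt_eqF z0) implybT.
    by have -> : 1 - p + (p - 1) = 0 by [ring]; rewrite powRr0.
  have -> : (z / 16) `^ (p - 1) = z `^ (p - 1) * 16^-1 `^ (p - 1) by rewrite powRM ?(ltW z0).
  rewrite mulrA -(mulrA 256) e1 mulr1 -powR_inv1 // -powRrM mulN1r powRN ler_pdivlMr ?powR_gt0 // mul1r.
  have -> : 256 = 16 `^ 2 :> R by rewrite powR_mulrn //; ring.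
  by rewrite ler_powR //; lra.
apply: (le_trans h1); rewrite EZ.
have := ler_wpM2l (_ : 0 <= 256 * (4 + 12 * Ce) * zp) (third_XV i).
move=> H; apply: le_trans (H _) _; last by rewrite le_eqVlt; apply/orP; left; apply/eqP; ring.
by rewrite !mulr_ge0 ?powR_ge0 // addr_ge0 // mulr_ge0.
Qed.

Theorem far_smooth :
  `|E (fun w : conf => smooth z al (W w)) - smooth_mean z al| <= Kfar * (zp * Gam).
Proof.
have fg t := der_sol z al0 t.
have chi01 i w : 0 <= chifar i w <= 1 by rewrite /chifar ler0n lern1 leq_b1.
have := @stein_decomposition R F (sol z al) (dsol z al) chifar rfar fg chi01 dep_chifar rfarP.
set B := \sum_i _ => HB.
have -> : E (fun w : conf => smooth z al (W w)) - smooth_mean z al =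
   E (fun w : conf => dsol z al (W w)) - E (fun w : conf => W w * sol z al (W w)).
  by rewrite -EB -(E_cst F (smooth_mean z al)) -EB; apply: eq_E => w; rewrite /dsol; ring.
apply: (le_trans HB); apply: (@le_trans _ _ (\sum_i Kfar * zp * third i)); last first.
  rewrite -mulr_sumr mulrA; apply: ler_wpM2l; last exact: sum_third.
  by rewrite mulr_ge0 ?powR_ge0 // /Kfar; move: Ct0 Ce0; lra.
apply: ler_sum => i _.
have t0 : 0 <= (105 + 22 * Ct + 4 * Ce) * third i.
  by rewrite mulr_ge0 ?third_ge0 //; move: Ct0 Ce0; lra.
have h0 := ler_wpM2r t0 zi3_zp.
have h1 := le_trans (E_rfar_cst i) h0; have h2 := le_trans (E_rfar_zeta i) h0.
apply: le_trans (lerD (lerD h1 h2) (lerD (E_far_D1 i) (E_far_D2 i))) _.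
rewrite le_eqVlt; apply/orP; left; apply/eqP; rewrite /Kfar; ring.
Qed.

End NonUniform.


(** * Both bounds on a finite probability space *)

Section Far.
Variables (R : realType) (F : lfield R).
Local Notation p := (expo F).
Local Notation conf := (conf F).
Local Notation Gam := (Gam F).
Local Notation Pr := (@Pr R F).

Lemma expR_le_eps (z : R) : expR (- (z ^+ 2 / 2)) <= eps z.
Proof. by rewrite /eps ler_expR lerN2; have := sqr_ge0 z; lra. Qed.

Section Smoothed.
Variables (z al Ct Ce : R).
Hypotheses (z16 : 16 <= z) (al0 : 0 < al) (al1 : al <= 1).
Hypotheses (Gal : Gam * z ^+ 4 <= al) (Gz : Gam <= z^-1 ^+ 24).
Hypotheses (Ct0 : 0 <= Ct) (Ce0 : 0 <= Ce).
Hypothesis tailW : Pr (fun w => z / 8 <= `|W w|) <= Ct * z^-1 ^+ 8.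
Hypothesis epsz : eps z <= Ce * z^-1 ^+ 8.

Let H : `|E (fun w : conf => smooth z al (W w)) - smooth_mean z al| <= Kfar Ct Ce * (z `^ (- p) * Gam).
Proof. by apply: far_smooth. Qed.

Let incr : Phi (z + al) - Phi z <= al * eps z.
Proof.
have zz : z <= z + al by rewrite lerDl ltW.
have z0 : 0 <= z by apply: le_trans z16.
apply: le_trans (Phi_incr z0 zz) _; rewrite addrAC subrr add0r.
by rewrite ler_wpM2l ?expR_le_eps // ltW.
Qed.

Lemma far_upper : Pr (fun w => W w <= z) - Phi z <= Kfar Ct Ce * (z `^ (- p) * Gam) + al * eps z.
Proof.
have /ler_normlP[_ h] := H; have := Pr_le_smooth F z al0; have := mean_le z al0.
by have := incr; lra.
Qed.

Lemma far_lower : Phi (z + al) - Pr (fun w => W w < z + al) <=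
  Kfar Ct Ce * (z `^ (- p) * Gam) + al * eps z.
Proof.
have /ler_normlP[h _] := H; have := smooth_le_Pr F (z + al) al0; rewrite addrK.
have := mean_ge z al0; have := incr; lra.
Qed.

End Smoothed.

Variables (C4 C14 e3 e13 : R).
Hypotheses (C40 : 0 <= C4) (C140 : 0 <= C14) (e30 : 0 <= e3) (e130 : 0 <= e13).
Hypothesis tail4 : forall z : R, 1 <= z -> Pr (fun w => z <= `|W w|) <=
  C4 * (z^-1 ^+ (2 * 4) + Gam * z `^ (- p)).
Hypothesis tail14 : forall z : R, 1 <= z -> Pr (fun w => z <= `|W w|) <=
  C14 * (z^-1 ^+ (2 * 14) + Gam * z `^ (- p)).
Hypothesis eps3 : forall z : R, 1 <= z -> eps z <= e3 * z^-1 ^+ (2 * 4).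
Hypothesis eps13 : forall z : R, 1 <= z -> eps z <= e13 * z^-1 ^+ (2 * 14).

Variable Ct : R.
Hypotheses (Ct0 : 0 <= Ct) (CtE : C4 * (8 ^+ 8 + 1) <= Ct).

Definition Cfar : R := 8 * (Kfar Ct e3 + e3) + e13 + 2 * C14.

Let G0 : 0 <= Gam := Gam_ge0 F.

Lemma tail8 (z : R) : 16 <= z -> Gam <= z^-1 ^+ 24 ->
  Pr (fun w => z / 8 <= `|W w|) <= Ct * z^-1 ^+ 8.
Proof.
move=> z16 Gz; have z0 : 0 < z by apply: lt_le_trans z16.
have z8 : 1 <= z / 8 by lra.
apply: (le_trans (tail4 z8)); apply: (@le_trans _ _ (C4 * (8 ^+ 8 + 1) * z^-1 ^+ 8)); last first.
  by apply: ler_wpM2r CtE; rewrite exprn_ge0 // invr_ge0 ltW.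
rewrite -mulrA; apply: (ler_wpM2l C40).
have -> : (z / 8)^-1 ^+ (2 * 4) = 8 ^+ 8 * z^-1 ^+ 8 by rewrite invf_div exprMn.
rewrite mulrDl lerD2l mul1r; apply: (@le_trans _ _ Gam).
  have p2 := p2 F; rewrite ler_piMr // powRN invf_le1 ?powR_gt0 //; last by lra.
  by apply: powR_ge1 => //; lra.
apply: (le_trans Gz); apply: ler_wiXn2l => //.
  by rewrite invr_ge0 ltW.
by rewrite invf_le1 //; lra.
Qed.

Lemma inv_small (z : R) : 1 <= z -> 0 < z^-1 /\ z^-1 <= 1.
Proof.
move=> z1; have z0 : 0 < z by apply: lt_le_trans z1.
by rewrite invr_gt0 z0 invf_le1.
Qed.

Lemma inv3_powR (z : R) : 1 <= z -> z^-1 ^+ 3 <= z `^ (- p).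
Proof.
move=> z1; have z0 : 0 < z by apply: lt_le_trans z1.
have p3 := p3 F; rewrite exprVn powRN lef_pV2 ?posrE ?powR_gt0 ?exprn_gt0 //.
by rewrite -powR_mulrn ?(ltW z0) // ler_powR.
Qed.

Lemma far_error (z al : R) : 16 <= z -> 0 <= Gam -> Gam * z ^+ 4 <= al ->
  al <= 1 -> (al - Gam * z ^+ 4) * e3 + Gam * (e3 * z `^ (- p)) >= al * eps z.
Proof.
move=> z16 _ Ga a1; have z1 : 1 <= z by lra.
have [zi0 zi1] := inv_small z1; have z0 : 0 < z by lra.
have e8 : eps z <= e3 * z^-1 ^+ 8 by exact: eps3.
have -> : al * eps z = (al - Gam * z ^+ 4) * eps z + Gam * (z ^+ 4 * eps z) by ring.
apply: lerD.
  rewrite ler_wpM2l ?subr_ge0 //; apply: (le_trans e8); rewrite ler_piMr //.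
  by rewrite exprn_ile1 // ltW.
rewrite ler_wpM2l //; apply: (@le_trans _ _ (z ^+ 4 * (e3 * z^-1 ^+ 8))).
  by rewrite ler_wpM2l // exprn_ge0 // ltW.
rewrite mulrCA ler_wpM2l //.
have -> : z ^+ 4 * z^-1 ^+ 8 = z^-1 ^+ 4 by field; rewrite gt_eqF.
apply: le_trans (inv3_powR z1); apply: ler_wiXn2l => //; exact: ltW.
Qed.

Lemma Kfar_ge0 : 0 <= Kfar Ct e3.
Proof.
by rewrite /Kfar; move: Ct0 e30; lra.
Qed.

(** If [Gam > z^-1 ^+ 24], the tails of [W] and of the normal distribution, of order [z^-1 ^+ 28] up
  to a multiple of [Gam * z `^ (- p)], are bounded separately.  Otherwise [far_upper] and
  [far_lower] apply with [al] close to [Gam * z ^+ 4]. *)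
Lemma far_bound (z : R) : 17 <= z ->
  Pr (fun w => W w <= z) - Phi z <= Cfar * (z `^ (- p) * Gam) /\
  Phi z - Pr (fun w => W w < z) <= Cfar * (z `^ (- p) * Gam).
Proof.
move=> z17; have z1 : 1 <= z by lra.
have z0 : 0 < z by lra.
have [zi0 zi1] := inv_small z1.
have zp0 : 0 <= z `^ (- p) * Gam by rewrite mulr_ge0 ?powR_ge0.
have K0 := Kfar_ge0.
have c0 : 0 <= (e13 + 2 * C14) * (z `^ (- p) * Gam) by rewrite mulr_ge0 // addr_ge0 // mulr_ge0.
have c1 : 0 <= (Kfar Ct e3 + e3) * (z `^ (- p) * Gam) by rewrite mulr_ge0 // addr_ge0.
have CE : Cfar * (z `^ (- p) * Gam) = 8 * ((Kfar Ct e3 + e3) * (z `^ (- p) * Gam)) +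
   (e13 + 2 * C14) * (z `^ (- p) * Gam) by rewrite /Cfar; ring.
have [Gz|/ltW zG] := leP Gam (z^-1 ^+ 24); last first.
  have small : z^-1 ^+ 28 <= z `^ (- p) * Gam.
    apply: (@le_trans _ _ (z^-1 ^+ 3 * z^-1 ^+ 24)).
      by rewrite -exprD; apply: ler_wiXn2l => //; exact: ltW.
    by apply: ler_pM; rewrite ?exprn_ge0 ?(ltW zi0) ?inv3_powR.
  have t := tail_eps z1; have e := eps13 z1; have w := tail14 z1.
  have e' := ler_wpM2l e130 small; have w' := ler_wpM2l C140 small.
  have PW : Pr (fun w => W w <= z) <= 1 by exact: Pr_le1.
  have c2 : 0 <= 8 * ((Kfar Ct e3 + e3) * (z `^ (- p) * Gam)) by rewrite mulr_ge0.
  have PL : 1 - Pr (fun w => W w < z) <= Pr (fun w => z <= `|W w|).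
    rewrite lerBlDr -ED -[leLHS](E_cst F 1); apply: ler_E => w1.
    case: (ltP (W w1) z) => [_|zw]; first by rewrite lerDr.
    by rewrite addr0; case: (leP z `|W w1|) => // ; rewrite ltNge (le_trans zw) // ler_norm.
  have c3 := mulr_ge0 C140 zp0; have c4 := mulr_ge0 e130 zp0.
  have P1 := Phi_le1 z; rewrite CE [Gam * _]mulrC in w *.
  by split; lra.
have small4 : Gam * z ^+ 4 <= 2^-1.
  apply: (@le_trans _ _ (z^-1 ^+ 24 * z ^+ 4)).
    by rewrite ler_wpM2r // exprn_ge0 // ltW.
  have -> : z^-1 ^+ 24 * z ^+ 4 = z^-1 ^+ 20 by field; rewrite gt_eqF.
  apply: (@le_trans _ _ (z^-1 ^+ 1)); first by apply: ler_wiXn2l => //; exact: ltW.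
  by rewrite expr1 lef_pV2 ?posrE //; lra.
suff S : forall L : nat, (0 < L)%N ->
   Pr (fun w => W w <= z) - Phi z <= 8 * ((Kfar Ct e3 + e3) * (z `^ (- p) * Gam)) + (8 * e3) / L%:R /\
   Phi z - Pr (fun w => W w < z) <= 8 * ((Kfar Ct e3 + e3) * (z `^ (- p) * Gam)) + (8 * e3) / L%:R.
  rewrite CE; split; apply: (@le_trans _ _ (8 * ((Kfar Ct e3 + e3) * (z `^ (- p) * Gam)))); try lra.
    by apply: (@le_of_le_addeps _ _ _ (8 * e3)) => L /S[].
  by apply: (@le_of_le_addeps _ _ _ (8 * e3)) => L /S[].
move=> L L0; pose d : R := 2^-1 / L%:R.
have L1 : 0 < d by rewrite /d divr_gt0 // ltr0n.
have L2 : d <= 2^-1 by rewrite /d ler_piMr // invf_le1 ?ler1n ?ltr0n.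
have L3 : d * e3 <= (8 * e3) / L%:R.
  have : 0 <= e3 / L%:R by rewrite divr_ge0.
  rewrite /d; set l := L%:R^-1; lra.
(* As before, [d] makes [al] positive. *)
pose al : R := Gam * z ^+ 4 + d.
have Gz4 : 0 <= Gam * z ^+ 4 by rewrite mulr_ge0 // exprn_ge0 // ltW.
have al0 : 0 < al by rewrite /al; lra.
have al1 : al <= 1 by rewrite /al; lra.
split.
  have Ga : Gam * z ^+ 4 <= al by rewrite /al; lra.
  have z16 : 16 <= z by lra.
  have h := far_upper z16 al0 al1 Ga Gz Ct0 e30 (tail8 z16 Gz) (eps3 z1).
  have h' := far_error z16 G0 Ga al1.
  have -> : (Kfar Ct e3 + e3) * (z `^ (- p) * Gam) = Kfar Ct e3 * (z `^ (- p) * Gam) + Gam * (e3 * z `^ (- p)) by ring.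
  have k1 : 0 <= Kfar Ct e3 * (z `^ (- p) * Gam) by rewrite mulr_ge0.
  have k2 : 0 <= Gam * (e3 * z `^ (- p)) := mulr_ge0 G0 (mulr_ge0 e30 (powR_ge0 _ _)).
  have dE : al - Gam * z ^+ 4 = d by rewrite /al; ring.
  rewrite dE in h'; lra.
(* The lower bound needs a smoothed indicator that ends at [z]. *)
pose y := z - al.
have yz : y <= z by rewrite /y; lra.
have y16 : 16 <= y by rewrite /y; lra.
have y1 : 1 <= y by lra.
have y0 : 0 < y by lra.
have Gy : Gam <= y^-1 ^+ 24.
  apply: (le_trans Gz); rewrite lerXn2r ?nnegrE ?(ltW zi0) ?invr_ge0 ?(ltW y0) //.
  by rewrite lef_pV2 ?posrE.
have Ga : Gam * y ^+ 4 <= al.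
  apply: (@le_trans _ _ (Gam * z ^+ 4)); last by rewrite /al; lra.
  by rewrite ler_wpM2l // lerXn2r ?nnegrE ?(ltW y0) ?(ltW z0).
have h := far_lower y16 al0 al1 Ga Gy Ct0 e30 (tail8 y16 Gy) (eps3 y1).
have zE : y + al = z by rewrite /y; ring.
rewrite zE in h.
have yp : y `^ (- p) <= 8 * z `^ (- p).
  have p2 := p2 F; have p3 := p3 F; have pp := p0 F.
  rewrite !powRN ler_pdivlMr ?powR_gt0 // mulrC ler_pdivrMr ?powR_gt0 //.
  apply: (@le_trans _ _ ((2 * y) `^ p)).
    by rewrite ge0_ler_powR ?nnegrE ?(ltW z0) ?mulr_ge0 ?(ltW y0) ?(ltW pp) // /y; lra.
  rewrite powRM ?(ltW y0) // ler_wpM2r ?powR_ge0 //.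
  apply: (@le_trans _ _ (2 `^ 3)); first by rewrite ler_powR // ler1n.
  by rewrite powR_mulrn //; lra.
have h1 : Kfar Ct e3 * (y `^ (- p) * Gam) <= 8 * (Kfar Ct e3 * (z `^ (- p) * Gam)).
  have := ler_wpM2r G0 yp => q; have := ler_wpM2l K0 q; lra.
have e8 : al * eps y <= al * (e3 * y^-1 ^+ 8).
  by rewrite ler_wpM2l ?(ltW al0) //; exact: eps3.
have yiz : y^-1 <= 2 * z^-1.
  by rewrite -[2]invrK -invfM lef_pV2 ?posrE ?mulr_gt0 // /y; lra.
have h2 : al * (e3 * y^-1 ^+ 8) <= 8 * (Gam * (e3 * z `^ (- p))) + d * e3.
  have -> : al * (e3 * y^-1 ^+ 8) = Gam * (e3 * (z ^+ 4 * y^-1 ^+ 8)) + d * (e3 * y^-1 ^+ 8).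
    by rewrite /al; ring.
  have [yi0 yi1] := inv_small y1.
  apply: lerD.
    have -> : 8 * (Gam * (e3 * z `^ (- p))) = Gam * (e3 * (8 * z `^ (- p))) by ring.
    apply: (ler_wpM2l G0); apply: (ler_wpM2l e30).
    have y8 : y^-1 ^+ 8 <= (2 * z^-1) ^+ 4 * y^-1 ^+ 4.
      rewrite -[8%N]/(4 + 4)%N exprD ler_wpM2r ?exprn_ge0 ?(ltW yi0) //.
      by rewrite lerXn2r ?nnegrE ?mulr_ge0 ?(ltW zi0) ?(ltW yi0).
    apply: (@le_trans _ _ (z ^+ 4 * ((2 * z^-1) ^+ 4 * y^-1 ^+ 4))).
      by rewrite ler_wpM2l // exprn_ge0 // ltW.
    have -> : z ^+ 4 * ((2 * z^-1) ^+ 4 * y^-1 ^+ 4) = 16 * y^-1 * y^-1 ^+ 3.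
      by field; rewrite !gt_eqF.
    apply: le_trans yp; apply: le_trans (inv3_powR y1).
    rewrite ler_piMl ?exprn_ge0 ?(ltW yi0) // ler_pdivrMr //; lra.
  rewrite ler_wpM2l ?(ltW L1) // ler_piMr // exprn_ile1 // ltW //.
have -> : 8 * ((Kfar Ct e3 + e3) * (z `^ (- p) * Gam)) =
  8 * (Kfar Ct e3 * (z `^ (- p) * Gam)) + 8 * (Gam * (e3 * z `^ (- p))) by ring.
lra.
Qed.

Definition Cnon : R := 75 * 18 ^+ 3 + 8 * Cfar.

Lemma Cfar_ge0 : 0 <= Cfar.
Proof. by have := Kfar_ge0; rewrite /Cfar; move: C140 e30 e130; lra. Qed.

Lemma nonuniform_bound (z : R) : 0 <= z ->
  Pr (fun w => W w <= z) - Phi z <= Cnon * ((1 + z) `^ (- p) * Gam) /\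
  Phi z - Pr (fun w => W w < z) <= Cnon * ((1 + z) `^ (- p) * Gam).
Proof.
move=> z0; have p3 := p3 F; have pp := p0 F; have cf := Cfar_ge0.
have zp0 : 0 <= (1 + z) `^ (- p) * Gam by rewrite mulr_ge0 ?powR_ge0.
have [z17|/ltW z17] := leP 17 z.
  have zz : 0 < z by lra.
  have q : z `^ (- p) <= 8 * (1 + z) `^ (- p).
    rewrite !powRN ler_pdivlMr ?powR_gt0 //; last by lra.
    rewrite mulrC ler_pdivrMr ?powR_gt0 //.
    apply: (@le_trans _ _ ((2 * z) `^ p)).
      by rewrite ge0_ler_powR ?nnegrE ?mulr_ge0 ?addr_ge0 ?(ltW zz) ?(ltW pp) //; lra.
    rewrite powRM ?(ltW zz) // ler_wpM2r ?powR_ge0 //.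
    apply: (@le_trans _ _ (2 `^ 3)); first by rewrite ler_powR // ler1n.
    by rewrite powR_mulrn //; lra.
  have {}q : Cfar * (z `^ (- p) * Gam) <= Cnon * ((1 + z) `^ (- p) * Gam).
    have := ler_wpM2l cf (ler_wpM2r G0 q); rewrite /Cnon; have := mulr_ge0 (exprn_ge0 3 (ler0n R 18)) zp0.
    lra.
  by have [h1 h2] := far_bound z17; split; [apply: le_trans h1 q|apply: le_trans h2 q].
have q : 75 * Gam <= Cnon * ((1 + z) `^ (- p) * Gam).
  have r : 1 <= 18 ^+ 3 * (1 + z) `^ (- p).
    rewrite powRN ler_pdivlMr ?mul1r ?powR_gt0 //; last by lra.
    apply: (@le_trans _ _ (18 `^ p)).
      by rewrite ge0_ler_powR ?nnegrE ?addr_ge0 ?(ltW pp) //; lra.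
    by rewrite -powR_mulrn // ler_powR // ler1n.
  have := ler_wpM2r G0 r; have := mulr_ge0 cf zp0; rewrite /Cnon; lra.
have [h1 h2] := uniform_bound F z.
by split; [apply: le_trans h1 q|apply: le_trans h2 q].
Qed.

End Far.

Section Reflection.
Variables (R : realType) (F : lfield R).

Lemma mean0N i : Ex (@mass R F) (fun w => - coord i (w i)) = 0.
Proof. by rewrite ExN mean0 oppr0. Qed.

Lemma var1N : Ex (@mass R F) (fun w => (\sum_i - coord i (w i)) ^+ 2) = 1.
Proof. by rewrite -[RHS](var1 F); apply: eq_Ex => w; rewrite sumrN sqrrN. Qed.

(** Reflection: it exchanges the two one-sided bounds, and the two half lines. *)
Definition negF : lfield R :=
  @LField R (site F) (state F) (@mass R F) (fun i x => - coord i x) (@dist R F) (radius F)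
   (expo F) (kap F) (@mass_ge0 R F) (mass1 F) (@dist_sym R F) (@dist_refl R F) (@dist_tri R F)
   (@indep R F) mean0N var1N (expo_bd F) (@card_bd R F).

Lemma W_negF (w : conf F) : W (w : conf negF) = - W w.
Proof. by rewrite /W /X /= sumrN. Qed.

Lemma Gam_negF : Gam negF = Gam F.
Proof.
rewrite /Gam /gam /=; congr (_ * _); apply: eq_bigr => i _.
by apply: eq_Ex => w; rewrite /X /= normrN.
Qed.

End Reflection.

Theorem finite_nonuniform (R : realType) : exists2 C : R, 0 <= C & forall (F : lfield R) (z : R),
  Pr (fun w : conf F => W w <= z) - Phi z <= C * ((1 + `|z|) `^ (- expo F) * Gam F) /\
  Phi z - Pr (fun w : conf F => W w < z) <= C * ((1 + `|z|) `^ (- expo F) * Gam F).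
Proof.
have [C4 C40 t4] := tail_prob R 4; have [C14 C140 t14] := tail_prob R 14.
have [e3 e30 h3] := eps_poly R 3; have [e13 e130 h13] := eps_poly R 13.
pose Ct := C4 * (8 ^+ 8 + 1).
have Ct0 : 0 <= Ct by apply: mulr_ge0 C40 _; apply: addr_ge0 (exprn_ge0 _ _) _.
pose C := Cnon C14 e3 e13 Ct.
have pos (F : lfield R) z : 0 <= z ->
  Pr (fun w : conf F => W w <= z) - Phi z <= C * ((1 + z) `^ (- expo F) * Gam F) /\
  Phi z - Pr (fun w : conf F => W w < z) <= C * ((1 + z) `^ (- expo F) * Gam F).
  move=> z0; apply: (@nonuniform_bound R F C4 C14 e3 e13 C40 C140 e30 e130 (t4 F) (t14 F) h3 h13 Ct Ct0) => //.
exists C.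
  have := @Cfar_ge0 R C14 e3 e13 C140 e30 e130 Ct Ct0; rewrite /C /Cnon.
  by have := exprn_ge0 3 (ler0n R 18); lra.
move=> F z; have [z0|/ltW z0] := leP 0 z; first by rewrite ger0_norm //; exact: pos.
rewrite ler0_norm //; have Nz : 0 <= - z by rewrite oppr_ge0.
have [h1 h2] := pos (negF F) _ Nz; rewrite Gam_negF PhiN /= in h1 h2.
have e1 : Pr (fun w : conf (negF F) => W w < - z) = 1 - Pr (fun w : conf F => W w <= z).
  rewrite /Pr -[X in X - _](E_cst F 1) -EB; apply: eq_E => w.
  by rewrite W_negF ltrN2; case: ltP => _ /=; rewrite ?subrr ?subr0.
have e2 : Pr (fun w : conf (negF F) => W w <= - z) = 1 - Pr (fun w : conf F => W w < z).
  rewrite /Pr -[X in X - _](E_cst F 1) -EB; apply: eq_E => w.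
  by rewrite W_negF lerN2; case: leP => _ /=; rewrite ?subrr ?subr0.
by rewrite e1 in h2; rewrite e2 in h1; split; lra.
Qed.

Local Open Scope classical_set_scope.
Local Open Scope ring_scope.


(** * Discretization of real random variables *)

Section FiniteValued.
Context d (T : measurableType d) (R : realType) (P : probability T R).

Section Law.
Variables (U : finType) (w : T -> U).
Hypothesis mw : forall u, measurable (w @^-1` [set u]).

Lemma measurable_fibers (A : set U) : measurable (w @^-1` A).
Proof.
have -> : w @^-1` A = \bigcup_(u in A) (w @^-1` [set u]).
  by apply/seteqP; split => [t At|t [u Au] /= ->] //; exists (w t).
by apply: fin_bigcup_measurable => //; exact: finite_finset.
Qed.

Lemma measurable_finite (F : U -> R) : measurable_fun setT (F \o w).
Proof.
move=> _ B _; rewrite setTI.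
have -> : (F \o w) @^-1` B = w @^-1` (F @^-1` B) by [].
exact: measurable_fibers.
Qed.

Definition law u : R := fine (P (w @^-1` [set u])).

Lemma law_ge0 u : 0 <= law u.
Proof. by rewrite fine_ge0. Qed.

Lemma Ex_law (F : U -> R) : Ex law F = \int[P]_t F (w t).
Proof.
rewrite /Rintegral.
have -> : (\int[P]_t (F (w t))%:E = \int[P]_t \sum_u (F u)%:E * (\1_(w @^-1` [set u]) t)%:E)%E.
  apply: eq_integral => t _; rewrite (bigD1 (w t)) //= big1 ?adde0.
    by rewrite indicE mem_set // mule1.
  move=> u /eqP uw; rewrite indicE memNset ?mule0 // => /= e; exact: uw.
rewrite integral_sum //; last first.
  by move=> u; apply: integrableZl => //; exact: integrable_indic.
rewrite (eq_bigr (fun u => (law u * F u)%:E)); first by rewrite sumEFin.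
move=> u _; rewrite integralZl //; last exact: integrable_indic.
rewrite integral_indic // setIT mulrC EFinM /law fineK // fin_num_measure //.
Qed.

Lemma law1 : \sum_u law u = 1.
Proof.
have := Ex_law (fun=> 1); rewrite /Ex (eq_bigr law) => [->|u _]; last by rewrite mulr1.
by rewrite Rintegral_cst //= probability_setT mul1r.
Qed.

Lemma Ex_law_prob (A : pred U) : Ex law (fun u => (A u)%:R) = fine (P (w @^-1` [set u | A u])).
Proof.
rewrite Ex_law /Rintegral; congr fine.
rewrite -[in RHS](setIT (w @^-1` _)) -integral_indic //; last exact: measurable_fibers.
apply: eq_integral => t _; rewrite indicE.
have -> // : (t \in w @^-1` [set u | A u]) = A (w t).
by apply/idP/idP; rewrite inE.
Qed.

End Law.

(** Both sides are sums over pairs of values, since [w1] and [w2] take finitely many values. *)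
Lemma Ex_law_indep (U1 U2 : finType) (w1 : T -> U1) (w2 : T -> U2) (f : U1 -> R) (g : U2 -> R) :
  (forall u, measurable (w1 @^-1` [set u])) -> (forall u, measurable (w2 @^-1` [set u])) ->
  (forall u v, P (w1 @^-1` [set u] `&` w2 @^-1` [set v]) =
    (P (w1 @^-1` [set u]) * P (w2 @^-1` [set v]))%E) ->
  \int[P]_t (f (w1 t) * g (w2 t)) = (\int[P]_t f (w1 t)) * \int[P]_t g (w2 t).
Proof.
move=> m1 m2 ind; pose w t := (w1 t, w2 t).
have wE u v : w @^-1` [set (u, v)] = w1 @^-1` [set u] `&` w2 @^-1` [set v].
  by apply/seteqP; split => t; [case=> <- <-|case=> /= <- <-].
have mw u : measurable (w @^-1` [set u]).
  by case: u => u v; rewrite wE; apply: measurableI.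
rewrite -(Ex_law m1) -(Ex_law m2) -(@Ex_law _ w mw (fun uv => f uv.1 * g uv.2)).
rewrite /Ex (eq_bigr (fun uv => (law w1 uv.1 * f uv.1) * (law w2 uv.2 * g uv.2))); last first.
  move=> [u v] _ /=; rewrite /law wE ind fineM ?fin_num_measure //; ring.
rewrite -(pair_bigA _ (fun u v => (law w1 u * f u) * (law w2 v * g v))) /= mulr_suml.
by apply: eq_bigr => u _; rewrite mulr_sumr.
Qed.

Lemma cvg_mean (f_ : nat -> T -> R) (f g : T -> R) :
  (forall n, measurable_fun setT (f_ n)) -> measurable_fun setT f ->
  (forall t, f_ n t @[n --> \oo] --> f t) ->
  P.-integrable setT (EFin \o g) -> (forall n t, `|f_ n t| <= g t) ->
  \int[P]_t f_ n t @[n --> \oo] --> \int[P]_t f t.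
Proof.
move=> mf_ mf cf ig fg.
have [] := @dominated_convergence _ _ _ P setT measurableT (fun n => EFin \o f_ n)
   (EFin \o f) (EFin \o g).
- by move=> n; apply/measurable_EFinP.
- exact/measurable_EFinP.
- by apply: aeW => t _ /=; apply: cvg_EFin; [exact: nearW|exact: cf].
- exact: ig.
- by apply: aeW => t n _ /=; rewrite lee_fin.
move=> iF _ H; apply: fine_cvg; rewrite /Rintegral fineK //.
exact: integrable_fin_num.
Qed.

End FiniteValued.

Section Cells.
Variable R : realType.
Variable n : nat.
Local Notation h := (n.+1%:R : R).

Definition ncell := (2 * n.+1 * n.+1)%N.

(** Index of the interval of length [n.+1^-1] that contains [x], with one more index for the numbers
  outside [[- n.+1, n.+1)], which are rounded to [0]. *)
Definition cell (x : R) : 'I_ncell.+1 :=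
  inord (if - h <= x < h then Num.trunc (h * (x + h)) else ncell).

Definition cval (k : 'I_ncell.+1) : R := if (k < ncell)%N then k%:R / h - h else 0.

Definition round (x : R) : R := cval (cell x).

Let h0 : 0 < h. Proof. exact: ltr0Sn. Qed.

Lemma trunc_lt (x : R) : - h <= x < h -> (Num.trunc (h * (x + h)) < ncell)%N.
Proof.
move=> /andP[x1 x2]; rewrite truncn_lt_nat.
  rewrite /ncell -mulnA !natrM mulrCA ltr_pM2l //; lra.
rewrite mulr_ge0 ?(ltW h0) //; lra.
Qed.

Lemma cell_in (x : R) : - h <= x < h -> cell x = Num.trunc (h * (x + h)) :> nat.
Proof. by move=> xh; rewrite /cell xh inordK // ltnS ltnW // trunc_lt. Qed.

Lemma cell_out (x : R) : ~~ (- h <= x < h) -> cell x = ncell :> nat.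
Proof. by move=> /negbTE xh; rewrite /cell xh inordK. Qed.

Lemma round_near (x : R) : - h <= x < h -> `|round x - x| <= h^-1.
Proof.
move=> xh; rewrite /round /cval cell_in // trunc_lt //.
have /andP[x1 x2] := xh; have y0 : 0 <= h * (x + h) by rewrite mulr_ge0 ?(ltW h0) //; lra.
have /andP[t1 t2] := truncn_itv y0.
rewrite -[ltRHS]natr1 in t2; set t := (Num.trunc _)%:R in t1 t2 *.
have -> : t / h - h - x = (t - h * (x + h)) / h by field; rewrite gt_eqF.
rewrite normrM (gtr0_norm (_ : 0 < h^-1)) ?invr_gt0 // ler_piMl ?invr_ge0 ?(ltW h0) //.
by rewrite ler_norml; apply/andP; split; move: t1 t2; set y := _ * _; lra.
Qed.

Lemma round_out (x : R) : ~~ (- h <= x < h) -> round x = 0.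
Proof. by move=> xh; rewrite /round /cval cell_out // ltnn. Qed.

Lemma round_le (x : R) : `|round x| <= `|x| + 1.
Proof.
have [xh|xh] := boolP (- h <= x < h); last by rewrite round_out // normr0 addr_ge0.
have := round_near xh; have : h^-1 <= 1 by rewrite invf_le1 // ler1n.
move=> h1 h2; apply: (@le_trans _ _ (`|round x - x| + `|x|)).
  by rewrite -{1}(subrK x (round x)) ler_normD.
by rewrite addrC lerD2l; exact: le_trans h2 h1.
Qed.

Lemma measurable_cell k : measurable (cell @^-1` [set k]).
Proof.
have [kN|kN] := ltnP k ncell.
  have -> : cell @^-1` [set k] = `[(k%:R / h - h)%R, (k.+1%:R / h - h)%R[%classic.
    apply/seteqP; split => x /=; rewrite in_itv /=.
      move=> kx; have xh : - h <= x < h.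
        by apply: contraLR kN => xh; rewrite -leqNgt -kx cell_out.
      have := cell_in xh; rewrite kx => ->; have /andP[x1 x2] := xh.
      have y0 : 0 <= h * (x + h) by rewrite mulr_ge0 ?(ltW h0) //; lra.
      have /andP[t1 t2] := truncn_itv y0.
      rewrite lerBlDr ltrBrDr ler_pdivrMr // ltr_pdivlMr // ![(x + h) * h]mulrC.
      by rewrite t1 t2.
    rewrite lerBlDr ltrBrDr ler_pdivrMr // ltr_pdivlMr // ![(x + h) * h]mulrC => /andP[t1 t2].
    have xh : - h <= x < h.
      have k0 : 0 <= h * (x + h) by apply: le_trans t1.
      have k1 : h * (x + h) < h * (2 * h).
        apply: lt_le_trans t2 _; rewrite mulrCA -!natrM ler_nat; move: kN.
        by rewrite /ncell mulnA.
      move: k0 k1; rewrite pmulr_rge0 // ltr_pM2l // => *; apply/andP; split; lra.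
    by apply: val_inj; rewrite /= cell_in //; apply: truncn_def; rewrite t1 t2.
  exact: measurable_itv.
have -> : cell @^-1` [set k] = ~` `[(- h)%R, h[%classic.
  apply/seteqP; split => x /=; rewrite in_itv /=.
    move=> kx xh; have := trunc_lt xh; rewrite -cell_in // kx ltnNge kN //.
  move=> /negP xh; apply: val_inj; rewrite /= cell_out //; apply/eqP.
  by rewrite eqn_leq kN -ltnS ltn_ord.
by apply: measurableC; exact: measurable_itv.
Qed.

End Cells.

Lemma round_cvg (R : realType) (x : R) : round n x @[n --> \oo] --> x.
Proof.
apply/cvgrPdist_le => e e0; near=> n.
have n1 : `|x| < n.+1%:R.
  by rewrite -truncn_le_nat; near: n; exact: nbhs_infty_ge.
rewrite distrC; apply: le_trans (round_near _) _.
  by move: n1; rewrite ltr_norml => /andP[/ltW -> ->].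
by apply: ltW; near: n; exact: (near_infty_natSinv_lt (PosNum e0)).
Unshelve. all: by end_near. Qed.


(** * Approximation by fields on finite probability spaces *)

Section Limits.
Variable R : realType.

Lemma cvg_finsum (I : Type) (s : seq I) (u : nat -> I -> R) (l : I -> R) :
  (forall i, u n i @[n --> \oo] --> l i) ->
  \sum_(i <- s) u n i @[n --> \oo] --> \sum_(i <- s) l i.
Proof.
move=> ul; elim: s => [|i s IH].
  by rewrite big_nil (_ : (fun n => _) = cst 0); [exact: cvg_cst|apply/funext => n; rewrite big_nil].
rewrite big_cons (_ : (fun n => _) = (fun n => u n i + \sum_(j <- s) u n j)).
  exact: cvgD.
by apply/funext => n; rewrite big_cons.
Qed.

Lemma cvg_continuous (f : R -> R) (u : nat -> R) (a : R) : {for a, continuous f} ->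
  u n @[n --> \oo] --> a -> f (u n) @[n --> \oo] --> f a.
Proof. by move=> cf ua; exact: (cvg_comp u f ua cf). Qed.

Lemma continuous_powR (p a : R) : 0 < a -> {for a, continuous (fun x : R => x `^ p)}.
Proof.
move=> a0; apply: differentiable_continuous; apply/derivable1_diffP.
by apply: derivable_powR; rewrite in_itv /= a0.
Qed.

Lemma cvg_normpowR (p a : R) (u : nat -> R) : 1 <= p -> u n @[n --> \oo] --> a ->
  `|u n| `^ p @[n --> \oo] --> `|a| `^ p.
Proof.
move=> p1 ua; have nu : `|u n| @[n --> \oo] --> `|a| by exact: cvg_norm.
have [a0|a0] := eqVneq a 0; last first.
  apply: (cvg_continuous (f := fun y => y `^ p) (u := fun n => `|u n|)) nu.
  by apply: continuous_powR; rewrite normr_gt0.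
rewrite a0 normr0 powR0 ?gt_eqF ?(lt_le_trans ltr01) //.
rewrite a0 normr0 in nu; apply: squeeze_cvgr (cvg_cst 0) nu.
have /cvgr_norm_lt : u n @[n --> \oo] --> a by [].
rewrite a0 normr0 => /(_ 1 ltr01) H; near=> n.
have n1 : `|u n| < 1 by near: n.
rewrite powR_ge0 /=; have [->|u0] := eqVneq `|u n| 0.
  by rewrite powR0 // gt_eqF // (lt_le_trans ltr01).
rewrite -[leRHS]powRr1 //; apply: ger_powR => //.
by rewrite lt_neqAle eq_sym u0 /= normr_ge0 ltW.
Unshelve. all: by end_near. Qed.

End Limits.

Section Approximation.
Context dd (T : measurableType dd) (R : realType) (P : probability T R).
Variables (I : finType) (x : I -> {RV P >-> R}) (p kap : R).
Variables (dst : I -> I -> nat) (m : nat).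
Hypothesis hp : 2 < p <= 3.
Hypothesis imom : forall i, P.-integrable setT (EFin \o (fun t => `|x i t| `^ p)).
Hypothesis xmean : forall i, \int[P]_t x i t = 0.
Hypothesis xvar : \int[P]_t ((\sum_i x i t) ^+ 2) = 1.
Hypothesis dst_sym : forall i j, dst i j = dst j i.
Hypothesis dst_refl : forall i, dst i i = 0%N.
Hypothesis dst_tri : forall i j k, (dst i k <= dst i j + dst j k)%N.
Hypothesis xindep : forall A B : {set I},
  (forall i j, i \in A -> j \in B -> (m < dst i j)%N) ->
  indep_families x [set i | i \in A] [set j | j \in B].
Hypothesis card_bd : forall i,
  (#|[set j | (dst i j <= 5 * m)%N]%SET|)%:R <= kap.

Let p2 : 2 < p. Proof. by case/andP: hp. Qed.
Let p0 : 0 < p. Proof. by move: p2; lra. Qed.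
Let p1 : 1 <= p. Proof. by move: p2; lra. Qed.

Let xm i : measurable_fun setT (x i : T -> R). Proof. exact: measurable_funPT. Qed.

Definition xsum (t : T) : R := \sum_i x i t.

Lemma integrable_le (f g : T -> R) : measurable_fun setT f ->
  P.-integrable setT (EFin \o g) -> (forall t, `|f t| <= g t) -> P.-integrable setT (EFin \o f).
Proof.
move=> mf ig fg; apply: le_integrable ig => //; first exact/measurable_EFinP.
by move=> t _ /=; rewrite lee_fin; apply: le_trans (fg t) (ler_norm _).
Qed.

Definition maj_cst : R := \sum_i (\int[P]_t `|x i t| + 2).
(** It bounds at once all rounded and centred variables and their sums, so that [dom] serves as the
  majorant for each use of dominated convergence. *)
Definition maj (t : T) : R := \sum_i `|x i t| + maj_cst.
Definition dom (t : T) : R := 1 + maj t `^ p.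

Lemma maj_cst_ge0 : 0 <= maj_cst.
Proof. by apply: sumr_ge0 => i _; rewrite addr_ge0 // Rintegral_ge0. Qed.

Lemma maj_ge0 t : 0 <= maj t.
Proof. by rewrite addr_ge0 ?maj_cst_ge0 // sumr_ge0. Qed.

Lemma measurable_maj : measurable_fun setT maj.
Proof.
apply: measurable_funD => //; apply: measurable_sum => i.
exact: measurableT_comp.
Qed.

Lemma integrable_dom : P.-integrable setT (EFin \o dom).
Proof.
pose k : R := (#|I|.+1)%:R; have k0 : 0 < k by rewrite ltr0Sn.
pose a : R := 2 `^ p * k `^ p * k^-1; have a0 : 0 <= a.
  by rewrite /a !mulr_ge0 ?powR_ge0 // invr_ge0 ltW.
pose g t : R := (1 + 2 `^ p * maj_cst `^ p) + a * \sum_i `|x i t| `^ p.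
have ig : P.-integrable setT (EFin \o g).
  have -> : EFin \o g = (cst (1 + 2 `^ p * maj_cst `^ p)%:E \+
      (fun t => a%:E * \sum_i (`|x i t| `^ p)%:E))%E.
    by apply/funext => t /=; rewrite sumEFin -EFinM -EFinD.
  apply: integrableD => //; first exact: finite_measure_integrable_cst.
  by apply: integrableZl => //; apply: integrable_sum => // i _; exact: imom.
apply: integrable_le ig _.
  apply: measurable_funD => //.
  by apply: (measurableT_comp (measurable_powR p)); exact: measurable_maj.
move=> t; rewrite ger0_norm ?addr_ge0 ?powR_ge0 // /dom /g -addrA lerD2l.
set s := \sum_i `|x i t|; have s0 : 0 <= s by rewrite sumr_ge0.
have hS : s `^ p <= k `^ p * (k^-1 * \sum_i `|x i t| `^ p).
  have cI : (#|[set: I]%SET|)%:R <= k by rewrite /k ler_nat cardsT.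
  have := @pow_avg_le R I [set: I]%SET (fun i => `|x i t|) p k p2 k0 cI (fun i => normr_ge0 _).
  rewrite (eq_bigl predT) => [|i]; last by rewrite finset.in_setT.
  rewrite [X in k^-1 * X](eq_bigl predT) => [H|i]; last by rewrite finset.in_setT.
  have -> : s = k * (s / k) by rewrite mulrC divfK // gt_eqF.
  by rewrite powRM ?(ltW k0) ?divr_ge0 ?(ltW k0) // ler_wpM2l ?powR_ge0.
have hM : maj t `^ p <= 2 `^ p * (maj_cst `^ p + s `^ p).
  have KK := maj_cst_ge0; have [KS|/ltW SK] := leP maj_cst s.
    apply: (@le_trans _ _ ((2 * s) `^ p)).
      by rewrite ge0_ler_powR ?nnegrE ?maj_ge0 ?mulr_ge0 ?(ltW p0) // /maj -/s; lra.
    by rewrite powRM // ler_wpM2l ?powR_ge0 // lerDr powR_ge0.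
  apply: (@le_trans _ _ ((2 * maj_cst) `^ p)).
    by rewrite ge0_ler_powR ?nnegrE ?maj_ge0 ?mulr_ge0 ?(ltW p0) // /maj -/s; lra.
  by rewrite powRM // ler_wpM2l ?powR_ge0 // lerDl powR_ge0.
apply: (le_trans hM); rewrite mulrDr lerD2l /a -!mulrA ler_wpM2l ?powR_ge0 //.
Qed.

Lemma maj_dom t : maj t <= dom t.
Proof.
have m0 := maj_ge0 t; have := powR_ge0 (maj t) p; rewrite /dom.
have [|/ltW m1] := leP (maj t) 1; first by lra.
have : maj t <= maj t `^ p by rewrite -[leLHS]powRr1 // ler_powR.
lra.
Qed.

Lemma maj2_dom t : maj t ^+ 2 <= dom t.
Proof.
have m0 := maj_ge0 t; have := powR_ge0 (maj t) p; rewrite /dom.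
have [m1|/ltW m1] := leP (maj t) 1.
  have : maj t ^+ 2 <= 1 by rewrite exprn_ile1.
  lra.
have : maj t ^+ 2 <= maj t `^ p by rewrite -powR_mulrn // ler_powR // ltW.
lra.
Qed.

Lemma majp_dom t : maj t `^ p <= dom t.
Proof. by rewrite /dom lerDr. Qed.

Lemma x_maj i t : `|x i t| + 1 <= maj t.
Proof.
rewrite /maj lerD //; first by rewrite (bigD1 i) //= lerDl sumr_ge0.
rewrite /maj_cst (bigD1 i) //= -[leLHS]addr0 lerD //.
  have : 0 <= \int[P]_t `|x i t| by exact: Rintegral_ge0.
  lra.
by apply: sumr_ge0 => j _; rewrite addr_ge0 // Rintegral_ge0.
Qed.

Lemma integrable_x i : P.-integrable setT (EFin \o x i).
Proof.
apply: integrable_le integrable_dom _ => // t.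
by apply: le_trans (maj_dom t); have := x_maj i t; lra.
Qed.

Definition rounded n i (t : T) : R := round n (x i t).

(** The rounded field as a random element of a finite space. *)
Definition cells n (t : T) : {ffun I -> 'I_(ncell n).+1} := [ffun i => cell n (x i t)].

Lemma cellsE n w : cells n @^-1` [set w] = \bigcap_(i in [set: I]) (x i @^-1` (cell n @^-1` [set w i])).
Proof.
apply/seteqP; split => [t /= <- i _ /=|t H]; first by rewrite ffunE.
by apply/ffunP => i; rewrite ffunE; exact: (H i).
Qed.

Lemma measurable_cells n w : measurable (cells n @^-1` [set w]).
Proof.
rewrite cellsE; apply: fin_bigcap_measurable => [|i _]; first exact: finite_finset.
by rewrite -[X in measurable X]setTI; apply: xm => //; exact: measurable_cell.
Qed.

Lemma measurable_rounded n i : measurable_fun setT (rounded n i).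
Proof.
have -> : rounded n i = (fun w : {ffun I -> 'I_(ncell n).+1} => cval R (w i)) \o cells n.
  by apply/funext => t; rewrite /= ffunE.
exact: measurable_finite (@measurable_cells n) _.
Qed.

Lemma rounded_maj n i t : `|rounded n i t| <= maj t.
Proof. exact: le_trans (round_le _ _) (x_maj i t). Qed.

Definition rounded_mean n i : R := \int[P]_t rounded n i t.

Lemma integrable_rounded n i : P.-integrable setT (EFin \o rounded n i).
Proof.
apply: integrable_le integrable_dom _; first exact: measurable_rounded.
by move=> t; apply: le_trans (rounded_maj n i t) (maj_dom t).
Qed.

Lemma rounded_mean_cvg i : rounded_mean n i @[n --> \oo] --> (0 : R).
Proof.
rewrite -(xmean i); apply: (cvg_mean (g := dom)).
- by move=> n; exact: measurable_rounded.
- exact: xm.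
- by move=> t; exact: round_cvg.
- exact: integrable_dom.
- by move=> n t; exact: le_trans (rounded_maj n i t) (maj_dom t).
Qed.

Lemma rounded_mean_le n i : `|rounded_mean n i| <= \int[P]_t `|x i t| + 1.
Proof.
have iq := integrable_rounded n i; have ix := integrable_x i.
apply: (le_trans (le_normr_Rintegral measurableT iq)).
have -> : \int[P]_t `|x i t| + 1 = \int[P]_t (`|x i t| + 1).
  rewrite RintegralD //; first by rewrite Rintegral_cst //= probability_setT mul1r.
    exact: (integrable_norm ix).
  exact: finite_measure_integrable_cst.
apply: le_Rintegral => //.
- exact: (integrable_norm iq).
- apply: (@integrableD _ _ _ P setT measurableT (fun t => (`|x i t|)%:E) (cst 1%:E)).
    exact: (integrable_norm ix).
  exact: finite_measure_integrable_cst.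
- by move=> t _; exact: round_le.
Qed.

Definition centred n i (t : T) : R := rounded n i t - rounded_mean n i.
Definition centred_sum n (t : T) : R := \sum_i centred n i t.

Lemma measurable_centred n i : measurable_fun setT (centred n i).
Proof. by apply: measurable_funB; [exact: measurable_rounded|]. Qed.

Lemma centred_le n i t : `|centred n i t| <= `|x i t| + (\int[P]_t `|x i t| + 2).
Proof.
apply: (le_trans (ler_normB _ _)); have := rounded_mean_le n i; have := round_le n (x i t).
rewrite -/(rounded n i t); lra.
Qed.

Lemma centred_sum_maj n t : `|centred_sum n t| <= maj t.
Proof.
apply: (le_trans (ler_norm_sum _ _ _)); rewrite /maj /maj_cst -big_split /=.
by apply: ler_sum => i _; exact: centred_le.
Qed.

Lemma centred_maj n i t : `|centred n i t| <= maj t.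
Proof.
apply: (le_trans (centred_le n i t)); rewrite /maj /maj_cst -big_split /= (bigD1 i) //= lerDl.
by apply: sumr_ge0 => j _; rewrite !addr_ge0 // Rintegral_ge0.
Qed.

Lemma centred_cvg i t : centred n i t @[n --> \oo] --> x i t.
Proof.
rewrite -[X in _ --> X]subr0; apply: cvgB; last exact: rounded_mean_cvg.
exact: round_cvg.
Qed.

Lemma centred_sum_cvg t : centred_sum n t @[n --> \oo] --> xsum t.
Proof. by apply: cvg_finsum => i; exact: centred_cvg. Qed.

Lemma measurable_centred_sum n : measurable_fun setT (centred_sum n).
Proof. by apply: measurable_sum => i; exact: measurable_centred. Qed.

Lemma measurable_xsum : measurable_fun setT xsum.
Proof. by apply: measurable_sum => i; exact: xm. Qed.

Definition rounded_var n : R := \int[P]_t (centred_sum n t ^+ 2).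

Lemma rounded_var_cvg : rounded_var n @[n --> \oo] --> (1 : R).
Proof.
rewrite -xvar; apply: (cvg_mean (g := dom)).
- by move=> n; apply: measurable_funX; exact: measurable_centred_sum.
- by apply: measurable_funX; exact: measurable_xsum.
- by move=> t; rewrite expr2 (_ : (fun n => _) = (fun n => centred_sum n t * centred_sum n t)) //;
    apply: cvgM; exact: centred_sum_cvg.
- exact: integrable_dom.
- move=> n t; apply: le_trans (maj2_dom t); rewrite normrX lerXn2r ?nnegrE ?maj_ge0 //.
  exact: centred_sum_maj.
Qed.

Definition rounded_sd n : R := Num.sqrt (rounded_var n).

Lemma rounded_sd_cvg : rounded_sd n @[n --> \oo] --> (1 : R).
Proof.
rewrite -[X in _ --> X]sqrtr1; apply: (cvg_continuous _ rounded_var_cvg); exact: sqrt_continuous.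
Qed.

Definition centred_absmom n i : R := \int[P]_t (`|centred n i t| `^ p).

Lemma centred_absmom_cvg i : centred_absmom n i @[n --> \oo] --> \int[P]_t (`|x i t| `^ p).
Proof.
apply: (cvg_mean (g := dom)).
- move=> n; apply: (measurableT_comp (measurable_powR p)).
  by apply: measurableT_comp => //; exact: measurable_centred.
- apply: (measurableT_comp (measurable_powR p)); exact: measurableT_comp.
- by move=> t; apply: cvg_normpowR => //; exact: centred_cvg.
- exact: integrable_dom.
- move=> n t; rewrite ger0_norm ?powR_ge0 //; apply: le_trans (majp_dom t).
  by rewrite ge0_ler_powR ?nnegrE ?maj_ge0 ?(ltW p0) // centred_maj.
Qed.

Definition rounded_sum n (t : T) : R := centred_sum n t / rounded_sd n.

Lemma rounded_sum_cvg t : rounded_sum n t @[n --> \oo] --> xsum t.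
Proof.
rewrite -[X in _ --> X]divr1; apply: cvgM; first exact: centred_sum_cvg.
by apply: cvgV; [exact: oner_neq0|exact: rounded_sd_cvg].
Qed.

Lemma measurable_rounded_sum n : measurable_fun setT (rounded_sum n).
Proof. by apply: measurable_funM => //; exact: measurable_centred_sum. Qed.

Definition far_event (e : R) n : set T := [set t | e < `|xsum t - rounded_sum n t|].

Lemma measurable_far_event e n : measurable (far_event e n).
Proof.
have m1 : measurable_fun setT (fun t => `|xsum t - rounded_sum n t|).
  apply: measurableT_comp => //; apply: measurable_funB; first exact: measurable_xsum.
  exact: measurable_rounded_sum.
have -> : far_event e n = setT `&` (fun t => `|xsum t - rounded_sum n t|) @^-1` `]e, +oo[%classic.
  by rewrite setTI; apply/seteqP; split => t /=; rewrite in_itv /= andbT.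
by apply: m1 => //; exact: measurable_itv.
Qed.

Lemma far_event_cvg (e : R) : 0 < e -> fine (P (far_event e n)) @[n --> \oo] --> (0 : R).
Proof.
move=> e0; rewrite (_ : (fun n => _) = (fun n => \int[P]_t (\1_(far_event e n) t))); last first.
  apply/funext => n; rewrite /Rintegral integral_indic ?setIT //; exact: measurable_far_event.
have -> : 0 = \int[P]_t (cst 0 t) :> R by rewrite Rintegral_cst // mul0r.
apply: (cvg_mean (g := dom)).
- by move=> n; apply: measurable_indic; exact: measurable_far_event.
- exact: measurable_cst.
- move=> t; apply: cvg_near_cst; have /cvgrPdist_lt/(_ _ e0) H := @rounded_sum_cvg t.
  near=> n; rewrite indicE memNset //= /far_event /= => h.
  have : `|xsum t - rounded_sum n t| < e by near: n.
  by rewrite ltNge (ltW h).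
- exact: integrable_dom.
- move=> n t; rewrite indicE ger0_norm // (@le_trans _ _ 1) ?lern1 ?leq_b1 //.
  by rewrite /dom lerDl powR_ge0.
Unshelve. all: by end_near. Qed.


Section FiniteField.
Variable n : nat.
Hypothesis var0 : 0 < rounded_var n.
Local Notation D := ('I_(ncell n).+1).

Definition cmass : {ffun I -> D} -> R := law P (cells n).
Definition ccoord (i : I) (k : D) : R := (cval R k - rounded_mean n i) / rounded_sd n.

Lemma Ex_cells (F : {ffun I -> D} -> R) : Ex cmass F = \int[P]_t F (cells n t).
Proof. exact: (Ex_law P (@measurable_cells n) F). Qed.

Lemma Ex_cval i : Ex cmass (fun w => cval R (w i)) = rounded_mean n i.
Proof.
rewrite Ex_cells /rounded_mean; apply: eq_Rintegral => t _.
by rewrite /rounded /round ffunE.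
Qed.

Lemma cmass_ge0 w : 0 <= cmass w. Proof. exact: law_ge0. Qed.
Lemma cmass1 : \sum_w cmass w = 1. Proof. exact: (law1 P (@measurable_cells n)). Qed.

Lemma cmean0 i : Ex cmass (fun w => ccoord i (w i)) = 0.
Proof. by rewrite ExZr ExB Ex_cval Ex_cst ?cmass1 // subrr mul0r. Qed.

Lemma rounded_sd_sqr : rounded_sd n ^+ 2 = rounded_var n. Proof. by rewrite sqr_sqrtr // ltW. Qed.
Lemma rounded_sd_gt0 : 0 < rounded_sd n. Proof. by rewrite sqrtr_gt0. Qed.

Lemma cells_sum t : \sum_i ccoord i (cells n t i) = rounded_sum n t.
Proof.
rewrite /rounded_sum /centred_sum mulr_suml; apply: eq_bigr => i _.
by rewrite /ccoord /centred /rounded /round ffunE.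
Qed.

Lemma cvar1 : Ex cmass (fun w => (\sum_i ccoord i (w i)) ^+ 2) = 1.
Proof.
rewrite (@eq_Ex _ _ cmass _ (fun w : {ffun I -> D} => (\sum_i (cval R (w i) - rounded_mean n i)) ^+ 2 * (rounded_var n)^-1)).
  rewrite ExZr Ex_cells.
  have -> : \int[P]_t (\sum_i (cval R (cells n t i) - rounded_mean n i)) ^+ 2 = rounded_var n.
    apply: eq_Rintegral => t _; congr (_ ^+ 2); apply: eq_bigr => i _.
    by rewrite /centred /rounded /round ffunE.
  by rewrite divff // gt_eqF.
by move=> w; rewrite -mulr_suml exprMn exprVn rounded_sd_sqr.
Qed.

(** A function of the coordinates in [A] factors through [restrict A], which has finitely many
  values; so independence is needed only for the events [restrict A (cells n t) = u]. *)
Definition restrict (A : {set I}) (w : {ffun I -> D}) : {ffun I -> D} :=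
  [ffun i => if i \in A then w i else ord0].

Lemma dep_restrict (A : {set I}) (f : {ffun I -> D} -> R) w : dep A f -> f w = f (restrict A w).
Proof. by move=> dA; apply: dA => i iA; rewrite ffunE iA. Qed.

(** A finite intersection of events of the form [cell n (x i t) = k] with [i] in [A]. *)
Lemma restrict_sigma (A : {set I}) u :
  sigma_family x [set i | i \in A] ((fun t => restrict A (cells n t)) @^-1` [set u]).
Proof.
set G := \bigcup_(i in [set i | i \in A]) preimage_set_system setT (x i) measurable.
have -> : (fun t => restrict A (cells n t)) @^-1` [set u] =
   \bigcap_(i in [set: I]) [set t | (if i \in A then cell n (x i t) else ord0) = u i].
  apply/seteqP; split => [t /= <- i _ /=|t H]; first by rewrite !ffunE.
  by apply/ffunP => i; rewrite !ffunE; exact: (H i).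
apply: (@fin_bigcap_measurable _ (g_sigma_algebraType G)) => [|i _]; first exact: finite_finset.
case: (boolP (i \in A)) => iA.
  apply: sub_sigma_algebra; exists i => //; exists (cell n @^-1` [set u i]).
    exact: measurable_cell.
  by rewrite setTI.
have [e|e] := eqVneq (ord0 : D) (u i).
  by rewrite (_ : [set t | _] = setT); [exact: measurableT|apply/seteqP; split].
rewrite (_ : [set t | _] = set0); first exact: measurable0.
by apply/seteqP; split => t //= h; rewrite h eqxx in e.
Qed.

Lemma sigma_measurable (A : set I) (S0 : set T) : sigma_family x A S0 -> dd.-measurable S0.
Proof.
apply; split; first exact: sigma_algebra_measurable.
move=> B [i _ [C mC <-]]; exact: xm.
Qed.

Lemma cindep (A B : {set I}) (f g : {ffun I -> D} -> R) :
  (forall i j, i \in A -> j \in B -> (m < dst i j)%N) -> dep A f -> dep B g ->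
  Ex cmass (fun w => f w * g w) = Ex cmass f * Ex cmass g.
Proof.
move=> AB dA dB; rewrite !Ex_cells.
have mr (C : {set I}) u : measurable ((fun t => restrict C (cells n t)) @^-1` [set u]).
  exact: sigma_measurable (@restrict_sigma C u).
have ind u v : P ((fun t => restrict A (cells n t)) @^-1` [set u] `&`
      (fun t => restrict B (cells n t)) @^-1` [set v]) =
    (P ((fun t => restrict A (cells n t)) @^-1` [set u]) *
     P ((fun t => restrict B (cells n t)) @^-1` [set v]))%E.
  exact: (xindep AB (@restrict_sigma A u) (@restrict_sigma B v)).
have := Ex_law_indep f g (mr A) (mr B) ind.
rewrite [X in X = _](_ : _ = \int[P]_t (f (cells n t) * g (cells n t))); last first.
  by apply: eq_Rintegral => t _; rewrite -(dep_restrict (cells n t) dA) -(dep_restrict (cells n t) dB).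
rewrite [X in _ = X * _](_ : _ = \int[P]_t f (cells n t)); last first.
  by apply: eq_Rintegral => t _; rewrite -(dep_restrict (cells n t) dA).
rewrite [X in _ = _ * X](_ : _ = \int[P]_t g (cells n t)) //.
by apply: eq_Rintegral => t _; rewrite -(dep_restrict (cells n t) dB).
Qed.

Definition cfield : lfield R :=
  @LField R I D cmass ccoord dst m p kap cmass_ge0 cmass1 dst_sym dst_refl dst_tri
   cindep cmean0 cvar1 hp card_bd.

Lemma Pr_cfield (B : R -> bool) : Pr (fun w : conf cfield => B (W w)) = fine (P [set t | B (rounded_sum n t)]).
Proof.
rewrite /Pr /E [LHS](Ex_law_prob P (@measurable_cells n) (fun w => B (\sum_i ccoord i (w i)))).
by congr (fine (P _)); apply/seteqP; split => t /=; rewrite cells_sum.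
Qed.

Lemma Gam_cfield : Gam cfield = kap `^ (p - 1) * (rounded_sd n `^ (- p) * \sum_i centred_absmom n i).
Proof.
rewrite /Gam /gam /=; congr (_ * _); rewrite mulr_sumr; apply: eq_bigr => i _.
rewrite /E /= Ex_cells /centred_absmom -RintegralZl //.
  apply: eq_Rintegral => t _; rewrite /X /= /ccoord ffunE -/(round n (x i t)) -/(rounded n i t) -/(centred n i t).
  by rewrite normrM normfV (gtr0_norm rounded_sd_gt0) mulrC powRM // ?invr_ge0 ?(ltW rounded_sd_gt0) // -powR_inv1 ?(ltW rounded_sd_gt0) // -powRrM mulN1r.
apply: integrable_le integrable_dom _.
  apply: (measurableT_comp (measurable_powR p)).
  by apply: measurableT_comp => //; exact: measurable_centred.
move=> t; rewrite ger0_norm ?powR_ge0 //; apply: le_trans (majp_dom t).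
by rewrite ge0_ler_powR ?nnegrE ?maj_ge0 ?(ltW p0) // centred_maj.
Qed.

End FiniteField.

Definition rounded_Gam n : R := kap `^ (p - 1) * (rounded_sd n `^ (- p) * \sum_i centred_absmom n i).
Definition field_Gam : R := kap `^ (p - 1) * \sum_i \int[P]_t (`|x i t| `^ p).

Lemma rounded_Gam_cvg : rounded_Gam n @[n --> \oo] --> field_Gam.
Proof.
apply: cvgM; first exact: cvg_cst.
rewrite -[X in _ --> X]mul1r; apply: cvgM.
  have -> : 1 = 1 `^ (- p) :> R by rewrite powR1.
  apply: (cvg_continuous (f := fun y : R => y `^ (- p)) _ rounded_sd_cvg).
  exact: continuous_powR.
by apply: cvg_finsum => i; exact: centred_absmom_cvg.
Qed.

Lemma rounded_var_pos : \forall n \near \oo, 0 < rounded_var n.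
Proof. exact: (cvgr_gt 1 rounded_var_cvg 0 ltr01). Qed.

Lemma measurable_le (f : T -> R) z : measurable_fun setT f -> measurable [set t | f t <= z].
Proof.
move=> mf; have -> : [set t | f t <= z] = setT `&` f @^-1` `]-oo, z]%classic.
  by rewrite setTI; apply/seteqP; split => t /=; rewrite in_itv.
by apply: mf => //; exact: measurable_itv.
Qed.

Lemma measurable_lt (f : T -> R) z : measurable_fun setT f -> measurable [set t | f t < z].
Proof.
move=> mf; have -> : [set t | f t < z] = setT `&` f @^-1` `]-oo, z[%classic.
  by rewrite setTI; apply/seteqP; split => t /=; rewrite in_itv.
by apply: mf => //; exact: measurable_itv.
Qed.

Lemma prob_subU (A B C : set T) : measurable A -> measurable B -> measurable C ->
  A `<=` B `|` C -> fine (P A) <= fine (P B) + fine (P C).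
Proof.
move=> mA mB mC ABC; rewrite -fineD ?fin_num_measure //.
apply: fine_le; rewrite ?fin_numD ?fin_num_measure //.
by apply: le_trans (measureU2 _ mB mC); apply: le_measure ABC; rewrite inE //; exact: measurableU.
Qed.

Lemma Phi_continuous : continuous (@Phi R).
Proof.
move=> z; apply: differentiable_continuous; apply/derivable1_diffP.
have h := der_Phi z; exact: ex_derive.
Qed.

(** For fixed [e > 0] compare the distribution function of the limit at [z] with those of the
  rounded sums at [z + e] and [z - e]; the difference is at most the probability of [far_event e],
  which tends to [0].  Then let [e] tend to [0], by continuity of [Phi] and [b]. *)
Theorem field_bound (b : R -> R) : continuous b ->
  (forall (F : lfield R) y, expo F = p ->
     Pr (fun w : conf F => W w <= y) - Phi y <= b y * Gam F /\
     Phi y - Pr (fun w : conf F => W w < y) <= b y * Gam F) ->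
  forall z, `|fine (P [set t | xsum t <= z]) - Phi z| <= b z * field_Gam.
Proof.
move=> cb H z.
pose u e := Phi (z + e) + b (z + e) * field_Gam.
pose l e := Phi (z - e) - b (z - e) * field_Gam.
have mz : measurable [set t | xsum t <= z] by exact: measurable_le measurable_xsum.
have up e : 0 < e -> fine (P [set t | xsum t <= z]) <= u e.
  move=> e0; have lim : Phi (z + e) + b (z + e) * rounded_Gam n + fine (P (far_event e n)) @[n --> \oo] --> u e.
    rewrite -[u e]addr0; apply: cvgD; last exact: far_event_cvg.
    by apply: cvgD; [exact: cvg_cst|apply: cvgM; [exact: cvg_cst|exact: rounded_Gam_cvg]].
  apply: (ler_cvg_to (cvg_cst _) lim); near=> n.
  have v0 : 0 < rounded_var n by near: n; exact: rounded_var_pos.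
  have [h _] := H (cfield v0) (z + e) erefl.
  rewrite (Pr_cfield v0 (fun y => y <= z + e)) Gam_cfield -/(rounded_Gam n) in h.
  apply: (@le_trans _ _ (fine (P [set t | rounded_sum n t <= z + e]) + fine (P (far_event e n)))); last first.
    by rewrite lerD2r; lra.
  apply: prob_subU => //; [exact: measurable_le (@measurable_rounded_sum n)|exact: measurable_far_event|].
  move=> t /= xz; have [wz|wz] := leP (rounded_sum n t) (z + e); [by left|right].
  by rewrite /far_event /= distrC; apply: lt_le_trans (ler_norm _); lra.
have lo e : 0 < e -> l e <= fine (P [set t | xsum t <= z]).
  move=> e0; have lim : Phi (z - e) - b (z - e) * rounded_Gam n - fine (P (far_event e n)) @[n --> \oo] --> l e.
    rewrite -[l e]subr0; apply: cvgB; last exact: far_event_cvg.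
    by apply: cvgB; [exact: cvg_cst|apply: cvgM; [exact: cvg_cst|exact: rounded_Gam_cvg]].
  apply: (ler_cvg_to lim (cvg_cst _)); near=> n.
  have v0 : 0 < rounded_var n by near: n; exact: rounded_var_pos.
  have [_ h] := H (cfield v0) (z - e) erefl.
  rewrite (Pr_cfield v0 (fun y => y < z - e)) Gam_cfield -/(rounded_Gam n) in h.
  have : fine (P [set t | rounded_sum n t < z - e]) <= fine (P [set t | xsum t <= z]) + fine (P (far_event e n)).
    apply: prob_subU => //; [exact: measurable_lt (@measurable_rounded_sum n)|exact: measurable_far_event|].
    move=> t /= wz; have [xz|xz] := leP (xsum t) z; [by left|right].
    by rewrite /far_event /=; apply: lt_le_trans (ler_norm _); lra.
  lra.
have cu : u e @[e --> 0^'+] --> Phi z + b z * field_Gam.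
  apply: cvg_at_right_filter; rewrite (_ : Phi z + b z * field_Gam = Phi (z + 0) + b (z + 0) * field_Gam) ?addr0 //.
  have cz : continuous (fun y => Phi y + b y * field_Gam).
    by move=> y; apply: cvgD; [exact: Phi_continuous|apply: cvgM; [exact: cb|exact: cvg_cst]].
  have sz : z + e @[e --> 0] --> z + 0 by apply: cvgD; [exact: cvg_cst|exact: cvg_id].
  rewrite -[in X in _ --> X](addr0 z); exact: (cvg_comp _ _ sz (cz (z + 0))).
have cl : l e @[e --> 0^'+] --> Phi z - b z * field_Gam.
  apply: cvg_at_right_filter; rewrite (_ : Phi z - b z * field_Gam = Phi (z - 0) - b (z - 0) * field_Gam) ?subr0 //.
  have cz : continuous (fun y => Phi y - b y * field_Gam).
    by move=> y; apply: cvgB; [exact: Phi_continuous|apply: cvgM; [exact: cb|exact: cvg_cst]].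
  have sz : z - e @[e --> 0] --> z - 0 by apply: cvgB; [exact: cvg_cst|exact: cvg_id].
  rewrite -[in X in _ --> X](subr0 z); exact: (cvg_comp _ _ sz (cz (z - 0))).
have hu : fine (P [set t | xsum t <= z]) <= Phi z + b z * field_Gam.
  by apply: (ler_cvg_to (cvg_cst _) cu); near=> e; exact: up.
have hl : Phi z - b z * field_Gam <= fine (P [set t | xsum t <= z]).
  by apply: (ler_cvg_to cl (cvg_cst _)); near=> e; exact: lo.
by rewrite ler_norml; apply/andP; split; lra.
Unshelve. all: by end_near. Qed.

End Approximation.


(** * The lattice *)

Section Lattice.
Variable d : nat.
Implicit Types i j k : lattice d.

Lemma lattice_dist_sym i j : lattice_dist i j = lattice_dist j i.
Proof. by apply: eq_bigr => l _; rewrite distnC. Qed.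

Lemma lattice_dist_refl i : lattice_dist i i = 0%N.
Proof. by apply: big1 => l _; rewrite distnn. Qed.

Lemma lattice_dist_coord i j l : (`|val (i l) - val (j l)| <= lattice_dist i j)%N.
Proof. exact: (@leq_bigmax _ (fun l => `|val (i l) - val (j l)|%N)). Qed.

Lemma lattice_dist_tri i j k : (lattice_dist i k <= lattice_dist i j + lattice_dist j k)%N.
Proof.
apply/bigmax_leqP => l _; apply: leq_trans (leqD_dist _ (val (j l)) _) _.
by apply: leq_add; exact: lattice_dist_coord.
Qed.

(** The ball is contained in a cube with [2 * r + 1] points on each side. *)
Lemma card_lattice_ball (J : {fset lattice d}) (i : J) (r : nat) :
  (#|[set j : J | (lattice_dist (val i) (val j) <= r)%N]%SET| <= (2 * r).+1 ^ d)%N.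
Proof.
set A := [set j | _]%SET.
pose g (j : J) : {ffun 'I_d -> 'I_(2 * r).+1} :=
  [ffun l => inord (val (val j l) + r - val (val i l))].
have near (j : J) l : j \in A ->
    (val (val i l) <= val (val j l) + r)%N /\ (val (val j l) <= val (val i l) + r)%N.
  rewrite inE => jA; have := leq_trans (lattice_dist_coord (val i) (val j) l) jA.
  by move: (val (val i l)) (val (val j l)) => a b; lia.
have inj : {in A &, injective g}.
  move=> j j' jA j'A /ffunP gg; apply: val_inj; apply/ffunP => l; apply: val_inj.
  have := congr1 val (gg l); rewrite !ffunE /=.
  have [/= h1 h2] := near j l jA; have [/= h3 h4] := near j' l j'A.
  move: h1 h2 h3 h4; set a := sval (fsval j l); set b := sval (fsval j' l).
  move: (sval (fsval i l)) => e h1 h2 h3 h4.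
  by rewrite !inordK; lia.
rewrite -(card_in_imset inj); apply: leq_trans (max_card _) _.
by rewrite card_ffun !card_ord.
Qed.

End Lattice.

Section Field.
Variables (R : realType) (d m : nat) (J : {fset lattice d}).
Context (disp : measure_display) (T : measurableType disp) (P : probability T R).
Variables (X : lattice d -> {RV P >-> R}) (p : R).
Hypothesis hp : 2 < p <= 3.
Hypothesis hdep : m_dependent m J X.
Hypothesis hmean : forall i, i \in J -> ('E_P[X i] = 0)%E.
Hypothesis hmom : forall i, i \in J -> (abs_moment p (X i) < +oo)%E.
Hypothesis hvar : ('V_P[field_sum J X] = 1)%E.

Let I : finType := J.
Let x (i : I) : {RV P >-> R} := X (val i).
Let kap : R := (10 * m + 1)%:R ^+ d.

Lemma mem_site (i : I) : val i \in J. Proof. exact: fsvalP. Qed.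

Lemma field_moment (i : I) : P.-integrable setT (EFin \o (fun t => `|x i t| `^ p)).
Proof.
apply/integrableP; split.
  apply/measurable_EFinP; apply: (measurableT_comp (measurable_powR p)).
  by apply: measurableT_comp => //; exact: measurable_funPT.
have := hmom (mem_site i); rewrite /abs_moment unlock; apply: le_lt_trans.
rewrite le_eqVlt; apply/orP; left; apply/eqP; apply: eq_integral => t _ /=.
by rewrite ger0_norm ?powR_ge0.
Qed.

Lemma field_mean (i : I) : \int[P]_t x i t = 0.
Proof. by rewrite /Rintegral; have := hmean (mem_site i); rewrite unlock => ->. Qed.

Lemma field_sumE t : field_sum J X t = \sum_i x i t.
Proof.
rewrite /field_sum -(big_seq_fsetE _ _ predT (fun j => X j t)) /=.
elim: (enum_fset J) => [|j s IH]; first by rewrite !big_nil.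
by rewrite !big_cons /= -IH.
Qed.

Lemma field_dep (A B : {set I}) :
  (forall i j, i \in A -> j \in B -> (m < lattice_dist (val i) (val j))%N) ->
  indep_families x [set i | i \in A] [set j | j \in B].
Proof.
move=> AB S1 S2.
have fam (C : {set I}) : sigma_family x [set i | i \in C] =
    sigma_family X (val @` [set i | i \in C]).
  by rewrite /sigma_family bigcup_image.
rewrite !fam; apply: hdep.
- by move=> _ [i _ <-]; exact: mem_site.
- by move=> _ [i _ <-]; exact: mem_site.
apply: (@lt_le_trans _ _ (m.+1%:R%:E)); first by rewrite lte_fin ltr_nat.
apply: le_ereal_inf_tmp => _ [_ [i iA <-]] [_ [j jB <-]] <-.
by rewrite lee_fin ler_nat; exact: AB.
Qed.

Lemma field_card (i : I) :
  (#|[set j : I | (lattice_dist (val i) (val j) <= 5 * m)%N]%SET|)%:R <= kap.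
Proof.
rewrite /kap -natrX ler_nat; apply: leq_trans (card_lattice_ball i (5 * m)) _.
by have -> : (2 * (5 * m)).+1 = (10 * m + 1)%N by lia.
Qed.


Lemma field_sum_mean : ('E_P[field_sum J X] = 0)%E.
Proof.
rewrite unlock; have ix := integrable_x hp field_moment.
have -> : (\int[P]_t (field_sum J X t)%:E = \int[P]_t \sum_(i : I) (x i t)%:E)%E.
  by apply: eq_integral => t _; rewrite field_sumE sumEFin.
rewrite (integral_sum measurableT ix) big1 // => i _.
by have := hmean (mem_site i); rewrite unlock.
Qed.

Lemma field_var : \int[P]_t ((\sum_i x i t) ^+ 2) = 1.
Proof.
have := hvar; rewrite /variance covariance.unlock field_sum_mean /= expectation.unlock => H.
rewrite /Rintegral -[RHS]/(fine 1%:E) -H; congr fine.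
apply: eq_integral => t _.
rewrite -[RHS]/(((field_sum J X t - 0) * (field_sum J X t - 0))%:E).
by rewrite field_sumE subr0 expr2.
Qed.

Lemma cdf_field z : cdf (field_sum J X) z = (fine (P [set t | xsum x t <= z]))%:E.
Proof.
have e : [set t | xsum x t <= z] = field_sum J X @^-1` `]-oo, z]%classic.
  by apply/seteqP; split => t /=; rewrite in_itv /= field_sumE.
by rewrite fineK ?fin_num_measure // e // -[X in measurable X]setTI; apply: measurable_funPT.
Qed.

Lemma sum_abs_moment :
  (\sum_(i <- J) abs_moment p (X i) = (\sum_i \int[P]_t (`|x i t| `^ p))%:E)%E.
Proof.
rewrite big_seq_fsetE /= -sumEFin; apply: eq_bigr => i _.
rewrite /abs_moment unlock /Rintegral fineK //.
exact: integrable_fin_num (field_moment i).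
Qed.

Lemma cube_powR : kap `^ (p - 1) = (10 * m + 1)%:R `^ ((p - 1) * d%:R).
Proof. by rewrite /kap -powR_mulrn ?ler0n // -powRrM mulrC. Qed.

Theorem field_sum_bound (b : R -> R) : continuous b ->
  (forall (F : lfield R) y, expo F = p ->
     Pr (fun w : conf F => W w <= y) - Phi y <= b y * Gam F /\
     Phi y - Pr (fun w : conf F => W w < y) <= b y * Gam F) ->
  forall z, (`|cdf (field_sum J X) z - std_normal_cdf z| <=
    (b z * (10 * m + 1)%:R `^ ((p - 1) * d%:R))%:E * \sum_(i <- J) abs_moment p (X i))%E.
Proof.
move=> cb H z; rewrite cdf_field std_normal_cdfE sum_abs_moment.
rewrite -EFinB /= -EFinM lee_fin -cube_powR -mulrA.
apply: (@field_bound _ _ _ P I x p kap (fun i j => lattice_dist (val i) (val j)) m hp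
  field_moment field_mean field_var _ _ _ field_dep field_card b cb H).
- by move=> i j; exact: lattice_dist_sym.
- by move=> i; exact: lattice_dist_refl.
- by move=> i j k; exact: lattice_dist_tri.
Qed.

End Field.

Lemma continuous_decay (R : realType) (C p : R) : continuous (fun y : R => C * (1 + `|y|) `^ (- p)).
Proof.
move=> y; apply: cvgM; first exact: cvg_cst.
have h : 1 + `|t| @[t --> y] --> 1 + `|y|.
  by apply: cvgD; [exact: cvg_cst|exact: norm_continuous].
apply: (cvg_comp (fun t => 1 + `|t|) (fun u => u `^ (- p)) h).
by apply: continuous_powR; rewrite ltr_pwDl.
Qed.

(** [10 * m + 1 <= 10 * (m + 1)], and [10 `^ ((p - 1) * d) <= 19 `^ (p * d)]. *)
Lemma side_le (R : realType) (p : R) (d m : nat) : 2 < p ->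
  (10 * m + 1)%:R `^ ((p - 1) * d%:R) <=
  19 `^ (p * d%:R) * (m + 1)%:R `^ ((p - 1) * d%:R) :> R.
Proof.
move=> p2; have e0 : 0 <= (p - 1) * d%:R by rewrite mulr_ge0 //; lra.
apply: (@le_trans _ _ ((10 * (m + 1)%:R) `^ ((p - 1) * d%:R))).
  apply: ge0_ler_powR; rewrite ?nnegrE ?mulr_ge0 //.
    lra.
  by rewrite -natrM ler_nat; lia.
rewrite powRM // ler_wpM2r ?powR_ge0 //.
apply: (@le_trans _ _ (19 `^ ((p - 1) * d%:R))).
  by rewrite ge0_ler_powR ?nnegrE //; lra.
by rewrite ler_powR ?ler1n // ler_wpM2r //; lra.
Qed.

Theorem theorem2p6 (R : realType) :
  exists C : R,
  forall (d : nat) (hd : (1 <= d)%N) (m : nat) (J : {fset lattice d})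
    (disp : measure_display) (T : measurableType disp) (P : probability T R)
    (X : lattice d -> {RV P >-> R}) (p : R)
    (hp : 2 < p <= 3)
    (hdep : m_dependent m J X)
    (hmean : forall i, i \in J -> ('E_P[X i] = 0)%E)
    (hmom : forall i, i \in J -> (abs_moment p (X i) < +oo)%E)
    (hvar : ('V_P[field_sum J X] = 1)%E),
  (ereal_sup [set `|cdf (field_sum J X) z - std_normal_cdf z|%E | z in [set: R]]
     <= (75 * (10 * m + 1)%:R `^ ((p - 1) * d%:R))%:E
        * \sum_(i <- J) abs_moment p (X i))%E
  /\
  forall z : R,
    (`|cdf (field_sum J X) z - std_normal_cdf z|
       <= (C * (1 + `|z|) `^ (- p) * 19 `^ (p * d%:R)
           * (m + 1)%:R `^ ((p - 1) * d%:R))%:E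
          * \sum_(i <- J) abs_moment p (X i))%E.
Proof.
have [C C0 HC] := finite_nonuniform R; exists C.
move=> d hd m J disp T P X p hp hdep hmean hmom hvar.
have p2 : 2 < p by case/andP: hp.
split.
  apply: ge_ereal_sup => _ [z _ <-].
  apply: (field_sum_bound hp hdep hmean hmom hvar (b := fun=> 75)) => [y|F y _].
    exact: cvg_cst.
  exact: uniform_bound.
move=> z; apply: le_trans (field_sum_bound hp hdep hmean hmom hvar
  (b := fun y => C * (1 + `|y|) `^ (- p)) _ _ z) _.
- exact: continuous_decay.
- by move=> F y Fp; rewrite -Fp -!mulrA; exact: HC.
apply: lee_wpmul2r; first by apply: sume_ge0 => i _; rewrite /abs_moment unlock integral_ge0 // => t _; rewrite lee_fin powR_ge0.
by rewrite lee_fin -(mulrA _ (19 `^ _)) ler_wpM2l ?mulr_ge0 ?powR_ge0 // side_le.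
Qed.
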